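(* Let $\mathcal{X}=(X,S)$ be a linearly recurrent subshift on $\mathbb{Z}_{\ge1}$. Then every element of $\mathcal{C}_{\mathcal{X}}$ is either a quadratic irrational or a transcendental number.
   Context: Let $S$ be the shift on $\mathbb{Z}_{\ge1}^{\mathbb{Z}_{\ge1}}$, $S((a_n)_{n\ge1})=(a_n)_{n\ge2}$. A subshift on $\mathbb{Z}_{\ge1}$ is a pair $(X,S)$ with $X\subset \mathbb{Z}_{\ge1}^{\mathbb{Z}_{\ge1}}$ and $S(X)\subset X$. For a finite word $W$, the cylinder $\langle W\rangle$ is the set of sequences in $X$ beginning with $W$. A subshift $(X,S)$ is linearly recurrent if it is minimal and there is a positive constant $c$ such that for each cylinder $\langle W\rangle$, the return time to $\langle W\rangle$ under $S$ is bounded by $c|W|$ (i.e., for every $x\in\langle W\rangle$ there is $1\le k\le c|W|$ with $S^kx\in\langle W\rangle$). The set $\mathcal{C}_{\mathcal{X}}$ is the set of $\alpha\in(0,1)$ with $\alpha=[0;a_1,a_2,\ldots]$ such that $(a_n)_{n\ge1}\in X$. *)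

(* Defs.v *)
From HB Require Import structures.
From mathcomp Require Import all_boot all_order all_algebra.
From mathcomp Require Import all_classical all_reals all_analysis.

Set Implicit Arguments.
Unset Strict Implicit.
Unset Printing Implicit Defensive.

Import Order.TTheory GRing.Theory Num.Theory.
Import numFieldNormedType.Exports.

Local Open Scope classical_set_scope.
Local Open Scope ring_scope.

(* Sequences a_1, a_2, ... are indexed from 0, so that [a n] is a_{n+1}.
   [int_seq] carries the product topology of the discrete topology on nat. *)
Notation int_seq := {ptws nat -> nat}.

Definition shift (a : int_seq) : int_seq := fun n => a n.+1.

Definition pos_seqs : set int_seq := [set a | forall n, (0 < a n)%N].

Definition subshift (X : set int_seq) : Prop :=
  X `<=` pos_seqs /\ shift @` X `<=` X.

(* X is not assumed closed in the space of all sequences: "closed" below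
   refers to the topology induced on X. *)
Definition minimal (X : set int_seq) : Prop :=
  forall Y : set int_seq, Y `<=` X -> closed (Y : set (subspace X)) ->
    shift @` Y `<=` Y -> Y = set0 \/ Y = X.

Definition cylinder (X : set int_seq) (W : seq nat) : set int_seq :=
  [set a | X a /\ mkseq a (size W) = W].

(* The empty word has to be excluded: no k satisfies 1 <= k <= c * 0. *)
Definition linearly_recurrent (R : realType) (X : set int_seq) : Prop :=
  minimal X /\
  exists c : R, 0 < c /\
    forall W : seq nat, W != [::] -> forall a, cylinder X W a ->
      exists k : nat, [/\ (1 <= k)%N, k%:R <= c * (size W)%:R
                        & cylinder X W (iter k shift a)].

(* [cf_convergent R a n] is the finite continued fraction [0; a_1, ..., a_n]. *)
Fixpoint cf_convergent (R : realType) (a : int_seq) (n : nat) : R :=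
  if n is m.+1 then ((a 0%N)%:R + cf_convergent R (shift a) m)^-1 else 0.

Definition cf_set (R : realType) (X : set int_seq) : set R :=
  [set alpha : R | 0 < alpha < 1 /\
     exists2 a : int_seq, X a & cf_convergent R a @ \oo --> alpha].

Definition quadratic_irrational (R : realType) (x : R) : Prop :=
  irrational x /\
  exists p : {poly rat}, size p = 3%N /\ root (map_poly ratr p) x.

Definition transcendental (R : realType) (x : R) : Prop :=
  ~ algebraicOver (ratr : rat -> R) x.

(* Main.v *)
(** Suppose that [alpha] is algebraic of degree at least 3.  For every [N], cut
    the sequence of partial quotients at the occurrences of its prefix of length
    about [N]: linear recurrence bounds the number of distinct return words by
    some [B] independent of [N].  In an ultrapower over [N] the matrices of the
    return words become [B] matrices of determinant [1] or [-1] with infinite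
    hyperinteger entries of comparable size, and [alpha] is the limit of the
    corresponding Moebius words.  Let [L] be the field generated by the entries.

    Each derivation [D] of [L] sends the convergents [r_J] to elements that are
    smaller than any power of the unit of scale: a Siegel construction gives a
    polynomial vanishing to high order along [alpha], and the Liouville
    inequality bounds it from below.  The logarithmic derivative [D(M) M^-1] of a
    word matrix [M] therefore nearly preserves the line of slope [alpha].  Its
    entries have bounded denominators, so the 3x3 determinants formed by such
    vectors and their derivatives vanish exactly, and these vectors are
    proportional to rational ones.  This produces a nontrivial rational relation
    between [1], [alpha] and [alpha^2], contradicting the degree, unless all
    derivations vanish on the entries, in which case the entries would be
    standard rationals although they are infinite. *)

From HB Require Import structures.
Require Import Defs.
From mathcomp Require Import all_boot all_order all_algebra.
From mathcomp Require Import all_classical all_reals all_analysis.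
From mathcomp Require Import perm ring lra zify.

Set Implicit Arguments.
Unset Strict Implicit.
Unset Printing Implicit Defensive.

Import Order.TTheory GRing.Theory Num.Theory.
Import numFieldNormedType.Exports.
Local Open Scope ring_scope.

(** The order of the choices shapes the proof. The bound [Q ^+ C1] on the effect of a derivation and
    the denominator [h] are fixed for the finite alphabet and a finite family of derivations; only
    then is the repetition length [L'] chosen, and it determines the length [j] of the word matrix
    [M]. Every estimate must therefore be uniform in the word. For sizes this comes from measuring
    words by the product of their [ld]; for denominators, from the integrality of [M] and of its
    inverse, the determinant being 1 or -1. The convergents [r_J] are too complex for a dimension
    count: their degree in the entries grows with [J]. A continued fraction with partial numerators
    of size [Q^-1] expresses them; its truncations have a degree linear in the precision, uniformly
    in [J]. Since the precision may be any multiple of the degree, the Liouville exponent suffices.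
    The auxiliary polynomial may vanish at [alpha]. A power [e] of the minimal polynomial is split
    off, and [k * e] derivatives undo it; the derivatives of order below [k] have to be negligible
    first, whence an induction on [k]. *)

(** * Subfields of an ambient field and their derivations *)

Section Subfield.
Variable F : numFieldType.

Record subfield (L : F -> Prop) : Prop := Subfield {
  subfield1 : L 1;
  subfieldB : forall x y, L x -> L y -> L (x - y);
  subfieldM : forall x y, L x -> L y -> L (x * y);
  subfieldV : forall x, L x -> L x^-1 }.

(** [D] is a total function constrained on [L] only, so that derivations can be iterated, added and
    commuted without a subtype. *)
Record derivation (L : F -> Prop) (D : F -> F) : Prop := Derivation {
  der_in : forall x, L x -> L (D x);
  derD : forall x y, L x -> L y -> D (x + y) = D x + D y;
  derM : forall x y, L x -> L y -> D (x * y) = D x * y + x * D y }.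

Variables (L : F -> Prop) (hL : subfield L).

Lemma subfield0 : L 0.
Proof. by rewrite -(subrr 1); apply: (subfieldB hL); apply: subfield1. Qed.

Lemma subfieldN x : L x -> L (- x).
Proof. by move=> Lx; rewrite -sub0r; apply: (subfieldB hL) => //; apply: subfield0. Qed.

Lemma subfieldD x y : L x -> L y -> L (x + y).
Proof.
by move=> Lx Ly; rewrite -[y]opprK; apply: (subfieldB hL) => //; apply: subfieldN.
Qed.

Lemma subfield_div x y : L x -> L y -> L (x / y).
Proof. by move=> Lx Ly; apply: (subfieldM hL) => //; apply: (subfieldV hL). Qed.

Lemma subfield_nat n : L n%:R.
Proof.
elim: n => [|n IH]; first exact: subfield0.
by rewrite -natr1; apply: subfieldD => //; apply: (subfield1 hL).
Qed.

Lemma subfield_rat (q : rat) : L (ratr q).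
Proof.
rewrite /ratr; apply: subfield_div.
  case: (numq q) => n; first exact: subfield_nat.
  by rewrite NegzE mulrNz; apply/subfieldN/subfield_nat.
by case: (denq q) => n; [apply: subfield_nat|
  rewrite NegzE mulrNz; apply/subfieldN/subfield_nat].
Qed.

Lemma subfieldX x n : L x -> L (x ^+ n).
Proof.
move=> Lx; elim: n => [|n IH]; first exact: (subfield1 hL).
by rewrite exprS; apply: (subfieldM hL).
Qed.

Lemma subfield_sum (I : Type) (r : seq I) (P : pred I) (f : I -> F) :
  (forall i, L (f i)) -> L (\sum_(i <- r | P i) f i).
Proof. by move=> Lf; elim/big_ind: _ => //; [apply: subfield0|apply: subfieldD]. Qed.

Lemma subfield_horner (p : {poly F}) x : (forall i, L p`_i) -> L x -> L p.[x].
Proof.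
move=> Lp Lx; rewrite horner_coef; apply: subfield_sum => i.
by apply: (subfieldM hL) => //; apply: subfieldX.
Qed.

Variables (D : F -> F) (hD : derivation L D).

Lemma der0 : D 0 = 0.
Proof.
have := derD hD subfield0 subfield0; rewrite addr0 => /eqP.
by rewrite -subr_eq0 opprD addrA subrr sub0r oppr_eq0 => /eqP.
Qed.

Lemma der1 : D 1 = 0.
Proof.
have L1 := subfield1 hL.
have := derM hD L1 L1; rewrite !mul1r mulr1 => /eqP.
by rewrite -subr_eq0 opprD addrA subrr sub0r oppr_eq0 => /eqP.
Qed.

Lemma derN x : L x -> D (- x) = - D x.
Proof.
move=> Lx; apply/eqP; rewrite -subr_eq0 opprK -(derD hD) ?addNr ?der0 //.
exact: subfieldN.
Qed.

Lemma derB x y : L x -> L y -> D (x - y) = D x - D y.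
Proof. by move=> Lx Ly; rewrite (derD hD) ?derN //; apply: subfieldN. Qed.

Lemma derV x : L x -> D x^-1 = - D x * x^-1 ^+ 2.
Proof.
move=> Lx; have [->|x0] := eqVneq x 0; first by rewrite invr0 der0 mulrC expr0n mul0r.
have := derM hD Lx (subfieldV hL Lx); rewrite mulfV // der1 => /eqP.
rewrite eq_sym addrC addr_eq0 => /eqP e.
by rewrite -[LHS]mul1r -(mulVf x0) -mulrA e; field.
Qed.

Lemma der_nat n : D n%:R = 0.
Proof.
elim: n => [|n IH]; first exact: der0.
by rewrite -natr1 (derD hD) ?IH ?der1 ?addr0 //; [apply: subfield_nat|apply: (subfield1 hL)].
Qed.

Lemma der_int (z : int) : D z%:~R = 0.
Proof.
case: z => n; first exact: der_nat.
by rewrite NegzE mulrNz derN ?der_nat ?oppr0 //; apply: subfield_nat.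
Qed.

Lemma subfield_int (z : int) : L z%:~R.
Proof.
case: z => n; first exact: subfield_nat.
by rewrite NegzE mulrNz; apply/subfieldN/subfield_nat.
Qed.

Lemma der_rat (q : rat) : D (ratr q) = 0.
Proof.
rewrite /ratr (derM hD) ?derV ?der_int ?oppr0 ?mul0r ?mulr0 ?addr0 //.
- exact: subfield_int.
- exact: subfield_int.
- by apply: (subfieldV hL); apply: subfield_int.
Qed.

End Subfield.

(** * Extension of derivations in characteristic zero *)

(* A derivation is a subring G of the dual numbers F[e]/(e^2), the pair (a, b)
   standing for a + b e, which meets (e) trivially and projects onto L. *)
Section DerivationExtension.
Variables (F : numFieldType) (L : F -> Prop) (hL : subfield L).

Record dual_subring (G : set (F * F)) : Prop := DualSubring {
  ds_in : forall a b, G (a, b) -> L a /\ L b;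
  ds_one : G (1, 0);
  ds_sub : forall a b c d, G (a, b) -> G (c, d) -> G (a - c, b - d);
  ds_mul : forall a b c d, G (a, b) -> G (c, d) -> G (a * c, b * c + a * d);
  ds_inj : forall b, G (0, b) -> b = 0 }.

(** The second component is the quotient rule; a dual number is invertible as soon as its first
    component is nonzero. *)
Definition dual_frac (G : set (F * F)) : set (F * F) :=
  [set z | exists a b d e, [/\ G (a, b), G (d, e), d != 0 &
    z = (a / d, (b * d - a * e) / d ^+ 2)]].

Lemma dual_frac_subring G : dual_subring G -> dual_subring (dual_frac G).
Proof.
move=> hG; split.
- move=> _ _ [a [b [d [e [Gab Gde d0 [-> ->]]]]]].
  have [La Lb] := ds_in hG Gab; have [Ld Le] := ds_in hG Gde.
  split; first exact: (subfield_div hL).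
  apply: (subfield_div hL); last exact: (subfieldX hL).
  by apply: (subfieldB hL); apply: (subfieldM hL).
- exists 1, 0, 1, 0; split; [exact: ds_one|exact: ds_one|exact: oner_neq0|].
  by rewrite divr1 mul0r mulr0 subrr mul0r.
- move=> _ _ _ _ [a [b [d [e [Gab Gde d0 [-> ->]]]]]] [a' [b' [d' [e' [Gab' Gde' d0' [-> ->]]]]]].
  exists (a * d' - a' * d), (b * d' + a * e' - (b' * d + a' * e)), (d * d'), (e * d' + d * e').
  split; [|exact: (ds_mul hG)|exact: mulf_neq0|].
    by apply: (ds_sub hG); apply: (ds_mul hG).
  by congr pair; field; rewrite d0 d0'.
- move=> _ _ _ _ [a [b [d [e [Gab Gde d0 [-> ->]]]]]] [a' [b' [d' [e' [Gab' Gde' d0' [-> ->]]]]]].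
  exists (a * a'), (b * a' + a * b'), (d * d'), (e * d' + d * e').
  split; [exact: (ds_mul hG)|exact: (ds_mul hG)|exact: mulf_neq0|].
  by congr pair; field; rewrite d0 d0'.
- move=> _ [a [b [d [e [Gab Gde d0 [a0 ->]]]]]].
  have {}a0 : a = 0 by rewrite -[a](mulfVK d0) -a0 mul0r.
  rewrite a0 in Gab; rewrite (ds_inj hG Gab) a0; field.
  exact: d0.
Qed.

Lemma sub_dual_frac G : dual_subring G -> (G `<=` dual_frac G)%classic.
Proof.
move=> hG [a b] Gab; exists a, b, 1, 0.
split; [by []|exact: ds_one|exact: oner_neq0|].
by rewrite divr1 mulr1 mulr0 subr0 expr1n divr1.
Qed.

Section Adjoin.
Variables (G : set (F * F)) (hG : dual_subring G).

Definition dual_poly (p q : {poly F}) := forall i, G (p`_i, q`_i).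

Lemma ds_zero : G (0, 0).
Proof. by have := ds_sub hG (ds_one hG) (ds_one hG); rewrite !subrr. Qed.

Lemma ds_add a b c d : G (a, b) -> G (c, d) -> G (a + c, b + d).
Proof.
move=> Gab Gcd; rewrite -[c]opprK -[d]opprK; apply: (ds_sub hG) => //.
by rewrite -sub0r -[X in (_, X)]sub0r; apply: (ds_sub hG) => //; apply: ds_zero.
Qed.

Lemma ds_sum (I : Type) (r : seq I) (f g : I -> F) :
  (forall i, G (f i, g i)) -> G (\sum_(i <- r) f i, \sum_(i <- r) g i).
Proof.
move=> h; elim: r => [|i r IH]; first by rewrite !big_nil; apply: ds_zero.
by rewrite !big_cons; apply: ds_add.
Qed.

Lemma dual_polyC a b : G (a, b) -> dual_poly a%:P b%:P.
Proof. by move=> h i; rewrite !coefC; case: eqP => // _; apply: ds_zero. Qed.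

Lemma dual_polyX : dual_poly 'X 0.
Proof. by move=> i; rewrite coefX coef0; case: eqP => _; [apply: ds_one|apply: ds_zero]. Qed.

Lemma dual_polyB p q p' q' :
  dual_poly p q -> dual_poly p' q' -> dual_poly (p - p') (q - q').
Proof. by move=> h h' i; rewrite !coefB; apply: (ds_sub hG). Qed.

Lemma dual_polyM p q p' q' :
  dual_poly p q -> dual_poly p' q' -> dual_poly (p * p') (q * p' + p * q').
Proof.
move=> h h' i; rewrite coefD !coefM -big_split /=; apply: ds_sum => j.
exact: (ds_mul hG).
Qed.

Lemma dual_polyXn n : dual_poly ('X^n) 0.
Proof.
elim: n => [|n IH]; first by rewrite expr0; apply: dual_polyC; apply: ds_one.
by have := dual_polyM dual_polyX IH; rewrite mul0r mulr0 addr0 -exprS.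
Qed.

Lemma dual_poly_deriv p q : dual_poly p q -> dual_poly (deriv p) (deriv q).
Proof.
have Gn a b n : G (a, b) -> G (a *+ n, b *+ n).
  move=> Gab; elim: n => [|n IH]; first by rewrite !mulr0n; apply: ds_zero.
  by rewrite !mulrS; apply: ds_add.
by move=> h i; rewrite !coef_deriv; apply: Gn.
Qed.

Variables (t u : F).

(** The pair [(p, q)] stands for a polynomial over the dual numbers. This is the second component of
    its value at [(t, u)], the first being [p.[t]]. *)
Definition dual_eval (p q : {poly F}) : F := q.[t] + (deriv p).[t] * u.

Definition dual_adjoin : set (F * F) :=
  [set z | exists p q, dual_poly p q /\ z = (p.[t], dual_eval p q)].

Hypotheses (Lt : L t) (Lu : L u).
Hypothesis inj : forall p q, dual_poly p q -> p.[t] = 0 -> dual_eval p q = 0.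

Lemma dual_evalM p q p' q' :
  dual_eval (p * p') (q * p' + p * q') =
  dual_eval p q * p'.[t] + p.[t] * dual_eval p' q'.
Proof. by rewrite /dual_eval derivM !hornerE; ring. Qed.

Lemma dual_adjoin_subring : dual_subring dual_adjoin.
Proof.
have Lpq p q : dual_poly p q -> (forall i, L p`_i) /\ (forall i, L q`_i).
  by move=> h; split=> i; have [] := ds_in hG (h i).
split.
- move=> _ _ [p [q [h [-> ->]]]]; have [Lp Lq] := Lpq _ _ h.
  have [Lp' _] := Lpq _ _ (dual_poly_deriv h).
  split; first exact: (subfield_horner hL).
  apply: (subfieldD hL); first exact: (subfield_horner hL).
  by apply: (subfieldM hL) => //; apply: (subfield_horner hL).
- exists 1%:P, 0%:P; split; first by apply: dual_polyC; apply: ds_one.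
  by rewrite /dual_eval derivC !hornerE.
- move=> _ _ _ _ [p [q [h [-> ->]]]] [p' [q' [h' [-> ->]]]].
  exists (p - p'), (q - q'); split; first exact: dual_polyB.
  by rewrite /dual_eval derivB !hornerE; congr pair; ring.
- move=> _ _ _ _ [p [q [h [-> ->]]]] [p' [q' [h' [-> ->]]]].
  exists (p * p'), (q * p' + p * q'); split; first exact: dual_polyM.
  by rewrite dual_evalM hornerM.
- by move=> b [p [q [h [p0 ->]]]]; apply: inj.
Qed.

Lemma sub_dual_adjoin : (G `<=` dual_adjoin)%classic.
Proof.
move=> [a b] Gab; exists a%:P, b%:P; split; first exact: dual_polyC.
by rewrite /dual_eval derivC !hornerE.
Qed.

Lemma dual_adjoin_gen : dual_adjoin (t, u).
Proof.
exists 'X, 0; split; first exact: dual_polyX.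
by rewrite /dual_eval derivX !hornerE.
Qed.

End Adjoin.

(** If [t] is a root of no nonzero polynomial over the first projection of [G], any [u] works.
    Otherwise a nonzero polynomial of least size vanishing at [t] forces [u]: its derivative is
    nonzero at [t] by minimality in characteristic zero. Division by it reaches every other
    polynomial vanishing at [t]. *)
Lemma dual_adjoin_exists G t : dual_subring G -> (dual_frac G `<=` G)%classic -> L t ->
  exists2 u, L u & forall p q, dual_poly G p q -> p.[t] = 0 -> dual_eval t u p q = 0.
Proof.
move=> hG Gfrac Lt.
have poly0 q : dual_poly G 0 q -> q = 0.
  by move=> h; apply/polyP => i; have := h i; rewrite coef0 => /(ds_inj hG).
have [algt|trt] := pselect (exists n, exists p q, [/\ dual_poly G p q, p != 0, p.[t] = 0 & size p = n]); last first.
  exists 0; first exact: (subfield0 hL).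
  move=> p q h pt; have [p0|p0] := eqVneq p 0; last by case: trt; exists (size p), p, q.
  by rewrite p0 in h *; rewrite (poly0 _ h) /dual_eval deriv0 !hornerE.
have {}algt : exists n, `[< exists p q, [/\ dual_poly G p q, p != 0, p.[t] = 0 & size p = n] >].
  by case: algt => n h; exists n; apply/asboolP.
case: (ex_minnP algt) => n /asboolP [p [q [hpq p0 pt szp]]] nmin.
have min f g : dual_poly G f g -> f != 0 -> f.[t] = 0 -> (size p <= size f)%N.
  by move=> h f0 ft; rewrite szp; apply: nmin; apply/asboolP; exists f, g.
have p't : (deriv p).[t] != 0.
  apply/negP => /eqP p't; have := dual_poly_deriv hG hpq => hp'.
  have szp1 : (1 < size p)%N.
    rewrite ltnNge; apply/negP => /size1_polyC ep; move: pt p0; rewrite ep hornerC.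
    by move=> ->; rewrite eqxx.
  have p'0 : (deriv p) != 0.
    apply/negP => /eqP e; have := congr1 (fun r : {poly F} => r`_(size p).-2) e.
    have e2 : ((size p).-2.+1 = (size p).-1)%N by case: (size p) szp1 => [|[]].
    rewrite coef_deriv coef0 e2 => /eqP; rewrite mulrn_eq0 -lead_coefE lead_coef_eq0.
    by rewrite (negbTE p0) orbF -e2.
  have := min _ _ hp' p'0 p't; rewrite leqNgt => /negP; apply.
  exact: lt_size_deriv.
exists (- q.[t] / (deriv p).[t]).
  have Lc f g : dual_poly G f g -> L f.[t] /\ L g.[t].
    by move=> h; split; apply: (subfield_horner hL) => // i; have [] := ds_in hG (h i).
  have [_ Lq] := Lc _ _ hpq; have [Lp' _] := Lc _ _ (dual_poly_deriv hG hpq).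
  by apply: (subfield_div hL) => //; apply: (subfieldN hL).
set u := - _ / _.
have pu : dual_eval t u p q = 0 by rewrite /dual_eval /u mulrC mulfVK // subrr.
move=> f g; elim: {f}_.+1 {-2}f g (ltnSn (size f)) => // k IH f g szf hfg ft.
have [f0|f0] := eqVneq f 0.
  by rewrite f0 in hfg *; rewrite (poly0 _ hfg) /dual_eval deriv0 !hornerE.
have szpf := min _ _ hfg f0 ft.
have lp0 : lead_coef p != 0 by rewrite lead_coef_eq0.
pose l := lead_coef f / lead_coef p.
(* Closure of [G] under fractions supplies a second component for the quotient of the leading
   coefficients, so the division step stays among dual polynomials. *)
have [l' Gl] : exists l', G (l, l').
  exists ((g`_(size f).-1 * lead_coef p - lead_coef f * q`_(size p).-1) / lead_coef p ^+ 2).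
  apply: Gfrac; exists (lead_coef f), (g`_(size f).-1), (lead_coef p), (q`_(size p).-1).
  by split; [apply: hfg|apply: hpq| |].
pose n' := (size f - size p)%N.
have hX := dual_polyM hG (dual_polyC hG Gl) (dual_polyXn hG n').
have := dual_polyB hG hfg (dual_polyM hG hX hpq).
set f1 := f - _; set g1 := g - _ => hf1.
have f1t : f1.[t] = 0 by rewrite /f1 !hornerE ft pt mulr0 subrr.
have szf1 : (size f1 < size f)%N.
  have szX : size (l%:P * 'X^n' * p) = size f.
    rewrite -mulrA mul_polyC size_scale; last by rewrite mulf_neq0 ?invr_eq0 // lead_coef_eq0.
    by rewrite mulrC size_mulXn // /n' subnK.
  have : (size f1 <= size f)%N.
    by rewrite (leq_trans (size_polyD _ _)) // size_polyN szX maxnn.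
  rewrite leq_eqVlt => /orP[/eqP e|//].
  have f10 : f1 != 0 by rewrite -size_poly_eq0 e size_poly_eq0.
  move: f10; rewrite -lead_coef_eq0 lead_coefE e /f1 coefB -lead_coefE.
  have -> : (l%:P * 'X^n' * p)`_(size f).-1 = lead_coef f.
    rewrite -szX -lead_coefE -mulrA mul_polyC lead_coefZ lead_coefM lead_coefXn mul1r.
    by rewrite /l mulfVK.
  by rewrite subrr eqxx.
have := IH _ _ (leq_trans szf1 szf) hf1 f1t.
have -> : dual_eval t u f1 g1 = dual_eval t u f g -
    dual_eval t u (l%:P * 'X^n' * p) ((l'%:P * 'X^n' + l%:P * 0) * p + l%:P * 'X^n' * q).
  by rewrite /dual_eval /f1 /g1 derivB !(hornerD, hornerN); ring.
by rewrite dual_evalM pt pu !mulr0 addr0 subr0.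
Qed.

(** Zorn's lemma on the graphs of partial derivations that send [x] to 1. A maximal graph is closed
    under fractions, and by [dual_adjoin_exists] it is defined at every element of [L]. *)
Lemma derivation_exists x : L x ->
  (forall p : {poly rat}, p != 0 -> (map_poly (ratr : rat -> F) p).[x] != 0) ->
  exists2 D, derivation L D & D x = 1.
Proof.
move=> Lx trx.
pose good G := dual_subring G /\ G (x, 1).
have [G [Ggood Gmax]] : exists G, [set G | G = set0 \/ good G]%classic G /\
    forall B, (G `<` B)%classic -> ~ (B = set0 \/ good B).
  apply: (@Zorn_bigcup _ [set G | G = set0 \/ good G]%classic) => C CP Ctot.
  have [[G0 [CG0 gG0]]|noC] := pselect (exists G0, C G0 /\ good G0); last first.
    left; rewrite predeqE => z; split=> // -[G CG Gz].
    by case: (CP _ CG) => [G0|gG]; [rewrite G0 in Gz|case: noC; exists G].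
  right; split; last by exists G0 => //; case: gG0.
  have inC G z : C G -> G z -> good G.
    by move=> CG Gz; case: (CP _ CG) => // G00; rewrite G00 in Gz.
  have two z z' : (\bigcup_(X in C) X)%classic z -> (\bigcup_(X in C) X)%classic z' ->
      exists G, [/\ C G, good G, G z & G z'].
    move=> [G1 C1 z1] [G2 C2 z2]; case: (Ctot _ _ C1 C2) => h.
      by exists G2; split=> //; [exact: inC z2|exact: h].
    by exists G1; split=> //; [exact: inC z1|exact: h].
  split.
  - by move=> a b [G CG Gab]; have [hG _] := inC _ _ CG Gab; apply: (ds_in hG).
  - by exists G0 => //; case: gG0 => h _; apply: (ds_one h).
  - move=> a b c d h h'; have [G [CG [hG _] h1 h2]] := two _ _ h h'.
    by exists G => //; apply: (ds_sub hG).
  - move=> a b c d h h'; have [G [CG [hG _] h1 h2]] := two _ _ h h'.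
    by exists G => //; apply: (ds_mul hG).
  - by move=> b [G CG Gab]; have [hG _] := inC _ _ CG Gab; apply: (ds_inj hG).
pose phi (p : {poly rat}) : {poly F} := map_poly ratr p.
(* The graph of formal differentiation on rational polynomials in [x]; it is a graph because no
   nonzero one vanishes at [x]. *)
pose G0 : set (F * F) := [set z | exists p, z = ((phi p).[x], (phi (deriv p)).[x])]%classic.
have gG0 : good G0.
  split; last by exists 'X; rewrite derivX /phi map_polyX hornerX rmorph1 hornerC.
  have Lphi p : L (phi p).[x].
    by apply: (subfield_horner hL) => // i; rewrite coef_map /=; apply: (subfield_rat hL).
  split.
  - by move=> _ _ [p [-> ->]].
  - by exists 1; rewrite derivC /phi rmorph1 rmorph0 !hornerE.
  - move=> _ _ _ _ [p [-> ->]] [q [-> ->]]; exists (p - q).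
    by rewrite derivB /phi !rmorphB /= !hornerE.
  - move=> _ _ _ _ [p [-> ->]] [q [-> ->]]; exists (p * q).
    by rewrite derivM /phi !rmorphD /= !rmorphM /= !hornerE.
  - move=> b [p [p0 ->]]; have [->|pn0] := eqVneq p 0; first by rewrite deriv0 /phi rmorph0 horner0.
    by have := trx _ pn0; rewrite -/(phi p) -p0 eqxx.
have {Ggood} [hG Gx] : good G.
  case: Ggood => // G00; exfalso; apply: (Gmax G0); last by right.
  rewrite G00; split; last by move=> /(_ (x, 1)) h; apply: h; case: gG0.
  by move=> z.
have max B : dual_subring B -> (G `<=` B)%classic -> (B `<=` G)%classic.
  move=> hB GB; apply: contrapT => nBG; apply: (Gmax B); first by split.
  by right; split=> //; apply: GB.
have Gfrac := max _ (dual_frac_subring hG) (sub_dual_frac hG).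
have tot t : exists u, L t -> G (t, u).
  have [Lt|nLt] := pselect (L t); last by exists 0.
  have [u Lu inj] := dual_adjoin_exists hG Gfrac Lt.
  exists u => _; have sub := max _ (dual_adjoin_subring hG Lt Lu inj).
  by apply: (sub (@sub_dual_adjoin _ hG _ _)); apply: dual_adjoin_gen.
have [D hD] := choice tot.
have uniq a b b' : G (a, b) -> G (a, b') -> b = b'.
  move=> h h'; have := ds_sub hG h h'; rewrite subrr => /(ds_inj hG) /eqP.
  by rewrite subr_eq0 => /eqP.
exists D; last exact: uniq (hD _ Lx) Gx.
split.
- by move=> y Ly; have [] := ds_in hG (hD _ Ly).
- move=> y z Ly Lz; apply: (uniq (y + z)); first exact/hD/(subfieldD hL).
  by apply: (ds_add hG); apply: hD.
- move=> y z Ly Lz; apply: (uniq (y * z)); first exact/hD/(subfieldM hL).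
  by apply: (ds_mul hG); apply: hD.
Qed.
End DerivationExtension.

(** * A free ultrafilter on the natural numbers *)

Lemma free_ultrafilter_exists : exists U : set_system nat,
  UltraFilter U /\ forall N, U [set n | (N <= n)%N]%classic.
Proof.
pose E : set_system nat := [set A | exists N, forall n, (N <= n)%N -> A n]%classic.
have PE : ProperFilter E.
  apply: Build_ProperFilter.
    by move=> [N /(_ N (leqnn N))].
  split; first by exists 0.
    move=> A B [N hA] [M hB]; exists (maxn N M) => n; rewrite geq_max => /andP[h1 h2].
    by split; [apply: hA|apply: hB].
  by move=> A B AB [N h]; exists N => n /h /AB.
have [U [UU EU]] := ultraFilterLemma PE.
by exists U; split=> // N; apply: EU; exists N.
Qed.

Definition ufilter : set_system nat := sval (cid free_ultrafilter_exists).

Lemma ufilter_ultra : UltraFilter ufilter.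
Proof. by have [] := svalP (cid free_ultrafilter_exists). Qed.

Lemma ufilter_tail N : ufilter [set n | (N <= n)%N]%classic.
Proof. by have [_ h] := svalP (cid free_ultrafilter_exists); apply: h. Qed.

#[local] Instance ufilter_proper : ProperFilter ufilter := @ultra_proper _ _ ufilter_ultra.

Definition uae (P : nat -> Prop) : Prop := ufilter [set n | P n]%classic.

Lemma uaeS (P Q : nat -> Prop) : (forall n, P n -> Q n) -> uae P -> uae Q.
Proof. by move=> PQ; apply: filterS. Qed.

Lemma uaeI (P Q : nat -> Prop) : uae P -> uae Q -> uae (fun n => P n /\ Q n).
Proof. exact: filterI. Qed.

Lemma uaeT (P : nat -> Prop) : (forall n, P n) -> uae P.
Proof. by move=> h; apply: (@uaeS (fun=> True)) => // ; apply: filterT. Qed.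

Lemma uae_ge N : uae (fun n => (N <= n)%N).
Proof. exact: ufilter_tail. Qed.

Lemma uae_ex (P : nat -> Prop) : uae P -> exists n, P n.
Proof. by move=> /filter_ex. Qed.

Lemma uae_em (P : nat -> Prop) : uae P \/ uae (fun n => ~ P n).
Proof. exact: in_ultra_setVsetC ufilter_ultra. Qed.

Lemma uae_not (P : nat -> Prop) : ~ uae P -> uae (fun n => ~ P n).
Proof. by case: (uae_em P). Qed.

Lemma uae_or (P Q : nat -> Prop) : uae (fun n => P n \/ Q n) -> uae P \/ uae Q.
Proof.
move=> PQ; case: (uae_em P) => [|nP]; [by left|right].
by apply: uaeS (uaeI PQ nP) => n [[]].
Qed.

(** This turns choices that depend on the level into a single one: a letter at each position, and
    later a return index. *)
Lemma uae_ord k (f : nat -> 'I_k) : exists i, uae (fun n => f n = i).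
Proof.
apply: contrapT => h.
have : uae (fun n => forall i, i \in enum 'I_k -> f n <> i).
  elim: (enum 'I_k) => [|j s IH]; first exact: uaeT.
  apply: uaeS (uaeI IH (uae_not (fun hj => h (ex_intro _ j hj)))) => n [h1 h2] i.
  by rewrite inE => /predU1P[->//|]; apply: h1.
by move=> /uae_ex [n /(_ (f n))]; apply; rewrite ?mem_enum.
Qed.

Lemma uae_forall_ltn (P : nat -> nat -> Prop) k :
  (forall i, (i < k)%N -> uae (P i)) -> uae (fun n => forall i, (i < k)%N -> P i n).
Proof.
elim: k => [|k IH] h; first exact: uaeT.
have hk : uae (P k) by apply: h.
have {}IH := IH (fun i ik => h i (ltnW ik)).
apply: uaeS (uaeI IH hk) => n [h1 h2] i; rewrite ltnS leq_eqVlt.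
by move=> /predU1P[->//|]; apply: h1.
Qed.

(** * The ultrapower of an ordered field *)

Section Hyperreals.
Variable R : realFieldType.

Definition ueq (f g : nat -> R) : bool := `[< uae (fun n => f n = g n) >].

Lemma ueq_refl : reflexive ueq.
Proof. by move=> f; apply/asboolP/uaeT. Qed.
Lemma ueq_sym : symmetric ueq.
Proof. by move=> f g; apply/asboolP/asboolP; apply: uaeS. Qed.
Lemma ueq_trans : transitive ueq.
Proof.
move=> g f h /asboolP fg /asboolP gh; apply/asboolP.
by apply: uaeS (uaeI fg gh) => n [-> ->].
Qed.

Canonical ueq_equiv := EquivRel ueq ueq_refl ueq_sym ueq_trans.

Definition hyper := {eq_quot ueq_equiv}%qT.

HB.instance Definition _ := Choice.on hyper.

Definition hyp (f : nat -> R) : hyper := (\pi_hyper f)%qT.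

Lemma hyp_surj (x : hyper) : exists f, x = hyp f.
Proof. by exists (repr x); rewrite /hyp reprK. Qed.

Lemma hypP f g : hyp f = hyp g <-> uae (fun n => f n = g n).
Proof. by split=> [/eqmodP/asboolP|h] //; apply/eqmodP/asboolP. Qed.

Lemma repr_hyp f : uae (fun n => repr (hyp f) n = f n).
Proof. by apply/hypP; rewrite /hyp reprK. Qed.

Definition hadd (x y : hyper) := hyp (fun n => repr x n + repr y n).
Definition hopp (x : hyper) := hyp (fun n => - repr x n).
Definition hmul (x y : hyper) := hyp (fun n => repr x n * repr y n).
Definition hinv (x : hyper) := hyp (fun n => (repr x n)^-1).
Definition hnorm (x : hyper) := hyp (fun n => `|repr x n|).
Definition hle (x y : hyper) : bool := `[< uae (fun n => repr x n <= repr y n) >].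
Definition hlt (x y : hyper) : bool := (y != x) && hle x y.

Lemma haddE f g : hadd (hyp f) (hyp g) = hyp (fun n => f n + g n).
Proof. by apply/hypP; apply: uaeS (uaeI (repr_hyp f) (repr_hyp g)) => n [-> ->]. Qed.
Lemma hoppE f : hopp (hyp f) = hyp (fun n => - f n).
Proof. by apply/hypP; apply: uaeS (repr_hyp f) => n ->. Qed.
Lemma hmulE f g : hmul (hyp f) (hyp g) = hyp (fun n => f n * g n).
Proof. by apply/hypP; apply: uaeS (uaeI (repr_hyp f) (repr_hyp g)) => n [-> ->]. Qed.
Lemma hinvE f : hinv (hyp f) = hyp (fun n => (f n)^-1).
Proof. by apply/hypP; apply: uaeS (repr_hyp f) => n ->. Qed.
Lemma hnormE f : hnorm (hyp f) = hyp (fun n => `|f n|).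
Proof. by apply/hypP; apply: uaeS (repr_hyp f) => n ->. Qed.
Lemma hleE f g : hle (hyp f) (hyp g) <-> uae (fun n => f n <= g n).
Proof.
split=> [/asboolP h|h]; last apply/asboolP;
  by apply: uaeS (uaeI h (uaeI (repr_hyp f) (repr_hyp g))) => n [h1 [h2 h3]]; move: h1; rewrite h2 h3.
Qed.

Lemma haddA : associative hadd.
Proof.
move=> x y z; have [f ->] := hyp_surj x; have [g ->] := hyp_surj y.
have [h ->] := hyp_surj z; rewrite !haddE; congr hyp.
by apply/funext => n; rewrite addrA.
Qed.
Lemma haddC : commutative hadd.
Proof.
move=> x y; have [f ->] := hyp_surj x; have [g ->] := hyp_surj y.
by rewrite !haddE; congr hyp; apply/funext => n; rewrite addrC.
Qed.
Lemma hadd0 : left_id (hyp (fun=> 0)) hadd.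
Proof.
move=> x; have [f ->] := hyp_surj x.
by rewrite haddE; congr hyp; apply/funext => n; rewrite add0r.
Qed.
Lemma haddN : left_inverse (hyp (fun=> 0)) hopp hadd.
Proof.
move=> x; have [f ->] := hyp_surj x.
by rewrite hoppE haddE; congr hyp; apply/funext => n; rewrite addNr.
Qed.
HB.instance Definition _ := GRing.isZmodule.Build hyper haddA haddC hadd0 haddN.

Lemma hmulA : associative hmul.
Proof.
move=> x y z; have [f ->] := hyp_surj x; have [g ->] := hyp_surj y.
have [h ->] := hyp_surj z; rewrite !hmulE; congr hyp.
by apply/funext => n; rewrite mulrA.
Qed.
Lemma hmulC : commutative hmul.
Proof.
move=> x y; have [f ->] := hyp_surj x; have [g ->] := hyp_surj y.
by rewrite !hmulE; congr hyp; apply/funext => n; rewrite mulrC.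
Qed.
Lemma hmul1 : left_id (hyp (fun=> 1)) hmul.
Proof.
move=> x; have [f ->] := hyp_surj x.
by rewrite hmulE; congr hyp; apply/funext => n; rewrite mul1r.
Qed.
Lemma hmulDl : left_distributive hmul hadd.
Proof.
move=> x y z; have [f ->] := hyp_surj x; have [g ->] := hyp_surj y.
have [h ->] := hyp_surj z; rewrite !(haddE, hmulE); congr hyp.
by apply/funext => n; rewrite mulrDl.
Qed.
Lemma hone_neq0 : hyp (fun=> 1) != hyp (fun=> 0).
Proof.
by apply/eqP => /hypP /uae_ex [n /eqP]; rewrite oner_eq0.
Qed.
HB.instance Definition _ :=
  GRing.Zmodule_isComNzRing.Build hyper hmulA hmulC hmul1 hmulDl hone_neq0.

Lemma hmulVf (x : hyper) : x != 0 -> hinv x * x = 1.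
Proof.
have [f ->] := hyp_surj x => /eqP f0; rewrite hinvE [LHS]hmulE; apply/hypP.
have : uae (fun n => f n <> 0) by apply: uae_not => h; apply/f0/hypP.
by apply: uaeS => n /eqP h; rewrite mulVf.
Qed.
Lemma hinv0 : hinv 0 = 0.
Proof. by rewrite [LHS]hinvE; congr hyp; apply/funext => n; rewrite invr0. Qed.
HB.instance Definition _ := GRing.ComNzRing_isField.Build hyper hmulVf hinv0.

Lemma hle0_add (x y : hyper) : hle 0 x -> hle 0 y -> hle 0 (x + y).
Proof.
have [f ->] := hyp_surj x; have [g ->] := hyp_surj y.
move=> /hleE f0 /hleE g0; apply/asboolP; rewrite [_ + _]haddE; apply/asboolP/hleE.
by apply: uaeS (uaeI f0 g0) => n [? ?]; apply: addr_ge0.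
Qed.
Lemma hle0_mul (x y : hyper) : hle 0 x -> hle 0 y -> hle 0 (x * y).
Proof.
have [f ->] := hyp_surj x; have [g ->] := hyp_surj y.
move=> /hleE f0 /hleE g0; apply/asboolP; rewrite [_ * _]hmulE; apply/asboolP/hleE.
by apply: uaeS (uaeI f0 g0) => n [? ?]; apply: mulr_ge0.
Qed.
Lemma hle0_anti (x : hyper) : hle 0 x -> hle x 0 -> x = 0.
Proof.
have [f ->] := hyp_surj x => /hleE f0 /hleE f1; apply/hypP.
by apply: uaeS (uaeI f0 f1) => n [? ?]; apply/eqP; rewrite eq_le; apply/andP.
Qed.
Lemma hsub_ge0 (x y : hyper) : hle 0 (y - x) = hle x y.
Proof.
have [f ->] := hyp_surj x; have [g ->] := hyp_surj y.
rewrite [- _]hoppE [_ + _]haddE; apply/idP/idP => /hleE h; apply/hleE;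
  by apply: uaeS h => n; rewrite subr_ge0.
Qed.
Lemma hle0_total (x : hyper) : hle 0 x || hle x 0.
Proof.
have [f ->] := hyp_surj x.
have : uae (fun n => 0 <= f n \/ f n <= 0).
  by apply: uaeT => n; apply/orP; apply: le_total.
by move=> /uae_or [] h; apply/orP; [left|right]; apply/hleE.
Qed.
Lemma hnormN (x : hyper) : hnorm (- x) = hnorm x.
Proof.
have [f ->] := hyp_surj x.
by rewrite [- _]hoppE !hnormE; congr hyp; apply/funext => n; rewrite normrN.
Qed.
Lemma hge0_norm (x : hyper) : hle 0 x -> hnorm x = x.
Proof.
have [f ->] := hyp_surj x => /hleE h; rewrite hnormE; apply/hypP.
by apply: uaeS h => n; apply: ger0_norm.
Qed.
Lemma hlt_def (x y : hyper) : hlt x y = (y != x) && hle x y.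
Proof. by []. Qed.
HB.instance Definition _ := Num.IntegralDomain_isLeReal.Build hyper
  hle0_add hle0_mul hle0_anti hsub_ge0 hle0_total hnormN hge0_norm hlt_def.

Definition hyperreal : realFieldType := hyper.

Lemma hypD f g : (hyp f + hyp g : hyperreal) = hyp (fun n => f n + g n).
Proof. exact: haddE. Qed.
Lemma hypN f : (- hyp f : hyperreal) = hyp (fun n => - f n).
Proof. exact: hoppE. Qed.
Lemma hypM f g : (hyp f * hyp g : hyperreal) = hyp (fun n => f n * g n).
Proof. exact: hmulE. Qed.
Lemma hypV f : ((hyp f)^-1 : hyperreal) = hyp (fun n => (f n)^-1).
Proof. exact: hinvE. Qed.
Lemma hyp_norm f : (`|hyp f : hyperreal| : hyperreal) = hyp (fun n => `|f n|).
Proof. exact: hnormE. Qed.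
Lemma hyp_le f g : ((hyp f : hyperreal) <= hyp g) <-> uae (fun n => f n <= g n).
Proof. exact: hleE. Qed.
Lemma hyp0 : (0 : hyperreal) = hyp (fun=> 0). Proof. by []. Qed.
Lemma hyp1 : (1 : hyperreal) = hyp (fun=> 1). Proof. by []. Qed.
Lemma hyp_lt f g : ((hyp f : hyperreal) < hyp g) <-> uae (fun n => f n < g n).
Proof.
rewrite ltNge; split.
  move=> /negP h; have : uae (fun n => ~ g n <= f n) by apply: uae_not => /hyp_le.
  by apply: uaeS => n /negP; rewrite -ltNge.
move=> h; apply/negP => /hyp_le h'; have /uae_ex [n []] := uaeI h h'.
by rewrite ltNge => /negP.
Qed.
Lemma hypX f k : ((hyp f : hyperreal) ^+ k) = hyp (fun n => f n ^+ k).
Proof.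
elim: k => [|k IH]; first by rewrite expr0 hyp1; congr hyp; apply/funext => n; rewrite expr0.
by rewrite exprS IH hypM; congr hyp; apply/funext => n; rewrite exprS.
Qed.
Lemma hyp_nat k : (k%:R : hyperreal) = hyp (fun=> k%:R).
Proof.
elim: k => [|k IH]; first exact: hyp0.
by rewrite -natr1 IH hyp1 hypD; congr hyp; apply/funext => n; rewrite natr1.
Qed.

End Hyperreals.

(** * Size and denominator classes along derivations *)

Section Filtration.
Variables (F : realFieldType) (L : F -> Prop) (hL : subfield L).

Fixpoint derivations (ds : seq (F -> F)) : Prop :=
  if ds is D :: ds' then derivation L D /\ derivations ds' else True.

(* [filtered P H ds G x] bounds x by G, and each derivative of x along a
   subsequence of ds of length k by G * H ^+ k. *)
Fixpoint filtered (P : F -> F -> Prop) (H : F) (ds : seq (F -> F)) (G x : F) : Prop :=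
  if ds is D :: ds' then filtered P H ds' G x /\ filtered P H ds' (G * H) (D x)
  else L x /\ P G x.

Section Generic.
Variables (P : F -> F -> Prop) (H : F).
Hypothesis P0 : forall G, P G 0.
Hypothesis PD : forall G x y, P G x -> P G y -> P G (x + y).
Hypothesis PM : forall G G' x y, P G x -> P G' y -> P (G * G') (x * y).
Hypothesis PN1 : P 1 (-1).
Notation filt := (filtered P H).

Lemma filtered_in ds G x : filt ds G x -> L x.
Proof. by elim: ds G x => [|D ds IH] G x /= []; eauto. Qed.

Lemma filtered_base ds G x : filt ds G x -> P G x.
Proof. by elim: ds G x => [|D ds IH] G x /= []; eauto. Qed.

Lemma filtered0 ds G : derivations ds -> filt ds G 0.
Proof.
elim: ds G => [|D ds IH] G /=; first by split; [apply: (subfield0 hL)|].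
by move=> [hD hds]; rewrite (der0 hL hD); split; apply: IH.
Qed.

Lemma filteredD ds G x y : derivations ds ->
  filt ds G x -> filt ds G y -> filt ds G (x + y).
Proof.
elim: ds G x y => [|D ds IH] G x y /=.
  by move=> _ [? ?] [? ?]; split; [apply: (subfieldD hL)|apply: PD].
move=> [hD hds] [x1 x2] [y1 y2]; rewrite (derD hD) ?(filtered_in x1) ?(filtered_in y1) //.
- by split; apply: IH.
- exact: filtered_in x1.
- exact: filtered_in y1.
Qed.

(** By the Leibniz rule each term of [D (x * y)] charges one factor with a single [H]. The predicate
    [P] stays abstract because it is used twice: [nat_bounded] for sizes, [integral_at] for
    denominators. *)
Lemma filteredM ds G G' x y : derivations ds ->
  filt ds G x -> filt ds G' y -> filt ds (G * G') (x * y).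
Proof.
elim: ds G G' x y => [|D ds IH] G G' x y /=.
  by move=> _ [? ?] [? ?]; split; [apply: (subfieldM hL)|apply: PM].
move=> [hD hds] [x1 x2] [y1 y2]; split; first exact: IH.
rewrite (derM hD); [|exact: filtered_in x1|exact: filtered_in y1].
apply: filteredD => //; last by rewrite -mulrA; apply: IH.
by rewrite mulrAC; apply: IH.
Qed.

Lemma filtered_rat ds (q : rat) : derivations ds -> P 1 (ratr q) -> filt ds 1 (ratr q).
Proof.
move=> hds Pq; elim: ds hds => [|D ds IH] /=; first by split; [apply: (subfield_rat hL)|].
by move=> [hD hds]; rewrite (der_rat hL hD); split; [apply: IH|apply: filtered0].
Qed.

Lemma filtered1 ds : derivations ds -> filt ds 1 1.
Proof.
have P11 : P 1 1 by have := PM PN1 PN1; rewrite mulrNN !mulr1.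
by move=> hds; have := @filtered_rat ds 1 hds; rewrite rmorph1; apply.
Qed.

Lemma filteredN ds G x : derivations ds -> filt ds G x -> filt ds G (- x).
Proof.
move=> hds h; rewrite -mulN1r -(mul1r G); apply: filteredM => //.
by have := @filtered_rat ds (-1) hds; rewrite rmorphN1; apply.
Qed.

Lemma filteredB ds G x y : derivations ds ->
  filt ds G x -> filt ds G y -> filt ds G (x - y).
Proof. by move=> hds hx hy; apply: filteredD => //; apply: filteredN. Qed.

Lemma filtered_sum ds G (I : Type) (r : seq I) (Q : pred I) (f : I -> F) : derivations ds ->
  (forall i, Q i -> filt ds G (f i)) -> filt ds G (\sum_(i <- r | Q i) f i).
Proof.
move=> hds h; elim/big_ind: _ => //; first exact: filtered0.
by move=> x y; apply: filteredD.
Qed.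

Lemma filteredX ds G x n : derivations ds -> filt ds G x -> filt ds (G ^+ n) (x ^+ n).
Proof.
move=> hds h; elim: n => [|n IH]; first by rewrite !expr0; apply: filtered1.
by rewrite !exprS; apply: filteredM.
Qed.

Lemma filtered_iter D n i G x : (i <= n)%N ->
  filt (nseq n D) G x -> P (G * H ^+ i) (iter i D x).
Proof.
elim: n i G x => [|n IH] [|i] G x lin //=.
- by move=> [_ h]; rewrite expr0 mulr1.
- by move=> [/filtered_base h _]; rewrite expr0 mulr1.
by move=> [_] /(IH i _ _ lin); rewrite exprS mulrA -iterSr.
Qed.

End Generic.

(** The relation [x = O(G)]: the constant [K] is a standard natural number, hence finite in the
    ultrapower. *)
Definition nat_bounded (G x : F) := exists K : nat, `|x| <= K%:R * G.
Notation cls := (filtered nat_bounded).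

Lemma nat_bounded0 G : nat_bounded G 0.
Proof. by exists 0%N; rewrite normr0 mul0r. Qed.

Lemma nat_boundedD G x y : nat_bounded G x -> nat_bounded G y -> nat_bounded G (x + y).
Proof.
move=> [K h] [K' h']; exists (K + K')%N; rewrite natrD mulrDl.
by rewrite (le_trans (ler_normD _ _)) // lerD.
Qed.

Lemma nat_boundedM G G' x y : nat_bounded G x -> nat_bounded G' y ->
  nat_bounded (G * G') (x * y).
Proof.
move=> [K h] [K' h']; exists (K * K')%N; rewrite natrM mulrACA normrM.
exact: ler_pM.
Qed.

Lemma nat_boundedN1 : nat_bounded 1 (-1).
Proof. by exists 1%N; rewrite normrN1 mulr1. Qed.

Lemma nat_bounded_le G G' x : G <= G' -> nat_bounded G x -> nat_bounded G' x.
Proof.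
move=> GG [K h]; exists K; apply: le_trans h _.
by rewrite ler_wpM2l.
Qed.

Lemma nat_bounded_rat (q : rat) : nat_bounded 1 (ratr q).
Proof.
exists `|numq q|%N; rewrite mulr1 /ratr normrM normfV.
have -> : `|(numq q)%:~R : F| = `|numq q|%N%:R by rewrite -intr_norm natr_absz.
rewrite ler_pdivrMr ?normr_gt0 ?intr_eq0 ?denq_neq0 //.
rewrite ler_peMr ?ler0n // -intr_norm -[1]/(1%:~R) ler_int.
by rewrite gtr0_norm ?denq_gt0 // -[1]add0r lezD1 denq_gt0.
Qed.

Variable H : F.
Hypothesis H0 : 0 <= H.

Definition clsD := filteredD (H := H) nat_boundedD.
Definition clsM := filteredM (H := H) nat_boundedD nat_boundedM.
Definition cls0 := filtered0 H nat_bounded0.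
Definition cls1 := filtered1 H nat_bounded0 nat_boundedM nat_boundedN1.
Definition clsN := filteredN (H := H) nat_bounded0 nat_boundedD nat_boundedM nat_boundedN1.
Definition clsB := filteredB (H := H) nat_bounded0 nat_boundedD nat_boundedM nat_boundedN1.
Definition cls_sum := filtered_sum (H := H) nat_bounded0 nat_boundedD.
Definition clsX := filteredX (H := H) nat_bounded0 nat_boundedD nat_boundedM nat_boundedN1.

Lemma cls_rat ds (q : rat) : derivations ds -> cls H ds 1 (ratr q).
Proof. by move=> hds; apply: filtered_rat => //; [apply: nat_bounded0|apply: nat_bounded_rat]. Qed.

Lemma cls_le ds G G' x : G <= G' -> cls H ds G x -> cls H ds G' x.
Proof.
elim: ds G G' x => [|D ds IH] G G' x GG /=.
  by move=> [? ?]; split=> //; apply: nat_bounded_le GG _.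
by move=> [h1 h2]; split; [exact: IH GG _|apply: IH h2; apply: ler_wpM2r].
Qed.

(** The lower bound on [x] handles the inverse itself; its derivative [- D x * x^-1 ^+ 2] has size
    [G * H * G^-1 ^+ 2], and one recurses. *)
Lemma clsV ds G x (K : nat) : derivations ds -> 0 < G -> G <= K%:R * `|x| ->
  cls H ds G x -> cls H ds G^-1 x^-1.
Proof.
move=> + G0 Gx; have x0 : x != 0.
  by apply/eqP => x0; move: Gx; rewrite x0 normr0 mulr0 leNgt G0.
elim: ds => [|D ds IH] /=.
  move=> _ [Lx _]; split; first exact: (subfieldV hL).
  exists K; rewrite normfV ler_pdivlMr // mulrC ler_pdivrMr ?normr_gt0 //.
move=> [hD hds] [h1 h2]; have hV := IH hds h1; split=> //.
rewrite (derV hL hD (filtered_in h1)).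
have -> : G^-1 * H = (G * H) * (G^-1) ^+ 2 by field; rewrite gt_eqF.
by apply: clsM => //; [apply: clsN|apply: clsX].
Qed.

Lemma cls_rsum ds G (p : {poly F}) : derivations ds ->
  (forall i, cls H ds G p`_i) -> cls H ds G p.[1].
Proof.
move=> hds h; rewrite horner_coef; apply: cls_sum => // i _.
by rewrite expr1n mulr1.
Qed.

End Filtration.
Notation cls L := (filtered L (@nat_bounded _)).

Section ClsExists.
Variables (F : realFieldType) (L : F -> Prop) (hL : subfield L) (Q : F).
Hypothesis Q1 : 1 <= Q.
Hypothesis mod : forall x, L x -> exists C : nat, `|x| <= Q ^+ C.

Lemma cls_exists ds (xs : seq F) : derivations L ds -> (forall x, x \in xs -> L x) ->
  exists C0 : nat, forall C, (C0 <= C)%N -> forall x, x \in xs ->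
    forall G, Q^-1 <= G -> `|x| <= G -> cls L (Q ^+ C) ds G x.
Proof.
have Q0 : 0 < Q by apply: lt_le_trans Q1.
elim: ds xs => [|D ds IH] xs /=.
  move=> _ hxs; exists 0%N => C _ x xxs G QG xG; split; first exact: hxs.
  by exists 1%N; rewrite mul1r.
move=> [hD hds] hxs.
have [|C0 hC0] := IH (xs ++ map D xs) hds.
  move=> x; rewrite mem_cat => /orP[/hxs//|/mapP[y yxs ->]].
  exact: (der_in hD (hxs _ yxs)).
have [C1 hC1] : exists C1, forall x, x \in xs -> `|D x| <= Q ^+ C1.
  elim: xs hxs {hC0} => [|x xs IHx] hxs; first by exists 0%N.
  have [|C1 h1] := IHx; first by move=> y yxs; apply: hxs; rewrite inE yxs orbT.
  have [C2 h2] := mod (der_in hD (hxs x (mem_head _ _))).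
  exists (maxn C1 C2) => y; rewrite inE => /predU1P[->|/h1 h].
    by apply: le_trans h2 _; rewrite ler_weXn2l // leq_maxr.
  by apply: le_trans h _; rewrite ler_weXn2l // leq_maxl.
(* The extra factor [Q] makes up for [G], which may be as small as [Q^-1]. *)
exists (maxn C0 C1.+1) => C; rewrite geq_max => /andP[CC0 CC1] x xxs G QG xG.
have G0 : 0 < G by apply: lt_le_trans QG; rewrite invr_gt0.
split; first by apply: hC0 => //; rewrite mem_cat xxs.
have QCG : Q ^+ C1 <= G * Q ^+ C.
  have GQ : 1 <= G * Q by rewrite -ler_pdivrMr // div1r.
  apply: le_trans (ler_wpM2l (ltW G0) (ler_weXn2l Q1 CC1)).
  by rewrite exprS mulrA ler_peMl // exprn_ge0 // ltW.
apply: hC0 => //; first by rewrite mem_cat map_f ?orbT.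
  apply: le_trans QG _; rewrite ler_peMr ?exprn_ege1 // ltW //.
exact: le_trans (hC1 _ xxs) QCG.
Qed.

End ClsExists.

(** * Linear dependence over the rationals *)

Section LinearSpan.
Variable F : realFieldType.

Record qspace (V : F -> Prop) : Prop := QSpace {
  qs0 : V 0;
  qsD : forall x y, V x -> V y -> V (x + y);
  qsZ : forall (q : rat) x, V x -> V (ratr q * x) }.

Lemma qs_sum V (I : Type) (r : seq I) (P : pred I) (f : I -> F) : qspace V ->
  (forall i, P i -> V (f i)) -> V (\sum_(i <- r | P i) f i).
Proof. by move=> hV h; elim/big_ind: _ => //; [apply: qs0|apply: qsD]. Qed.

Definition lspan (s : seq F) (x : F) :=
  exists c : nat -> rat, x = \sum_(i < size s) ratr (c i) * s`_i.

Lemma lspan_qspace s : qspace (lspan s).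
Proof.
split.
- by exists (fun=> 0); rewrite big1 // => i _; rewrite rmorph0 mul0r.
- move=> _ _ [c ->] [c' ->]; exists (fun i => c i + c' i).
  by rewrite -big_split /=; apply: eq_bigr => i _; rewrite rmorphD mulrDl.
- move=> q _ [c ->]; exists (fun i => q * c i); rewrite mulr_sumr.
  by apply: eq_bigr => i _; rewrite rmorphM mulrA.
Qed.

Lemma lspan_nth s i : (i < size s)%N -> lspan s s`_i.
Proof.
move=> si; exists (fun j => (i == j)%:R).
rewrite (bigD1 (Ordinal si)) //= eqxx rmorph1 mul1r big1 ?addr0 // => j ji.
by rewrite eq_sym -val_eqE /= in ji; rewrite (negbTE ji) rmorph0 mul0r.
Qed.

Lemma lspan_dependent (s : seq F) (K : finType) (y : K -> F) :
  (forall k, lspan s (y k)) -> (size s < #|K|)%N ->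
  exists c : K -> rat, (exists k, c k != 0) /\ \sum_k ratr (c k) * y k = 0.
Proof.
move=> /choice [c yE] sK.
pose A : 'M[rat]_(#|K|, size s) := \matrix_(k, i) c (enum_val k) i.
have /rowV0Pn [v /sub_kermxP vA v0] : kermx A != 0.
  rewrite -mxrank_eq0 mxrank_ker subn_eq0 -ltnNge.
  exact: leq_ltn_trans (rank_leq_col A) sK.
have [k vk] : exists k, v 0 k != 0.
  by move/rV0Pn: v0.
exists (fun k => v 0 (enum_rank k)); split; first by exists (enum_val k); rewrite enum_valK.
rewrite (eq_bigr (fun k => \sum_(i < size s) ratr (v 0 (enum_rank k) * c k i) * s`_i)); last first.
  by move=> j _; rewrite yE mulr_sumr; apply: eq_bigr => i _; rewrite rmorphM mulrA.
rewrite exchange_big big1 //= => i _; rewrite -mulr_suml -rmorph_sum /=.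
have /matrixP/(_ 0 i) := vA; rewrite !mxE => e.
suff -> : \sum_k v 0 (enum_rank k) * c k i = 0 by rewrite rmorph0 mul0r.
rewrite -[RHS]e [RHS](reindex_onto enum_rank enum_val) /=; last by move=> j _; apply: enum_valK.
apply: eq_big => [j|j _]; first by rewrite enum_rankK eqxx.
by rewrite mxE enum_rankK.
Qed.

Lemma lspan_trans s s' x : (forall i, (i < size s)%N -> lspan s' s`_i) ->
  lspan s x -> lspan s' x.
Proof.
move=> h [c ->]; apply: qs_sum => [|i _]; first exact: lspan_qspace.
by apply: qsZ; [apply: lspan_qspace|apply: h].
Qed.

End LinearSpan.

(** * Polynomials in the entries: growth of dimensions and a Siegel lemma *)

Section PolyDegree.
Variables (F : realFieldType) (I : finType) (t : I -> F).

Definition monomial (e : I -> nat) : F := \prod_i t i ^+ e i.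

(* The Q-span of the monomials of degree at most T in each variable. *)
Definition Adeg (T : nat) (x : F) : Prop := forall V, qspace V ->
  (forall e, (forall i, e i <= T)%N -> V (monomial e)) -> V x.

Lemma Adeg_qspace T : qspace (Adeg T).
Proof.
split=> [|x y hx hy|q x hx] V hV hm.
- exact: qs0.
- by apply: qsD => //; [apply: hx|apply: hy].
- by apply: qsZ => //; apply: hx.
Qed.

Lemma Adeg0 T : Adeg T 0. Proof. exact: (qs0 (Adeg_qspace T)). Qed.

Lemma AdegD T x y : Adeg T x -> Adeg T y -> Adeg T (x + y).
Proof. exact: (qsD (Adeg_qspace T)). Qed.

Lemma AdegZ T (q : rat) x : Adeg T x -> Adeg T (ratr q * x).
Proof. exact: (qsZ (Adeg_qspace T)). Qed.

Lemma Adeg_sum T (J : Type) (r : seq J) (P : pred J) (f : J -> F) :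
  (forall i, P i -> Adeg T (f i)) -> Adeg T (\sum_(i <- r | P i) f i).
Proof. exact: (@qs_sum _ _ _ _ _ _ (Adeg_qspace T)). Qed.

Lemma Adeg_monomial T e : (forall i, e i <= T)%N -> Adeg T (monomial e).
Proof. by move=> h V hV hm; apply: hm. Qed.

Lemma Adeg_le T T' x : (T <= T')%N -> Adeg T x -> Adeg T' x.
Proof.
move=> TT h V hV hm; apply: h => // e he; apply: hm => i.
exact: leq_trans (he i) TT.
Qed.

Lemma AdegM T T' x y : Adeg T x -> Adeg T' y -> Adeg (T + T') (x * y).
Proof.
move=> hx hy.
have qsM z n : qspace (fun x => Adeg n (x * z)).
  split=> [|u v hu hv|q u hu].
  - by rewrite mul0r; apply: (qs0 (Adeg_qspace n)).
  - by rewrite mulrDl; apply: (qsD (Adeg_qspace n)).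
  - by rewrite -mulrA; apply: (qsZ (Adeg_qspace n)).
apply: (hx (fun x => Adeg (T + T') (x * y))) => // e he.
rewrite mulrC; apply: (hy (fun y => Adeg (T + T') (y * monomial e))) => // e' he'.
have -> : monomial e' * monomial e = monomial (fun i => e' i + e i)%N.
  by rewrite /monomial -big_split /=; apply: eq_bigr => i _; rewrite exprD.
by apply: Adeg_monomial => i; rewrite addnC leq_add.
Qed.

Lemma Adeg1 T : Adeg T 1.
Proof.
rewrite [1](_ : _ = monomial (fun=> 0%N)); first exact: Adeg_monomial.
by rewrite /monomial big1 // => i _; rewrite expr0.
Qed.

Lemma Adeg_gen i : Adeg 1 (t i).
Proof.
rewrite [t i](_ : _ = monomial (fun j => (j == i)%:R)).
  by apply: Adeg_monomial => j; case: (j == i).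
rewrite /monomial (bigD1 i) //= eqxx expr1 big1 ?mulr1 // => j /negbTE ->.
by rewrite expr0.
Qed.

Lemma AdegX T x n : Adeg T x -> Adeg (T * n) (x ^+ n).
Proof.
move=> h; elim: n => [|n IH]; first by rewrite muln0; apply: Adeg1.
by rewrite exprS mulnS; apply: AdegM.
Qed.

Definition Abasis T (s : seq F) :=
  (forall i, (i < size s)%N -> Adeg T s`_i) /\ (forall x, Adeg T x -> lspan s x).

Lemma Abasis_monomials T : exists s, Abasis T s /\ size s = (T.+1 ^ #|I|)%N.
Proof.
pose m (f : {ffun I -> 'I_T.+1}) := monomial (fun i => f i).
exists [seq m f | f <- enum {ffun I -> 'I_T.+1}].
have sz : size [seq m f | f <- enum {ffun I -> 'I_T.+1}] = (T.+1 ^ #|I|)%N.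
  by rewrite size_map -cardE card_ffun card_ord.
split=> //; split.
  move=> i; rewrite size_map => si.
  have f0 : {ffun I -> 'I_T.+1} by apply: [ffun=> ord0].
  by rewrite (nth_map f0) //; apply: Adeg_monomial => j; rewrite -ltnS.
move=> x; apply; first exact: lspan_qspace.
move=> e he; pose f : {ffun I -> 'I_T.+1} := [ffun i => inord (e i)].
have fs : m f \in [seq m f | f <- enum {ffun I -> 'I_T.+1}] by rewrite map_f ?mem_enum.
have -> : monomial e = m f.
  by apply: eq_bigr => i _; rewrite ffunE inordK // ltnS.
by rewrite -(nth_index 0 fs); apply: lspan_nth; rewrite index_mem.
Qed.

Lemma Abasis_ex T : exists n, `[< exists s, Abasis T s /\ size s = n >].
Proof.
by have [s [h1 h2]] := Abasis_monomials T; exists (T.+1 ^ #|I|)%N; apply/asboolP; exists s.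
Qed.

Definition dimA T := ex_minn (Abasis_ex T).

Lemma dimA_le T : (dimA T <= T.+1 ^ #|I|)%N.
Proof.
rewrite /dimA; case: ex_minnP => n _; apply; apply/asboolP.
exact: Abasis_monomials.
Qed.

(** A spanning list of least length is free: an element with a nonzero coefficient in a relation
    could be deleted. *)
Lemma dimA_basis T : exists s, [/\ Abasis T s, size s = dimA T &
  forall c : nat -> rat, \sum_(i < size s) ratr (c i) * s`_i = 0 ->
    forall i, (i < size s)%N -> c i = 0].
Proof.
rewrite /dimA; case: ex_minnP => n /asboolP [s [[sA sspan] sz]] nmin.
exists s; split=> // c c0 k ks; apply: contrapT => /eqP ck.
have : (n <= (size s).-1)%N; last first.
  by rewrite -sz => h; move: ks h; lia.
apply: nmin; apply/asboolP; pose s' := take k s ++ drop k.+1 s.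
have szs' : size s' = (size s).-1.
  rewrite size_cat size_take size_drop ks.
  by rewrite -[size s in RHS](subnKC ks) addSn.
have s'in i : (i < size s)%N -> i != k -> lspan s' s`_i.
  move=> si ik; have : s`_i \in s'.
    rewrite mem_cat; case: (ssrnat.ltngtP i k) ik => // ik _.
      by rewrite -(nth_take _ ik) mem_nth // size_take ks.
    have : (drop k.+1 s)`_(i - k.+1) \in drop k.+1 s.
      by rewrite mem_nth // size_drop ltn_sub2r //; apply: leq_ltn_trans si.
    by rewrite nth_drop subnKC // => ->; rewrite orbT.
  by move=> h; rewrite -(nth_index 0 h); apply: lspan_nth; rewrite index_mem.
exists s'; split=> //; split.
  move=> i; rewrite szs' => si; rewrite nth_cat size_take ks.
  case: ltnP => ik; first by rewrite nth_take //; apply: sA; apply: ltn_trans ks.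
  rewrite nth_drop addSn subnKC //.
  by apply: sA; move: si; case: (size s) ks.
move=> x /sspan; apply: lspan_trans => i si.
have [->|] := eqVneq i k; last exact: s'in.
have -> : s`_k = ratr (- (c k)^-1) * \sum_(j < size s | j != Ordinal ks) ratr (c j) * s`_j.
  move: c0; rewrite (bigD1 (Ordinal ks)) //= => /eqP; rewrite addr_eq0 => /eqP e.
  have ck0 : (ratr (c k) : F) != 0 by rewrite fmorph_eq0.
  by rewrite rmorphN fmorphV mulNr -mulrN -e mulrA mulVf // mul1r.
apply: qsZ; first exact: lspan_qspace.
apply: qs_sum; first exact: lspan_qspace.
move=> j jk; apply: qsZ; first exact: lspan_qspace.
exact: s'in.
Qed.

Lemma dimA_gt0 T : (0 < dimA T)%N.
Proof.
have [s [[_ h] <- _]] := dimA_basis T; rewrite lt0n; apply/eqP => /size0nil s0.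
have [c] := h _ (@Adeg1 T); rewrite s0 big_ord0 => /eqP.
by rewrite oner_eq0.
Qed.

(** The dimension is at most [T.+1 ^ #|I|], so it cannot gain a factor [La ^ #|I|.+1] at every
    dilation by [La]. This compares two dimensions although algebraic relations between the entries
    make them unknown. *)
Lemma dimA_doubling La T0 : (1 < La)%N ->
  exists2 T, (T0 <= T)%N & (dimA (La * T) <= La ^ #|I|.+1 * dimA T)%N.
Proof.
move=> La1; apply: contrapT => h.
have {}h T : (T0 <= T)%N -> (La ^ #|I|.+1 * dimA T < dimA (La * T))%N.
  by move=> TT; rewrite ltnNge; apply/negP => h'; apply: h; exists T.
pose T1 := maxn T0 1; pose m := #|I|.
have low i : (La ^ (m.+1 * i) <= dimA (La ^ i * T1))%N.
  elim: i => [|i IH]; first by rewrite muln0 expn0 mul1n dimA_gt0.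
  rewrite mulnS expnD [(La ^ i.+1)%N]expnS -mulnA.
  apply: leq_trans (ltnW (h (La ^ i * T1)%N _)).
    by rewrite leq_mul2l IH orbT.
  by rewrite (leq_trans (leq_maxl T0 1)) // leq_pmull // expn_gt0 (ltnW La1).
(* For this [i] the upper bound [(2 * T1 * La ^ i) ^ m] equals [i * La ^ (i * m)], which is below
   [La ^ (m.+1 * i)] because [i < La ^ i]. *)
pose i := ((2 * T1) ^ m)%N.
have := leq_trans (low i) (dimA_le _); rewrite leqNgt => /negP; apply.
have T1pos : (0 < T1)%N by rewrite /T1; lia.
have Lpos : (0 < La ^ i)%N by rewrite expn_gt0 (ltnW La1).
apply: (@leq_ltn_trans ((2 * T1 * La ^ i) ^ m)).
  have [m0|m0] := posnP #|I|; first by rewrite /m m0 !expn0.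
  rewrite leq_exp2r // -mulnA mulSn mul1n [X in (_ <= _ + X)%N]mulnC.
  by rewrite [(T1 * _)%N]mulnC -addn1 leq_add2l muln_gt0 Lpos T1pos.
rewrite expnMn -/i [(m.+1 * i)%N]mulSn expnD -expnM [(i * m)%N]mulnC.
by rewrite ltn_mul2r expn_gt0 (ltnW La1) /= ltn_expl.
Qed.

(** The products of a basis of degree [T] with the [E.+1] elements [de * Y i] lie in degree [T''],
    whose dimension is smaller than their number. The relation has standard rational coefficients,
    whose size costs only a standard factor. *)
Lemma Siegel T T' T'' E (de : F) (Y : nat -> F) : de != 0 -> (T + T' <= T'')%N ->
  (forall i, (i <= E)%N -> Adeg T' (de * Y i)) -> (dimA T'' < E.+1 * dimA T)%N ->
  exists g : nat -> F, [/\ forall i, Adeg T (g i), exists2 i, (i <= E)%N & g i != 0 &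
    \sum_(i < E.+1) g i * Y i = 0].
Proof.
move=> de0 hT hY hdim.
have [b [[bA bspan] bsz bfree]] := dimA_basis T.
have [s [[sA sspan] ssz _]] := dimA_basis T''.
have [|//|c [[k ck] c0]] := @lspan_dependent _ s ('I_E.+1 * 'I_(size b))%type
    (fun k => b`_k.2 * (de * Y k.1)).
- move=> [i j] /=; apply: sspan; apply: (Adeg_le hT); apply: AdegM; first exact: bA.
  by apply: (hY i); rewrite -ltnS.
- by rewrite card_prod !card_ord ssz bsz.
exists (fun i => \sum_(j < size b) ratr (c (inord i, j)) * b`_j); split.
- by move=> i; apply: Adeg_sum => j _; apply: AdegZ; apply: bA.
- exists k.1; first by rewrite -ltnS.
  apply/eqP => e; move/eqP: ck; apply.
  have b0 : (0 < size b)%N by rewrite bsz dimA_gt0.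
  pose c' (j : nat) := if insub j is Some j' then c (k.1, j') else 0.
  have c'E (j : 'I_(size b)) : c' j = c (k.1, j) by rewrite /c' valK.
  have := bfree c' _ k.2 (ltn_ord _); rewrite c'E -surjective_pairing; apply.
  rewrite -[RHS]e; apply: eq_bigr => j _; rewrite c'E; congr (ratr (c (_, _)) * _).
  by rewrite inord_val.
apply: (mulfI de0); rewrite mulr0 -[RHS]c0 mulr_sumr.
transitivity (\sum_(i < E.+1) \sum_(j < size b) ratr (c (i, j)) * (b`_j * (de * Y i))).
  apply: eq_bigr => i _; rewrite inord_val mulr_suml mulr_sumr.
  by apply: eq_bigr => j _; ring.
by rewrite pair_bigA /=; apply: eq_bigr => -[i j] _.
Qed.

End PolyDegree.

(** * Letters, their Moebius maps and the convergents *)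

(* F is a field of hyperreals, ZZ its ring of hyperintegers, and
   (la k, lb k; lc k, ld k) is the matrix of the k-th letter. *)
Record letter_system (F : realFieldType) (ZZ : F -> Prop) (B cc : nat) (Q : F)
    (la lb lc ld eps : 'I_B -> F) : Prop := LetterSystem {
  ls_1 : ZZ 1;
  ls_B : forall x y, ZZ x -> ZZ y -> ZZ (x - y);
  ls_M : forall x y, ZZ x -> ZZ y -> ZZ (x * y);
  ls_discrete : forall x, ZZ x -> `|x| < 1 -> x = 0;
  ls_la : forall k, ZZ (la k);
  ls_lb : forall k, ZZ (lb k);
  ls_lc : forall k, ZZ (lc k);
  ls_ld : forall k, ZZ (ld k);
  ls_eps : forall k, eps k = 1 \/ eps k = -1;
  ls_det : forall k, la k * ld k - lb k * lc k = eps k;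
  ls_la0 : forall k, 0 <= la k;
  ls_lac : forall k, la k <= lc k;
  ls_lb0 : forall k, 0 <= lb k;
  ls_lbd : forall k, lb k <= ld k;
  ls_lc0 : forall k, 0 < lc k;
  ls_lcd : forall k, lc k <= ld k;
  ls_inf : forall n : nat, n%:R < Q;
  ls_Qc : forall k, Q <= lc k ^+ 2;
  ls_dQ : forall k, ld k <= Q ^+ cc }.

Section Letters.
Variables (F : realFieldType) (ZZ : F -> Prop) (B cc : nat) (Q : F).
Variables (la lb lc ld eps : 'I_B -> F).
Hypothesis hS : letter_system ZZ cc Q la lb lc ld eps.

Lemma lsQ1 : 1 <= Q. Proof. exact: ltW (ls_inf hS 1). Qed.
Lemma lsQ0 : 0 < Q. Proof. exact: (ls_inf hS) 0. Qed.
Lemma ls_ld0 k : 0 < ld k. Proof. exact: lt_le_trans (ls_lc0 hS k) (ls_lcd hS k). Qed.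
Lemma ls_0 : ZZ 0.
Proof. by rewrite -(subrr 1); apply: (ls_B hS); apply: (ls_1 hS). Qed.
Lemma ls_N x : ZZ x -> ZZ (- x).
Proof. by move=> h; rewrite -sub0r; apply: (ls_B hS) => //; apply: ls_0. Qed.
Lemma ls_D x y : ZZ x -> ZZ y -> ZZ (x + y).
Proof. by move=> h h'; rewrite -[y]opprK; apply: (ls_B hS) => //; apply: ls_N. Qed.
Lemma ls_nat n : ZZ n%:R.
Proof.
elim: n => [|n IH]; first exact: ls_0.
by rewrite -natr1; apply: ls_D => //; apply: (ls_1 hS).
Qed.
Lemma ls_int (z : int) : ZZ z%:~R.
Proof.
by case: z => n; [exact: ls_nat|rewrite NegzE mulrNz; apply/ls_N/ls_nat].
Qed.
Lemma ls_X x n : ZZ x -> ZZ (x ^+ n).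
Proof.
move=> h; elim: n => [|n IH]; first exact: (ls_1 hS).
by rewrite exprS; apply: (ls_M hS).
Qed.
Lemma ls_ge1 x : ZZ x -> x != 0 -> 1 <= `|x|.
Proof.
move=> Zx x0; rewrite leNgt; apply/negP => /(ls_discrete hS Zx) /eqP.
by rewrite (negbTE x0).
Qed.

Lemma lsQ_absorb (K : nat) a b : (a < b)%N -> K%:R * Q ^+ a < Q ^+ b.
Proof.
move=> ab; apply: (@lt_le_trans _ _ (Q ^+ a.+1)).
  by rewrite exprS ltr_pM2r ?exprn_gt0 ?lsQ0 //; apply: (ls_inf hS).
by rewrite ler_weXn2l // lsQ1.
Qed.

Definition letter_entry (k : 'I_4 * 'I_B) : F :=
  nth 0 [:: la k.2; lb k.2; lc k.2; ld k.2] k.1.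

(** Defined as an intersection of subfields, so that membership gives induction on field expressions
    in the entries. *)
Definition Lgen (x : F) : Prop := forall K, subfield K -> (forall k, K (letter_entry k)) -> K x.

Lemma Lgen_subfield : subfield Lgen.
Proof.
split=> [|x y hx hy|x y hx hy|x hx] K hK hk.
- exact: subfield1.
- by apply: (subfieldB hK); [apply: hx|apply: hy].
- by apply: (subfieldM hK); [apply: hx|apply: hy].
- by apply: (subfieldV hK); apply: hx.
Qed.
Notation hL := Lgen_subfield.

Lemma Lgen_entry k : Lgen (letter_entry k). Proof. by move=> K hK; apply. Qed.
Lemma Lgen_la k : Lgen (la k). Proof. by exact: Lgen_entry (@Ordinal 4 0 isT, k). Qed.
Lemma Lgen_lc k : Lgen (lc k). Proof. by exact: Lgen_entry (@Ordinal 4 2 isT, k). Qed.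
Lemma Lgen_ld k : Lgen (ld k). Proof. by exact: Lgen_entry (@Ordinal 4 3 isT, k). Qed.
Lemma Lgen_eps k : Lgen (eps k).
Proof.
by case: (ls_eps hS k) => ->; [|apply: (subfieldN hL)]; apply: (subfield1 hL).
Qed.

Lemma letter_entryP (P : F -> Prop) :
  (forall k, [/\ P (la k), P (lb k), P (lc k) & P (ld k)]) -> forall k, P (letter_entry k).
Proof. by move=> h [[[|[|[|[|]]]] hi] k] //=; have [] := h k. Qed.

Lemma letter_entry_bound k : 0 <= letter_entry k <= ld k.2.
Proof.
have h := (ls_la0 hS, ls_lac hS, ls_lb0 hS, ls_lbd hS, ls_lcd hS, ls_ld0).
case: k => [[[|[|[|[|]]]] hi] k] //=; rewrite /letter_entry /=.
- by rewrite h (le_trans (ls_lac hS k)) // h.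
- by rewrite !h.
- by rewrite ltW ?(ls_lc0 hS) // h.
- by rewrite lexx ltW // h.
Qed.

Lemma Lgen_frac x : Lgen x -> exists C a b, [/\ ZZ a, ZZ b, b != 0, `|a| <= Q ^+ C &
  `|b| <= Q ^+ C /\ x = a / b].
Proof.
pose P y := exists C a b, [/\ ZZ a, ZZ b, b != 0, `|a| <= Q ^+ C & `|b| <= Q ^+ C /\ y = a / b].
move=> h; apply: (h P) => {x h}.
  have Q0 := ltW lsQ0; have Q1 := lsQ1.
  split=> [|_ _ [C [a [b [Za Zb b0 ha [hb ->]]]]] [C' [a' [b' [Za' Zb' b0' ha' [hb' ->]]]]]
    |_ _ [C [a [b [Za Zb b0 ha [hb ->]]]]] [C' [a' [b' [Za' Zb' b0' ha' [hb' ->]]]]]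
    |_ [C [a [b [Za Zb b0 ha [hb ->]]]]]].
  - exists 0%N, 1, 1; rewrite expr0 normr1 divr1 oner_eq0.
    by split=> //; apply: (ls_1 hS).
  - exists (C + C').+1, (a * b' - a' * b), (b * b'); split.
    + by apply: (ls_B hS); apply: (ls_M hS).
    + exact: (ls_M hS).
    + exact: mulf_neq0.
    + apply: le_trans (ltW (lsQ_absorb 2 (ltnSn (C + C')))).
      rewrite (le_trans (ler_normB _ _)) // mulr_natl mulr2n exprD lerD // normrM.
        exact: ler_pM.
      by rewrite mulrC; apply: ler_pM.
    split; last by field; rewrite b0 b0'.
    apply: le_trans (_ : Q ^+ (C + C') <= _); last by rewrite ler_weXn2l.
    by rewrite normrM exprD; apply: ler_pM.
  - exists (C + C')%N, (a * a'), (b * b'); split; rewrite ?normrM ?exprD.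
    + exact: (ls_M hS).
    + exact: (ls_M hS).
    + exact: mulf_neq0.
    + exact: ler_pM.
    split; first exact: ler_pM.
    by field; rewrite b0 b0'.
  - have [->|a0] := eqVneq a 0.
      exists 0%N, 0, 1; rewrite expr0 normr1 normr0 !mul0r invr0 oner_eq0.
      by split=> //; [apply: ls_0|apply: (ls_1 hS)].
    by exists C, b, a; rewrite invf_div.
have Q1 := lsQ1; have main y d : ZZ y -> 0 <= y <= d -> d <= Q ^+ cc -> P y.
  move=> Zy /andP[y0 yd] dQ; exists cc, y, 1; rewrite oner_eq0 divr1 normr1.
  split=> //; first exact: (ls_1 hS).
    by rewrite ger0_norm // (le_trans yd).
  by split=> //; rewrite exprn_ege1.
move=> k; apply: main (letter_entry_bound k) (ls_dQ hS _).
apply: (letter_entryP (P := ZZ)) => {}k.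
by split; [apply: (ls_la hS)|apply: (ls_lb hS)|apply: (ls_lc hS)|apply: (ls_ld hS)].
Qed.

Lemma Lgen_mod x : Lgen x -> exists C : nat, `|x| <= Q ^+ C.
Proof.
move=> /Lgen_frac [C [a [b [Za Zb b0 ha [hb ->]]]]]; exists C.
rewrite normrM normfV (le_trans _ ha) // ler_pdivrMr ?normr_gt0 //.
by rewrite ler_peMr ?normr_ge0 // ls_ge1.
Qed.

Lemma Lgen_den x : Lgen x -> exists C h, [/\ ZZ h, h != 0, `|h| <= Q ^+ C & ZZ (h * x)].
Proof.
move=> /Lgen_frac [C [a [b [Za Zb b0 ha [hb ->]]]]]; exists C, b.
by split=> //; rewrite mulrC mulfVK.
Qed.

Notation A := (Adeg letter_entry).

Lemma Lgen_A x : Lgen x -> exists C de, [/\ A C de, de != 0 & A C (de * x)].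
Proof.
move=> h; pattern x; apply: h => {x}; last first.
  by move=> k; exists 1%N, 1; rewrite oner_eq0 mul1r; split=> //; [apply: Adeg1|apply: Adeg_gen].
split=> [|x y [C [d [h1 d0 h2]]] [C' [d' [h1' d0' h2']]]|x y [C [d [h1 d0 h2]]] [C' [d' [h1' d0' h2']]]
  |x [C [d [h1 d0 h2]]]].
- by exists 0%N, 1; rewrite oner_eq0 mulr1; split=> //; apply: Adeg1.
- exists (C + C')%N, (d * d'); split; [exact: AdegM|exact: mulf_neq0|].
  have -> : d * d' * (x - y) = (d * x) * d' + ratr (-1) * (d * (d' * y)).
    by rewrite rmorphN1; ring.
  by apply: AdegD; [|apply: AdegZ]; apply: AdegM.
- exists (C + C')%N, (d * d'); split; [exact: AdegM|exact: mulf_neq0|].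
  by rewrite mulrACA; apply: AdegM.
- have [->|x0] := eqVneq x 0; last first.
    by exists C, (d * x); rewrite mulf_neq0 // mulfK.
  by exists 0%N, 1; rewrite oner_eq0 invr0 mulr0; split=> //; [apply: Adeg1|apply: Adeg0].
Qed.

Lemma Lgen_A_seq (xs : seq F) : (forall x, x \in xs -> Lgen x) ->
  exists C de, [/\ A C de, de != 0 & forall x, x \in xs -> A C (de * x)].
Proof.
elim: xs => [|x xs IH] h.
  by exists 0%N, 1; rewrite oner_eq0; split=> //; apply: Adeg1.
have [|C [d [h1 d0 h2]]] := IH; first by move=> y hy; apply: h; rewrite inE hy orbT.
have [C' [d' [h1' d0' h2']]] := Lgen_A (h x (mem_head _ _)).
exists (C + C')%N, (d * d'); split; [exact: AdegM|exact: mulf_neq0|].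
move=> y; rewrite inE => /predU1P[->|hy].
  by rewrite -mulrA; apply: AdegM.
by rewrite mulrAC; apply: AdegM => //; apply: h2.
Qed.

Lemma ratr_ZZ (q : rat) : exists2 N : nat, (0 < N)%N & ZZ (N%:R * ratr q).
Proof.
exists `|denq q|%N; first by rewrite absz_gt0 denq_neq0.
rewrite /ratr mulrC natr_absz gtr0_norm ?denq_gt0 // mulfVK ?intr_eq0 ?denq_neq0 //.
exact: ls_int.
Qed.

Lemma A_ZZ T x : A T x -> exists2 N : nat, (0 < N)%N & ZZ (N%:R * x).
Proof.
move=> h; pattern x; apply: h => {x}.
  split=> [|x y [N N0 h] [N' N0' h']|q x [N N0 h]].
  - by exists 1%N => //; rewrite mulr0; apply: ls_0.
  - exists (N * N')%N; first by rewrite muln_gt0 N0.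
    have -> : (N * N')%:R * (x + y) = N'%:R * (N%:R * x) + N%:R * (N'%:R * y).
      by rewrite natrM; ring.
    by apply: ls_D; apply: (ls_M hS) => //; apply: ls_nat.
  - have [N' N0' h'] := ratr_ZZ q.
    exists (N * N')%N; first by rewrite muln_gt0 N0.
    have -> : (N * N')%:R * (ratr q * x) = (N'%:R * ratr q) * (N%:R * x).
      by rewrite natrM; ring.
    exact: (ls_M hS).
move=> e _; exists 1%N => //; rewrite mul1r /monomial.
elim/big_ind: _ => [|x' y'|i _]; [exact: (ls_1 hS)|exact: (ls_M hS)|].
apply: ls_X; apply: (letter_entryP (P := ZZ)) => k.
by split; [apply: (ls_la hS)|apply: (ls_lb hS)|apply: (ls_lc hS)|apply: (ls_ld hS)].
Qed.

Variable om : nat -> 'I_B.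

Definition mob (k : 'I_B) (y : F) := (la k * y + lb k) / (lc k * y + ld k).

(** A word of [n.+1] matrices applied to the point at infinity, which the last letter sends to
    [la / lc]. *)
Fixpoint rr (n i : nat) : F :=
  if n is n'.+1 then mob (om i) (rr n' i.+1) else la (om i) / lc (om i).

Lemma mob_den_gt0 k y : 0 <= y -> 0 < lc k * y + ld k.
Proof. by move=> y0; rewrite ltr_wpDl ?ls_ld0 // mulr_ge0 // ltW // (ls_lc0 hS). Qed.

Lemma mob_ge0 k y : 0 <= y -> 0 <= mob k y.
Proof.
move=> y0; rewrite divr_ge0 ?(ltW (mob_den_gt0 _ _)) //.
by rewrite addr_ge0 ?mulr_ge0 // ?(ls_la0 hS) ?(ls_lb0 hS).
Qed.

Lemma mob_le1 k y : 0 <= y -> mob k y <= 1.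
Proof.
move=> y0; rewrite ler_pdivrMr ?mob_den_gt0 // mul1r lerD ?(ls_lbd hS) //.
by rewrite ler_wpM2r ?(ls_lac hS).
Qed.

Lemma rr_bound n i : 0 <= rr n i <= 1.
Proof.
elim: n i => [|n IH] i /=.
  rewrite divr_ge0 ?(ls_la0 hS) ?(ltW (ls_lc0 hS _)) //=.
  by rewrite ler_pdivrMr ?(ls_lc0 hS) // mul1r (ls_lac hS).
by have /andP[h _] := IH i.+1; rewrite mob_ge0 ?mob_le1.
Qed.

Lemma rr_ge0 n i : 0 <= rr n i. Proof. by case/andP: (rr_bound n i). Qed.

Lemma mobB k y z : 0 <= y -> 0 <= z ->
  mob k y - mob k z = eps k * (y - z) * (lc k * y + ld k)^-1 * (lc k * z + ld k)^-1.
Proof.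
move=> y0 z0; rewrite -(ls_det hS) /mob; field.
by rewrite !gt_eqF ?mob_den_gt0.
Qed.

Lemma eps_norm k : `|eps k| = 1.
Proof. by case: (ls_eps hS k) => ->; rewrite ?normrN ?normr1. Qed.

Lemma mob_contract k y z : 0 <= y -> 0 <= z -> `|mob k y - mob k z| <= `|y - z| * Q^-1.
Proof.
move=> y0 z0; rewrite mobB // !normrM eps_norm mul1r -mulrA ler_wpM2l //.
rewrite !gtr0_norm ?invr_gt0 ?mob_den_gt0 // -invfM.
have dpos := ls_ld0 k; have h0 := ls_lc0 hS k; have h1 := ls_lcd hS k; have Qc := ls_Qc hS k.
have dq w : 0 <= w -> lc k <= lc k * w + ld k.
  by move=> w0; rewrite (le_trans h1) // lerDr mulr_ge0 // ltW.
rewrite lef_pV2 ?posrE ?mulr_gt0 ?mob_den_gt0 ?lsQ0 //.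
rewrite (le_trans Qc) // expr2; apply: ler_pM; rewrite ?dq //; exact: ltW.
Qed.

Lemma rr_tail (x : nat -> F) : (forall i, 0 <= x i <= 1) ->
  (forall i, x i = mob (om i) (x i.+1)) -> forall n i, `|x i - rr n i| <= Q^-1 ^+ n.
Proof.
move=> x01 xE; elim=> [|n IH] i.
  have := x01 i; have := rr_bound 0 i; rewrite expr0 ler_norml; lra.
rewrite xE /= (le_trans (mob_contract _ _ _)) ?rr_ge0 //; first by case/andP: (x01 i.+1).
by rewrite exprSr ler_wpM2r // invr_ge0 ltW // lsQ0.
Qed.

(** The lower left entry of the product of the matrices of [f] and [g]. It appears in [th] and
    [kap], which rewrite the convergents as a continued fraction with partial denominators 1 and
    partial numerators [th] of size at most [Q^-1]. *)
Definition Gf f g := lc f * la g + ld f * lc g.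
Definition th f g h := - eps g * lc f * lc h / (Gf f g * Gf g h).
Definition kap f g := - eps f * lc g / (lc f * Gf f g).

Lemma Gf_gt0 f g : 0 < Gf f g.
Proof.
rewrite /Gf ltr_wpDl ?mulr_gt0 ?ls_ld0 ?(ls_lc0 hS) //.
by rewrite mulr_ge0 ?(ls_la0 hS) // ltW // (ls_lc0 hS).
Qed.

Lemma Gf_ge f g : lc f * lc g <= Gf f g.
Proof.
rewrite /Gf (le_trans (_ : _ <= ld f * lc g)) //.
  by rewrite ler_pM2r ?(ls_lc0 hS) // (ls_lcd hS).
by rewrite lerDr mulr_ge0 ?(ls_la0 hS) // ltW // (ls_lc0 hS).
Qed.

Lemma th_bound f g h : `|th f g h| <= Q^-1.
Proof.
have c0 := ls_lc0 hS.
rewrite /th !normrM normrN eps_norm mul1r normfV normrM !gtr0_norm ?Gf_gt0 //.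
rewrite ler_pdivrMr ?mulr_gt0 ?Gf_gt0 // [X in _ <= X]mulrC ler_pdivlMr ?lsQ0 //.
apply: le_trans (_ : lc f * lc g * (lc g * lc h) <= _); last first.
  by apply: ler_pM; rewrite ?Gf_ge ?mulr_ge0 // ltW.
have -> : lc f * lc g * (lc g * lc h) = lc f * lc h * lc g ^+ 2 by ring.
by rewrite ler_pM2l ?mulr_gt0 // (ls_Qc hS).
Qed.

Lemma lc_ge1 k : 1 <= lc k.
Proof.
have := ls_ge1 (ls_lc hS k); rewrite gtr0_norm ?(ls_lc0 hS) //; apply.
by rewrite gt_eqF // (ls_lc0 hS).
Qed.

Lemma kap_bound f g : `|kap f g| <= 1.
Proof.
have c0 := ls_lc0 hS.
rewrite /kap !normrM normrN eps_norm mul1r normfV normrM !gtr0_norm ?Gf_gt0 //.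
rewrite ler_pdivrMr ?mulr_gt0 ?Gf_gt0 // mul1r.
rewrite (le_trans _ (ler_wpM2l (ltW (c0 f)) (Gf_ge f g))) // mulrA.
by rewrite ler_peMl ?(ltW (c0 g)) // mulr_ege1 // lc_ge1.
Qed.

Fixpoint ss (n i : nat) : F :=
  if n is n'.+1 then (1 + th (om i) (om i.+1) (om i.+2) * ss n' i.+1)^-1 else 1.

Lemma ss_bound n i : 0 < ss n i <= 2.
Proof.
have Qi : 4 * Q^-1 <= 1 by rewrite ler_pdivrMr ?lsQ0 // mul1r ltW // (ls_inf hS 4).
elim: n i => [|n IH] i /=; first by rewrite ltr01 lerDl ler01.
have /andP[s0 s2] := IH i.+1; have ht := th_bound (om i) (om i.+1) (om i.+2).
have : `|th (om i) (om i.+1) (om i.+2) * ss n i.+1| <= Q^-1 * 2.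
  by rewrite normrM ler_pM // gtr0_norm.
move: (th _ _ _ * _) => z; rewrite ler_norml => /andP[z1 z2].
have h : 1 / 2 <= 1 + z by lra.
have z0 : 0 < 1 + z by lra.
by rewrite invr_gt0 z0 -[2]invrK lef_pV2 ?posrE ?invr_gt0 //; lra.
Qed.

Lemma ss_den n i : 1 + th (om i) (om i.+1) (om i.+2) * ss n i.+1 != 0.
Proof. by have /andP[/= + _] := ss_bound n.+1 i; rewrite invr_gt0 => /gt_eqF ->. Qed.

(** An equivalence transformation of continued fractions that puts all the smallness into [th]: the
    expansion can then be cut at any order, whatever the length [n]. *)
Lemma rr_ss n i : rr n.+1 i = la (om i) / lc (om i) + kap (om i) (om i.+1) * ss n i.
Proof.
have mobE k y : 0 <= y -> mob k y = la k / lc k - eps k / (lc k * (lc k * y + ld k)).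
  move=> y0; rewrite -(ls_det hS) /mob; field.
  by rewrite !gt_eqF ?mob_den_gt0 ?(ls_lc0 hS).
elim: n i => [|n IH] i.
  rewrite [LHS]mobE ?(rr_ge0 0) // /kap /Gf /=; have := Gf_gt0 (om i) (om i.+1).
  rewrite /Gf => G0; field.
  rewrite !gt_eqF ?(ls_lc0 hS) //.
have -> : rr n.+2 i = mob (om i) (rr n.+1 i.+1) by [].
rewrite mobE ?rr_ge0 // IH.
have := ss_den n i; rewrite [ss n.+1 i]/=.
move: (ss n i.+1) => s; rewrite /th /kap; move: (Gf_gt0 (om i.+1) (om i.+2)).
move: (Gf (om i.+1) (om i.+2)) => G' G0'.
have G0 := Gf_gt0 (om i) (om i.+1); rewrite /Gf in G0 *.
move=> den; congr (_ + _).
have c0 := ls_lc0 hS; have := c0 (om i); have := c0 (om i.+1) => c1 c2.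
have den' : lc (om i) * (la (om i.+1) / lc (om i.+1) + - eps (om i.+1) * lc (om i.+2) / (lc (om i.+1) * G') * s) + ld (om i) =
  (lc (om i) * la (om i.+1) + ld (om i) * lc (om i.+1)) / lc (om i.+1) * (1 + - eps (om i.+1) * lc (om i) * lc (om i.+2) /
        ((lc (om i) * la (om i.+1) + ld (om i) * lc (om i.+1)) * G') * s).
  by field; rewrite !gt_eqF.
rewrite den' !invfM invrK; ring.
Qed.

(** The finitely many ingredients from which [rr_ss] builds every convergent. *)
Definition letter_family : seq F :=
  [seq th p.1.1 p.1.2 p.2 | p <- enum {: 'I_B * 'I_B * 'I_B}] ++
  [seq kap p.1 p.2 | p <- enum {: 'I_B * 'I_B}] ++
  [seq la k / lc k | k <- enum 'I_B].

Definition all_family : seq F := letter_family ++ [seq letter_entry k | k <- enum {: 'I_4 * 'I_B}].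

Lemma all_family_in x : x \in all_family -> Lgen x.
Proof.
have hLg f g : Lgen (Gf f g).
  apply: (subfieldD hL); apply: (subfieldM hL);
  by [apply: Lgen_lc|apply: Lgen_la|apply: Lgen_ld].
have hLe k : Lgen (- eps k) by apply: (subfieldN hL); apply: Lgen_eps.
rewrite !mem_cat => /orP[/or3P[/mapP[p _ ->]|/mapP[p _ ->]|/mapP[k _ ->]]|/mapP[k _ ->]].
- apply: (subfield_div hL); last exact: (subfieldM hL).
  by do 2!(apply: (subfieldM hL); last exact: Lgen_lc).
- apply: (subfield_div hL); last by apply: (subfieldM hL) => //; apply: Lgen_lc.
  by apply: (subfieldM hL) => //; apply: Lgen_lc.
- by apply: (subfield_div hL); [apply: Lgen_la|apply: Lgen_lc].
- exact: Lgen_entry.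
Qed.

(** * Sizes of convergents and of their derivatives *)

Section Estimates.
Variables (ds : seq (F -> F)) (C1 : nat).
Hypothesis hds : derivations Lgen ds.
Notation H := (Q ^+ C1).
Notation clsL := (cls Lgen H ds).

Hypothesis cls_family : forall x, x \in all_family ->
  forall G, Q^-1 <= G -> `|x| <= G -> clsL G x.

Let H0 : 0 <= H. Proof. by rewrite exprn_ge0 // ltW // lsQ0. Qed.

Lemma mem_th f g h : th f g h \in letter_family.
Proof. by rewrite /letter_family mem_cat; apply/orP; left; apply/mapP; exists (f, g, h); rewrite ?mem_enum. Qed.
Lemma mem_kap f g : kap f g \in letter_family.
Proof. by rewrite /letter_family !mem_cat; apply/orP; right; apply/orP; left; apply/mapP; exists (f, g); rewrite ?mem_enum. Qed.
Lemma mem_ac k : la k / lc k \in letter_family.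
Proof. by rewrite /letter_family !mem_cat; apply/orP; right; apply/orP; right; apply/mapP; exists k; rewrite ?mem_enum. Qed.

Lemma Qi_le1 : Q^-1 <= 1. Proof. by rewrite invf_le1 ?lsQ0 ?lsQ1. Qed.
Lemma Qi_ge0 : 0 <= Q^-1. Proof. by rewrite invr_ge0 ltW // lsQ0. Qed.

Lemma cls_th f g h : clsL Q^-1 (th f g h).
Proof. by apply: cls_family; rewrite ?th_bound // mem_cat mem_th. Qed.
Lemma cls_kap f g : clsL 1 (kap f g).
Proof. by apply: cls_family; rewrite ?kap_bound ?Qi_le1 // mem_cat mem_kap. Qed.
Lemma cls_ac k : clsL 1 (la k / lc k).
Proof.
apply: cls_family; [by rewrite mem_cat mem_ac|exact: Qi_le1|].
rewrite ger0_norm ?divr_ge0 ?(ls_la0 hS) ?(ltW (ls_lc0 hS _)) //.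
by rewrite ler_pdivrMr ?(ls_lc0 hS) // mul1r (ls_lac hS).
Qed.
Lemma ld_ge1 k : 1 <= ld k. Proof. exact: le_trans (lc_ge1 k) (ls_lcd hS k). Qed.
Lemma cls_entry k : clsL (ld k.2) (letter_entry k).
Proof.
have /andP[h1 h2] := letter_entry_bound k.
apply: cls_family; rewrite ?ger0_norm //; last exact: le_trans Qi_le1 (ld_ge1 _).
by rewrite mem_cat map_f ?orbT ?mem_enum.
Qed.
Lemma cls_la k : clsL (ld k) (la k). Proof. exact: (cls_entry (@Ordinal 4 0 isT, k)). Qed.
Lemma cls_lb k : clsL (ld k) (lb k). Proof. exact: (cls_entry (@Ordinal 4 1 isT, k)). Qed.
Lemma cls_lc k : clsL (ld k) (lc k). Proof. exact: (cls_entry (@Ordinal 4 2 isT, k)). Qed.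
Lemma cls_ld k : clsL (ld k) (ld k). Proof. exact: (cls_entry (@Ordinal 4 3 isT, k)). Qed.
Lemma cls_eps k : clsL 1 (eps k).
Proof. by case: (ls_eps hS k) => ->; [|apply: (clsN hL) => //]; apply: (cls1 hL). Qed.

Lemma cls_mob_inv k y : 0 <= y -> clsL 1 y -> clsL (ld k)^-1 (lc k * y + ld k)^-1.
Proof.
move=> y0 cy; apply: (clsV hL hds (K := 1)); first exact: ls_ld0.
  by rewrite mul1r gtr0_norm ?mob_den_gt0 // lerDr mulr_ge0 // ltW // (ls_lc0 hS).
apply: (clsD hL hds); last exact: cls_ld.
by rewrite -[X in clsL X _]mulr1; apply: (clsM hL hds) => //; apply: cls_lc.
Qed.

Lemma cls_mob k y : 0 <= y -> clsL 1 y -> clsL 1 (mob k y).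
Proof.
move=> y0 cy; rewrite -(mulfV (lt0r_neq0 (ls_ld0 k))).
apply: (clsM hL hds); last exact: cls_mob_inv.
apply: (clsD hL hds); last exact: cls_lb.
by rewrite -[X in clsL X _]mulr1; apply: (clsM hL hds) => //; apply: cls_la.
Qed.

(** The point is uniformity: [H] depends on the alphabet and on [ds], while the length [n] is
    arbitrary. *)
Lemma cls_rr n i : clsL 1 (rr n i).
Proof.
elim: n i => [|n IH] i /=; first exact: cls_ac.
by apply: cls_mob => //; apply: rr_ge0.
Qed.

Lemma ld_sq_inv k : (ld k)^-1 * (ld k)^-1 <= Q^-1.
Proof.
rewrite -invfM lef_pV2 ?posrE ?mulr_gt0 ?ls_ld0 ?lsQ0 //.
rewrite (le_trans (ls_Qc hS k)) // expr2.
by apply: ler_pM; rewrite ?(ls_lcd hS) // ltW // (ls_lc0 hS).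
Qed.

(** Each common letter contributes two denominators by [mobB], whose inverses have class
    [(ld k)^-1]; together they gain a factor [Q^-1], also for all derivatives along [ds]. *)
Lemma cls_rr_diff m n n' i j : (m <= n)%N -> (m <= n')%N ->
  (forall l, (l < m)%N -> om (i + l) = om (j + l)) ->
  clsL (Q^-1 ^+ m) (rr n i - rr n' j).
Proof.
elim: m n n' i j => [|m IH] [|n] [|n'] i j // mn mn' hl;
  try by rewrite expr0; apply: (clsB hL hds); apply: cls_rr.
have := hl 0%N isT; rewrite /= !addn0 => <-.
rewrite mobB ?rr_ge0 // exprSr -!mulrA.
apply: (cls_le H0 (G := 1 * (Q^-1 ^+ m * ((ld (om i))^-1 * (ld (om i))^-1)))).
  by rewrite mul1r ler_wpM2l ?ld_sq_inv // exprn_ge0 // Qi_ge0.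
apply: (clsM hL hds); first exact: cls_eps.
apply: (clsM hL hds).
  by apply: IH => // l lm; rewrite !addSnnS; apply: hl.
by apply: (clsM hL hds); apply: cls_mob_inv; rewrite ?rr_ge0 //; apply: cls_rr.
Qed.

Lemma cls_ss n i : clsL 1 (ss n i).
Proof.
elim: n i => [|n IH] i /=; first exact: (cls1 hL).
rewrite -[X in clsL X _]invr1; apply: (clsV hL hds (K := 2)) => //.
  have /andP[/= h1 h2] := ss_bound n.+1 i; move: h1 h2; rewrite invr_gt0.
  move: (1 + _) => z z0; rewrite -[2 in X in X -> _]invrK lef_pV2 ?posrE ?invr_gt0 // gtr0_norm //.
  lra.
apply: (clsD hL hds); first exact: (cls1 hL).
apply: (cls_le H0 (G := Q^-1 * 1)); first by rewrite mulr1 Qi_le1.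
by apply: (clsM hL hds) => //; apply: cls_th.
Qed.

(** * Approximation of powers of a convergent by elements of controlled degree *)

Section Approximation.
Variables (C0 : nat) (de : F).
Hypotheses (Ade : A C0 de) (A_family : forall x, x \in letter_family -> A C0 (de * x)).

(** [k] is the order of smallness and [e] an allowance for extra denominators: each unit of either
    costs one factor [de] and degree [C0]. *)
Definition graded (e k : nat) (y : F) :=
  A (C0 * (k + e)) (de ^+ (k + e) * y) /\ clsL (Q^-1 ^+ k) y.

Lemma gradedM e e' k k' y y' : graded e k y -> graded e' k' y' ->
  graded (e + e') (k + k') (y * y').
Proof.
move=> [a c] [a' c']; split; last by rewrite exprD; apply: (clsM hL hds).
rewrite addnACA mulnDr exprD mulrACA; exact: AdegM.
Qed.

Lemma graded0 e k : graded e k 0.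
Proof. by split; [rewrite mulr0; apply: Adeg0|apply: (cls0 hL)]. Qed.

Lemma gradedD e k y y' : graded e k y -> graded e k y' -> graded e k (y + y').
Proof.
by move=> [a c] [a' c']; split; [rewrite mulrDr; apply: AdegD|apply: (clsD hL hds)].
Qed.

Lemma graded_sum e k (I : Type) (r : seq I) (f : I -> F) :
  (forall i, graded e k (f i)) -> graded e k (\sum_(i <- r) f i).
Proof. by move=> h; elim/big_ind: _ => //; [apply: graded0|apply: gradedD]. Qed.

Lemma graded_le e e' k y : (e <= e')%N -> graded e k y -> graded e' k y.
Proof.
move=> ee [a c]; split=> //; rewrite -(subnK ee) addnCA exprD -mulrA mulnDr.
by apply: AdegM => //; apply: AdegX.
Qed.

(** The variable of [q] only records orders of smallness; the approximation is [q.[1]], and cutting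
    a product at degree [S] discards terms of class [Q^-1 ^+ S]. *)
Definition approx (S e : nat) (x : F) := exists q : {poly F},
  [/\ (size q <= S)%N, forall k, graded e k q`_k & clsL (Q^-1 ^+ S) (x - q.[1])].

Lemma cls_pow_le a b x : (a <= b)%N -> clsL (Q^-1 ^+ b) x -> clsL (Q^-1 ^+ a) x.
Proof.
by move=> ab; apply: (cls_le H0); rewrite ler_wiXn2l // ?Qi_ge0 ?Qi_le1.
Qed.

Lemma approx_cls S e x : approx S e x -> clsL 1 x.
Proof.
move=> [q [_ gq cq]]; rewrite -(subrK q.[1] x); apply: (clsD hL hds).
  by rewrite -(expr0 Q^-1); apply: cls_pow_le cq.
by apply: (cls_rsum hL) => // i; have [_] := gq i; rewrite -[1](expr0 Q^-1); apply: cls_pow_le.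
Qed.

Lemma approxD S e x y : approx S e x -> approx S e y -> approx S e (x + y).
Proof.
move=> [q [sq gq cq]] [q' [sq' gq' cq']]; exists (q + q'); split.
- by rewrite (leq_trans (size_polyD _ _)) // geq_max sq.
- by move=> k; rewrite coefD; apply: gradedD.
- by rewrite hornerD opprD addrACA; apply: (clsD hL hds).
Qed.

Lemma approxM S e e' x y : approx S e x -> approx S e' y -> approx S (e + e') (x * y).
Proof.
move=> /[dup] ax [q [sq gq cq]] /[dup] ay [q' [sq' gq' cq']].
have cy := approx_cls ay.
have gqq k : graded (e + e') k (q * q')`_k.
  rewrite coefM; apply: graded_sum => i.
  have {1}-> : k = (i + (k - i))%N by rewrite subnKC // -ltnS.
  exact: gradedM.
exists (take_poly S (q * q')); split.
- exact: size_take_poly.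
- by move=> k; rewrite coef_take_poly; case: ifP => _; [apply: gqq|apply: graded0].
have -> : x * y - (take_poly S (q * q')).[1] =
    (x - q.[1]) * y + q.[1] * (y - q'.[1]) + (drop_poly S (q * q')).[1].
  have := congr1 (fun p : {poly F} => p.[1]) (poly_take_drop S (q * q')).
  rewrite hornerD !hornerM hornerXn expr1n mulr1 => e1.
  by rewrite -[(take_poly S _).[1]](addrK (drop_poly S (q * q')).[1]) e1; ring.
have cq1 : clsL 1 q.[1].
  by apply: (cls_rsum hL) => // i; have [_] := gq i; rewrite -[1](expr0 Q^-1); apply: cls_pow_le.
apply: (clsD hL hds); first apply: (clsD hL hds).
- by rewrite -[X in clsL X _]mulr1; apply: (clsM hL hds).
- by rewrite -[X in clsL X _]mul1r; apply: (clsM hL hds).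
apply: (cls_rsum hL) => // i; rewrite coef_drop_poly.
by have [_] := gqq (i + S)%N; apply: cls_pow_le; rewrite leq_addl.
Qed.

Lemma approx_const S e x : graded e 0 x -> approx S e x.
Proof.
move=> gx; case: S => [|S].
  by exists 0; split; [rewrite size_poly0|move=> k; rewrite coef0; apply: graded0|
    rewrite horner0 subr0; case: gx].
exists x%:P; split.
- by rewrite (leq_trans (size_polyC_leq1 _)).
- by move=> k; rewrite coefC; case: eqP => [->//|_]; apply: graded0.
- by rewrite hornerC subrr; apply: (cls0 hL).
Qed.

Lemma graded1 : graded 0 0 1.
Proof.
by split; rewrite ?expr0 ?mulr1; [apply: Adeg1|apply: (cls1 hL)].
Qed.

Lemma approx1 S : approx S 0 1. Proof. exact: approx_const graded1. Qed.

Lemma approx_le S e e' x : (e <= e')%N -> approx S e x -> approx S e' x.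
Proof.
by move=> ee [q [sq gq cq]]; exists q; split=> // k; apply: graded_le (gq k).
Qed.

Lemma approx_th S f g h x : approx S 0 x -> approx S.+1 0 (th f g h * x).
Proof.
move=> [q [sq gq cq]]; exists ((th f g h)%:P * q * 'X); split.
- rewrite mul_polyC; have [->|q0] := eqVneq (th f g h *: q) 0.
    by rewrite mul0r size_poly0.
  by rewrite size_mulX // ltnS (leq_trans (size_scale_leq _ _)).
- move=> [|k]; rewrite coefMX /=; first exact: graded0.
  rewrite coefCM -(add1n k) -(addn0 0%N); apply: gradedM => //.
  split; last by rewrite expr1; apply: cls_th.
  by rewrite addn0 muln1 expr1; apply: A_family; apply: mem_th.
- rewrite !hornerE -mulrBr exprS; apply: (clsM hL hds) => //; exact: cls_th.
Qed.

Lemma approx_exp S e x n : approx S e x -> approx S (e * n) (x ^+ n).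
Proof.
move=> ax; elim: n => [|n IH]; first by rewrite muln0; apply: approx1.
by rewrite exprS mulnS; apply: approxM.
Qed.

(** Induction on the precision: multiplication by [th] raises it by one, so the next tail is needed
    at precision [S] to obtain [z] at precision [S.+1]. The geometric series for [(1 + z)^-1] is
    then cut after [S.+1] terms. *)
Lemma approx_ss S n i : approx S 0 (ss n i).
Proof.
elim: S n i => [|S IH] n i.
  exists 0; split; [by rewrite size_poly0|move=> k; rewrite coef0; exact: graded0|].
  by rewrite horner0 subr0 expr0; apply: cls_ss.
case: n => [|n]; first exact: approx1.
have := approx_th (om i) (om i.+1) (om i.+2) (IH n i.+1); have den := ss_den n i.
have cz : clsL Q^-1 (th (om i) (om i.+1) (om i.+2) * ss n i.+1).
  by rewrite -[X in clsL X _]mulr1; apply: (clsM hL hds); [apply: cls_th|apply: cls_ss].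
have cs := cls_ss n.+1 i; rewrite /= in cs *; move: (th _ _ _ * _) cz den cs => z cz den cs az.
have aNz : approx S.+1 0 (- z).
  move: az => [q [sq gq cq]]; exists (- q); split.
  - by rewrite size_polyN.
  - move=> k; have [a c] := gq k; rewrite coefN; split; last exact: (clsN hL).
    by rewrite mulrN -mulN1r -(rmorphN1 (ratr : rat -> F)); apply: AdegZ.
  - by rewrite hornerN -opprD; apply: (clsN hL).
have geo N : (1 + z)^-1 = \sum_(k < N) (- z) ^+ k + (- z) ^+ N * (1 + z)^-1.
  apply: (mulIf den); rewrite mulVf // mulrDl mulfVK //.
  have -> : (\sum_(k < N) (- z) ^+ k) * (1 + z) = 1 - (- z) ^+ N.
    by rewrite -[RHS]opprB (subrX1 (- z) N); ring.
  by rewrite subrK.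
rewrite (geo S.+1); apply: approxD; last first.
  exists 0; split; [by rewrite size_poly0|move=> k; rewrite coef0; exact: graded0|].
  rewrite horner0 subr0 -[X in clsL X _]mulr1; apply: (clsM hL hds) => //.
  by apply: (clsX hL) => //; apply: (clsN hL).
suff main N : approx S.+1 0 (\sum_(k < N) (- z) ^+ k) by apply: main.
elim: N => [|k IHk]; last first.
  rewrite big_ord_recr /=; apply: approxD => //.
  by rewrite -[0%N](mul0n k); apply: approx_exp.
by rewrite big_ord0; apply: approx_const; apply: graded0.
Qed.

Lemma approx_rr S n i : approx S 1 (rr n.+1 i).
Proof.
have gr x : x \in letter_family -> clsL 1 x -> graded 1 0 x.
  by move=> xf cx; split; rewrite ?expr0 // add0n muln1 expr1; apply: A_family.
rewrite rr_ss; apply: approxD.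
  by apply: approx_const; apply: gr; [apply: mem_ac|apply: cls_ac].
rewrite -(addn0 1%N); apply: approxM; last exact: approx_ss.
by apply: approx_const; apply: gr; [apply: mem_kap|apply: cls_kap].
Qed.

(** The degree is linear in [S] and free of [n], which is what a dimension count can afford; the
    convergent itself would cost a degree growing with [n]. *)
Lemma rr_powers E S n i : exists Y : nat -> F, forall k, (k <= E)%N ->
  A (C0 * (E + S)) (de ^+ (E + S) * Y k) /\ clsL (Q^-1 ^+ S) (rr n.+1 i ^+ k - Y k).
Proof.
have h k : exists y, (k <= E)%N ->
    A (C0 * (E + S)) (de ^+ (E + S) * y) /\ clsL (Q^-1 ^+ S) (rr n.+1 i ^+ k - y).
  have [kE|kE] := leqP k E; last by exists 0.
  have := approx_le (_ : 1 * k <= E)%N (approx_exp k (approx_rr S n i)).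
  rewrite mul1n => /(_ kE) [q [sq gq cq]]; exists q.[1] => _; split=> //.
  rewrite horner_coef mulr_sumr; apply: Adeg_sum => j _.
  rewrite expr1n mulr1; have [a _] := gq j.
  have jS : (j <= S)%N by apply: leq_trans (ltnW (ltn_ord j)) sq.
  have -> : (E + S = (S - j) + (j + E))%N by rewrite addnA subnK // addnC.
  by rewrite exprD -mulrA mulnDr; apply: AdegM => //; apply: AdegX.
have [Y hY] := choice h; by exists Y.
Qed.

End Approximation.
End Estimates.
End Letters.

(** * Leading terms of iterated derivatives *)

Section Leibniz.
Variables (F : realFieldType) (L : F -> Prop) (hL : subfield L).
Variables (D : F -> F) (hD : derivation L D).

Lemma iter_der_in n x : L x -> L (iter n D x).
Proof. by move=> Lx; elim: n => //= n; apply: (der_in hD). Qed.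

Lemma iter_derD n x y : L x -> L y -> iter n D (x + y) = iter n D x + iter n D y.
Proof.
by move=> Lx Ly; elim: n => //= n ->; rewrite (derD hD) //; apply: iter_der_in.
Qed.

Lemma iter_der_rat n (q : rat) : (0 < n)%N -> iter n D (ratr q) = 0.
Proof.
case: n => // n _; elim: n => [|n /= ->]; first exact: (der_rat hL hD).
exact: (der0 hL hD).
Qed.

Lemma der_sum (I : Type) (r : seq I) (f : I -> F) : (forall i, L (f i)) ->
  D (\sum_(i <- r) f i) = \sum_(i <- r) D (f i).
Proof.
move=> Lf; elim: r => [|i r IH]; first by rewrite !big_nil; apply: (der0 hL hD).
by rewrite !big_cons (derD hD) ?IH //; apply: (subfield_sum hL).
Qed.

Lemma der_mulrn x n : L x -> D (x *+ n) = D x *+ n.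
Proof.
move=> Lx; rewrite -mulr_natl (derM hD) ?(der_nat hL hD) //; last exact: (subfield_nat hL).
by rewrite mul0r add0r mulr_natl.
Qed.

Lemma iter_derM n x y : L x -> L y ->
  iter n D (x * y) = \sum_(i < n.+1) iter i D x * iter (n - i) D y *+ 'C(n, i).
Proof.
move=> Lx Ly; have Lt i j : L (iter i D x * iter j D y).
  by apply: (subfieldM hL); apply: iter_der_in.
elim: n => [|n IH]; first by rewrite big_ord_recl big_ord0 addr0.
rewrite iterS IH der_sum; last first.
  by move=> i; rewrite -mulr_natl; apply: (subfieldM hL) => //; apply: (subfield_nat hL).
transitivity (\sum_(i < n.+1) iter i.+1 D x * iter (n - i) D y *+ 'C(n, i) +
    \sum_(i < n.+1) iter i D x * iter (n.+1 - i) D y *+ 'C(n, i)).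
  rewrite -big_split /=; apply: eq_bigr => i _; rewrite der_mulrn // (derM hD); try exact: iter_der_in.
  by rewrite mulrnDl subSn // -ltnS.
rewrite [RHS]big_ord_recl /= ?subn0 bin0 mulr1n.
rewrite [X in _ + X = _]big_ord_recl /= ?subn0 bin0 mulr1n addrCA; congr (_ + _).
rewrite [X in _ = X](eq_bigr (fun i : 'I_n.+1 =>
  iter i.+1 D x * iter (n - i) D y *+ 'C(n, i) + iter i.+1 D x * iter (n - i) D y *+ 'C(n, i.+1))); last first.
  by move=> i _; rewrite /bump /= add1n subSS binS mulrnDr addrC.
rewrite big_split /=; congr (_ + _).
rewrite [RHS]big_ord_recr /= bin_small // mulr0n addr0; apply: eq_bigr => i _.
by rewrite /bump /= add1n subSS.
Qed.

Notation nb := (@nat_bounded F).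

Lemma nb_sum (I : Type) (r : seq I) (P : pred I) (f : I -> F) G :
  (forall i, P i -> nb G (f i)) -> nb G (\sum_(i <- r | P i) f i).
Proof.
by move=> h; elim/big_ind: _ => //; [apply: nat_bounded0|move=> x y; apply: nat_boundedD].
Qed.

Lemma nb_mulrn G x n : nb G x -> nb G (x *+ n).
Proof.
by move=> h; elim: n => [|n IH]; [rewrite mulr0n; apply: nat_bounded0|
  rewrite mulrS; apply: nat_boundedD].
Qed.

Lemma nbN G x : nb G x -> nb G (- x).
Proof. by move=> [K h]; exists K; rewrite normrN. Qed.

Variables (k N : nat) (M tau : F).
Hypotheses (M1 : 1 <= M) (tau0 : 0 <= tau).

Let M0 : 0 <= M. Proof. exact: le_trans ler01 M1. Qed.

Let tauM a b : (a <= b)%N -> tau * M ^+ a <= tau * M ^+ b.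
Proof. by move=> ab; rewrite ler_wpM2l // ler_weXn2l. Qed.

Section Lead.
Variables (x z : F).
Hypotheses (Lx : L x) (Lz : L z).
Hypothesis xM : forall i, (i <= N)%N -> nb M (iter i D x).
Hypothesis zM : forall i, (i <= N)%N -> nb M (iter i D z).
Hypothesis xt : forall i, (i < k)%N -> nb tau (iter i D x).

(** Spread [k * e] derivatives over [e] factors [x] and one [z]: unless every [x] receives exactly
    [k], some [x] receives fewer and brings a factor [tau]. The constant [c] is the multinomial
    coefficient. *)
Lemma lead_power e : (k * e <= N)%N -> exists2 c : nat, (0 < c)%N &
  nb (tau * M ^+ e.+1) (iter (k * e) D (x ^+ e * z) - c%:R * (iter k D x ^+ e * z)).
Proof.
move=> keN.
(* The induction also needs a crude bound at all orders and smallness at the orders below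
   [k * e]. *)
suff : [/\ forall i, (i <= N)%N -> nb (M ^+ e.+1) (iter i D (x ^+ e * z)),
    forall i, (i < k * e)%N -> nb (tau * M ^+ e.+1) (iter i D (x ^+ e * z)) &
    exists2 c : nat, (0 < c)%N &
      nb (tau * M ^+ e.+1) (iter (k * e) D (x ^+ e * z) - c%:R * (iter k D x ^+ e * z))].
  by case.
elim: e keN => [|e IH] keN.
  split; rewrite ?muln0 //.
    by move=> i iN; rewrite expr0 mul1r expr1; apply: zM.
  exists 1%N => //=; rewrite !expr0 !mul1r subrr; exact: nat_bounded0.
have keN' : (k * e <= N)%N by apply: leq_trans keN; rewrite leq_mul2l leqnSn orbT.
have [IHa IHb [c c0 IHc]] := IH keN'.
have Lw : L (x ^+ e * z) by apply: (subfieldM hL) => //; apply: (subfieldX hL).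
have wE : x ^+ e.+1 * z = x * (x ^+ e * z) by rewrite exprS mulrA.
have t1 i j : (i < k)%N -> (j <= N)%N -> nb (tau * M ^+ e.+2) (iter i D x * iter j D (x ^+ e * z)).
  move=> ik jN; apply: (@nat_bounded_le _ (tau * M ^+ e.+1)); first exact: tauM.
  by apply: nat_boundedM; [apply: xt|apply: IHa].
have t2 i j : (i <= N)%N -> (j < k * e)%N -> nb (tau * M ^+ e.+2) (iter i D x * iter j D (x ^+ e * z)).
  move=> iN je; have -> : tau * M ^+ e.+2 = M * (tau * M ^+ e.+1) by rewrite exprS; ring.
  by apply: nat_boundedM; [apply: xM|apply: IHb].
rewrite wE; split.
- move=> i iN; rewrite iter_derM // exprS; apply: nb_sum => j _; apply: nb_mulrn.
  have ji : (j <= i)%N by rewrite -ltnS.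
  by apply: nat_boundedM; [apply: xM|apply: IHa]; lia.
- move=> i ik; rewrite iter_derM //; apply: nb_sum => j _; apply: nb_mulrn.
  have ji : (j <= i)%N by rewrite -ltnS.
  have [jk|jk] := ltnP j k; [apply: t1 => //|apply: t2]; lia.
have kn : (k < (k * e.+1).+1)%N by rewrite ltnS leq_pmulr.
exists ('C(k * e.+1, k) * c)%N.
  by rewrite muln_gt0 c0 bin_gt0 leq_pmulr.
rewrite iter_derM // (bigD1 (Ordinal kn)) //= addrAC; apply: nat_boundedD; last first.
  apply: nb_sum => j jk; apply: nb_mulrn; rewrite -val_eqE /= in jk.
  have ji : (j <= k * e.+1)%N by rewrite -ltnS.
  by have [jk'|jk'] := ltnP j k; [apply: t1 => //|apply: t2]; lia.
have -> : (k * e.+1 - k = k * e)%N by rewrite mulnS addKn.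
set w := iter _ D (_ * _); set y := iter k D x.
have -> : y * w *+ 'C(k * e.+1, k) - ('C(k * e.+1, k) * c)%:R * (y ^+ e.+1 * z) =
    y * (w - c%:R * (y ^+ e * z)) *+ 'C(k * e.+1, k).
  by rewrite -[y * w *+ _]mulr_natl -[y * (_ - _) *+ _]mulr_natl natrM exprS; ring.
apply: nb_mulrn; have -> : tau * M ^+ e.+2 = M * (tau * M ^+ e.+1) by rewrite exprS; ring.
by apply: nat_boundedM => //; apply: xM; lia.
Qed.

End Lead.

Section Chain.
Variable r : F.
Hypothesis Lr : L r.
Hypothesis k0 : (0 < k)%N.
Hypothesis rM : forall i, (i <= k)%N -> nb M (iter i D r).
Hypothesis pM : forall (p : {poly rat}) i, (i <= k)%N -> nb M (iter i D (map_poly ratr p).[r]).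
Hypothesis rt : forall i, (0 < i < k)%N -> nb tau (iter i D r).

(** Apart from the main term, every term of [D ^ k (p (r))] contains a derivative of [r] of order
    strictly between 0 and [k]. *)
Lemma chain_rule (p : {poly rat}) n : (size p <= n)%N ->
  (forall i, (0 < i < k)%N -> nb (tau * M ^+ n) (iter i D (map_poly ratr p).[r])) /\
  nb (tau * M ^+ n) (iter k D (map_poly ratr p).[r] - (map_poly ratr (deriv p)).[r] * iter k D r).
Proof.
have Lp (q : {poly rat}) : L (map_poly (ratr : rat -> F) q).[r].
  by apply: (subfield_horner hL) => // i; rewrite coef_map; apply: (subfield_rat hL).
elim/poly_ind: p n => [|p c IH] n.
  move=> _; rewrite deriv0 rmorph0 !horner0 mul0r subr0.
  have e i : (0 < i)%N -> iter i D 0 = 0.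
    by move=> i0; have := @iter_der_rat i 0 i0; rewrite rmorph0.
  split=> [i /andP[i0 _]|]; rewrite e //; exact: nat_bounded0.
have [->|p0] := eqVneq p 0.
  move=> _; rewrite mul0r add0r derivC rmorph0 horner0 mul0r subr0 map_polyC hornerC.
  by split=> [i /andP[i0 _]|]; rewrite iter_der_rat //; apply: nat_bounded0.
rewrite size_MXaddC (negbTE p0) /=; case: n => // n; rewrite ltnS => /IH [IH1 IH2].
have pE : (map_poly (ratr : rat -> F) (p * 'X + c%:P)).[r] = (map_poly ratr p).[r] * r + ratr c.
  by rewrite rmorphD rmorphM /= map_polyX map_polyC !hornerE.
have dE : (map_poly (ratr : rat -> F) (deriv (p * 'X + c%:P))).[r] =
    (map_poly ratr p).[r] + (map_poly ratr (deriv p)).[r] * r.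
  by rewrite derivMXaddC rmorphD rmorphM /= map_polyX !hornerE.
rewrite pE dE; set y := (map_poly ratr p).[r] in IH1 IH2 *.
have Ly : L y by apply: Lp.
have iE i : (0 < i)%N -> iter i D (y * r + ratr c) = iter i D (y * r).
  move=> i0; rewrite iter_derD ?iter_der_rat ?addr0 //; last exact: (subfield_rat hL).
  exact: (subfieldM hL).
have y0 i : (i <= k)%N -> nb M (iter i D y) by move=> ik; apply: pM.
have mid i j : (0 < i)%N -> (i < k)%N -> (j <= k)%N -> nb (tau * M ^+ n.+1) (iter i D y * iter j D r).
  move=> i0 ik jk; rewrite exprSr mulrA; apply: nat_boundedM; last exact: rM.
  by apply: IH1; rewrite i0.
have mid' i j : (i <= k)%N -> (0 < j < k)%N -> nb (tau * M ^+ n.+1) (iter i D y * iter j D r).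
  move=> ik jk; apply: (@nat_bounded_le _ (tau * M ^+ 1)); first exact: tauM.
  by rewrite expr1 [X in nb _ X]mulrC; apply: nat_boundedM; [apply: rt|apply: y0].
split=> [i /andP[i0 ik]|].
  rewrite iE // iter_derM //; apply: nb_sum => j _; apply: nb_mulrn.
  have ji : (j <= i)%N by rewrite -ltnS.
  have [j0|j0] := posnP j; first by rewrite j0 subn0; apply: mid' => //; lia.
  by apply: mid => //; lia.
rewrite iE // iter_derM // (bigD1 ord0) //= (bigD1 ord_max) /=; last first.
  by rewrite -val_eqE /= -lt0n.
rewrite subn0 subnn bin0 binn !mulr1n /=.
set yk := iter k D y; set rk := iter k D r; set sm := \sum_(_ | _) _.
have -> : y * rk + (yk * r + sm) - (y + (map_poly ratr (deriv p)).[r] * r) * rk =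
    (yk - (map_poly ratr (deriv p)).[r] * rk) * r + sm by ring.
apply: nat_boundedD.
  by rewrite exprSr mulrA; apply: nat_boundedM => //; apply: (rM (i := 0)).
apply: nb_sum => j /andP[j0 jk]; apply: nb_mulrn; rewrite -!val_eqE /= in j0 jk.
have ji : (j <= k)%N by rewrite -ltnS.
by apply: mid => //; lia.
Qed.

End Chain.
End Leibniz.

(** * Iterated derivatives of the convergents are smaller than any power of [Q^-1] *)

Section Mahler.
Variables (F : realFieldType) (ZZ : F -> Prop) (B cc : nat) (Q : F).
Variables (la lb lc ld eps : 'I_B -> F).
Hypothesis hS : letter_system ZZ cc Q la lb lc ld eps.
Variables (om : nat -> 'I_B) (alpha : F) (m : {poly rat}) (dd : nat).
Notation Lg := (Lgen la lb lc ld).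
Notation hL := (Lgen_subfield la lb lc ld).
Notation entry := (letter_entry la lb lc ld).
Notation A := (Adeg entry).
Notation r J := (rr la lb lc ld om J 0).
Notation nb := (@nat_bounded F).
Notation mF := (map_poly (ratr : rat -> F) m).
Notation q := (Q^-1).
Hypothesis alpha01 : 0 <= alpha <= 1.
Hypothesis alpha_r : forall J, `|alpha - r J| <= q ^+ J.
Hypothesis m_monic : m \is monic.
Hypothesis m_size : (1 < size m)%N.
Hypothesis m_root : mF.[alpha] = 0.
Hypothesis Liouville : forall (p : {poly F}) (G : F), 1 <= G ->
  (size p < size m)%N -> (forall i, ZZ p`_i) -> (forall i, `|p`_i| <= G) -> p != 0 ->
  exists K : nat, 1 <= K%:R * G ^+ dd * `|p.[alpha]|.

Let Q1 := lsQ1 hS.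
Let Q0 := lsQ0 hS.
Let q0 : 0 < q. Proof. by rewrite invr_gt0. Qed.
Let q1 : q <= 1. Proof. by rewrite invf_le1. Qed.

Lemma Qq_le a b c : (a + c <= b)%N -> Q ^+ a * q ^+ b <= q ^+ c.
Proof.
move=> h; apply: le_trans (_ : Q ^+ a * q ^+ (a + c) <= _).
  by rewrite ler_wpM2l ?exprn_ge0 ?(ltW Q0) // ler_wiXn2l // ltW.
by rewrite exprD mulrA -exprMn mulfV ?gt_eqF // expr1n mul1r.
Qed.

Lemma nb_q_lt a b x : (b < a)%N -> nb (q ^+ a) x -> `|x| < q ^+ b.
Proof.
move=> ba [K h]; apply: le_lt_trans h _.
rewrite -[a](subnK ba) exprD exprS mulrA mulrA gtr_pMl ?exprn_gt0 //.
apply: le_lt_trans (_ : K%:R * q < 1); last by rewrite ltr_pdivrMr // mul1r (ls_inf hS).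
by rewrite ler_wpM2l // ler_piMl ?exprn_ile1 // ltW.
Qed.

Notation cA := (cc * #|{: 'I_4 * 'I_B}|)%N.

Lemma A_cls ds C1 T x : derivations Lg ds ->
  (forall y, y \in all_family la lb lc ld eps -> forall G, q <= G -> `|y| <= G ->
     cls Lg (Q ^+ C1) ds G y) ->
  A T x -> cls Lg (Q ^+ C1) ds (Q ^+ (cA * T)) x.
Proof.
move=> hds hf h; apply: h.
  split=> [|y z|a y hy]; [exact: (cls0 hL)|exact: (clsD hL)|].
  rewrite -[X in cls _ _ _ X _]mul1r; apply: (clsM hL) => //.
  exact: (cls_rat hL).
move=> e he; apply: (@cls_le _ _ _ _ _ (Q ^+ (cc * \sum_i e i))).
- by rewrite exprn_ge0 // ltW.
- rewrite ler_weXn2l // -mulnA leq_mul2l; apply/orP; right.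
  rewrite -sum_nat_const; apply: leq_sum => i _; exact: he.
rewrite big_distrr /= expr_sum /monomial; elim/big_rec2: _ => [|i G y _ hy].
  exact: (cls1 hL).
apply: (clsM hL) => //; rewrite exprM; apply: (clsX hL) => //.
apply: (cls_le (exprn_ge0 _ (ltW Q0))); last exact: (cls_entry hS hf).
exact: ls_dQ hS _.
Qed.

Lemma A_nb T x : A T x -> nb (Q ^+ (cA * T)) x.
Proof.
move=> Ax; have [C hC] := @cls_exists _ Lg Q Q1 (Lgen_mod hS) [::]
  (all_family la lb lc ld eps) I (all_family_in hS).
by have [] := @A_cls [::] C T x I (hC C (leqnn _)) Ax.
Qed.

Lemma finite_common (p : {poly F}) T : (forall i, A T p`_i) ->
  exists N K : nat, [/\ (0 < N)%N, forall i, ZZ (N%:R * p`_i) &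
    forall i, `|p`_i| <= K%:R * Q ^+ (cA * T)].
Proof.
move=> hp.
suff [N [K [N0 h1 h2]]] : exists N K : nat, [/\ (0 < N)%N,
    forall i, (i < size p)%N -> ZZ (N%:R * p`_i) &
    forall i, (i < size p)%N -> `|p`_i| <= K%:R * Q ^+ (cA * T)].
  exists N, K; split=> // i; case: (ltnP i (size p)) => si; auto.
    by rewrite nth_default // mulr0; apply: (ls_0 hS).
  by rewrite nth_default // normr0 mulr_ge0 // exprn_ge0 // ltW.
elim: (size p) => [|n [N [K [N0 h1 h2]]]]; first by exists 1%N, 0%N.
have [N' N0' h1'] := A_ZZ hS (hp n); have [K' h2'] := A_nb (hp n).
exists (N * N')%N, (K + K')%N; rewrite muln_gt0 N0 N0'; split=> // i.
  rewrite ltnS leq_eqVlt natrM => /predU1P[->|/h1 h].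
    by rewrite -mulrA; apply: (ls_M hS) => //; apply: (ls_nat hS).
  by rewrite mulrAC mulrC; apply: (ls_M hS) => //; apply: (ls_nat hS).
have QA : 0 <= Q ^+ (cA * T) by rewrite exprn_ge0 // ltW.
rewrite ltnS leq_eqVlt natrD mulrDl => /predU1P[->|/h2 h].
  by rewrite (le_trans h2') // lerDr mulr_ge0.
by rewrite (le_trans h) // lerDl mulr_ge0.
Qed.

(** A common standard denominator turns the coefficients into hyperintegers, of size [Q ^+ (cA * T)]
    up to a standard factor; Liouville's inequality then applies. *)
Lemma A_poly_root T (p : {poly F}) : (forall i, A T p`_i) -> (size p < size m)%N -> p != 0 ->
  exists K : nat, 1 <= K%:R * Q ^+ (cA * T * dd) * `|p.[alpha]|.
Proof.
move=> hp szp p0; have [N [K [N0 h1 h2]]] := finite_common hp.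
pose G := (N * K).+1%:R * Q ^+ (cA * T).
have QA : 1 <= Q ^+ (cA * T) by rewrite exprn_ege1.
have NF0 : (N%:R : F) != 0 by rewrite pnatr_eq0 -lt0n.
have [|||||K' hK'] := @Liouville (N%:R *: p) G.
- by rewrite /G; apply: mulr_ege1; rewrite // ler1n.
- by rewrite size_scale.
- by move=> i; rewrite coefZ.
- move=> i; rewrite coefZ normrM normr_nat /G.
  apply: le_trans (_ : (N * K)%:R * Q ^+ (cA * T) <= _).
    by rewrite natrM -mulrA ler_wpM2l.
  by rewrite ler_pM2r ?ler_nat // (lt_le_trans _ QA).
- by rewrite scaler_eq0 (negbTE NF0).
exists (K' * (N * K).+1 ^ dd * N)%N; apply: le_trans hK' _.
rewrite hornerZ normrM normr_nat /G exprMn -exprM !natrM natrX.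
by rewrite le_eqVlt; apply/orP; left; apply/eqP; ring.
Qed.

Lemma mF_monic : mF \is monic. Proof. by rewrite map_monic. Qed.
Lemma mF_size : size mF = size m. Proof. exact: size_map_poly. Qed.

(** As [m] is monic with rational coefficients, division does not raise the degree [T] of the
    coefficients. *)
Lemma A_poly_div T (p : {poly F}) : (forall i, A T p`_i) -> exists u v : {poly F},
  [/\ p = mF * u + v, forall i, A T u`_i, forall i, A T v`_i & (size v < size m)%N].
Proof.
elim: {p}_.+1 {-2}p (ltnSn (size p)) => // n IH p szp hp.
have [sm|sm] := ltnP (size p) (size m).
  exists 0, p; rewrite mulr0 add0r; split=> // i; rewrite coef0; exact: Adeg0.
have p0 : p != 0 by rewrite -size_poly_gt0 (leq_trans _ sm) // ltnW.
pose k := (size p - size m)%N; pose l := lead_coef p.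
pose p1 := p - mF * (l *: 'X^k).
have Al : A T l by apply: hp.
have A1 i : A T p1`_i.
  rewrite coefB; have -> : (mF * (l *: 'X^k))`_i = (if (i < k)%N then 0 else ratr m`_(i - k) * l).
    by rewrite -scalerAr coefZ coefMXn coef_map; case: ifP => _; rewrite ?mulr0 // mulrC.
  rewrite -mulN1r -(rmorphN1 (ratr : rat -> F)); apply: AdegD => //; apply: AdegZ.
  by case: ifP => _; [apply: Adeg0|apply: AdegZ].
have l0 : l != 0 by rewrite lead_coef_eq0.
have m0 : mF != 0 by rewrite monic_neq0 // mF_monic.
have szX : size (mF * (l *: 'X^k)) = size p.
  rewrite -scalerAr size_scale // size_mulXn // mF_size /k subnK //.
have sz1 : (size p1 < size p)%N.
  have : (size p1 <= size p)%N.
    by rewrite (leq_trans (size_polyD _ _)) // size_polyN szX maxnn.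
  rewrite leq_eqVlt => /orP[/eqP e|//].
  have : p1 != 0 by rewrite -size_poly_eq0 e size_poly_eq0.
  rewrite -lead_coef_eq0 lead_coefE e /p1 coefB -lead_coefE -/l.
  have -> : (mF * (l *: 'X^k))`_(size p).-1 = l.
    rewrite -szX -lead_coefE -scalerAr lead_coefZ lead_coefM lead_coefXn mulr1.
    by rewrite (monicP mF_monic) mulr1.
  by rewrite subrr eqxx.
have [u [v [e1 hu hv szv]]] := IH _ (leq_trans sz1 szp) A1.
exists (u + l *: 'X^k), v; split=> //; first by rewrite mulrDr addrAC -e1 /p1 subrK.
move=> i; rewrite coefD; apply: AdegD => //; rewrite coefZ coefXn.
by case: eqP => _; rewrite ?mulr1 ?mulr0 //; apply: Adeg0.
Qed.

(** A nonzero remainder modulo [mF] cannot vanish at [alpha], by [A_poly_root]; so vanishing at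
    [alpha] means divisibility by [mF]. The exponent [e] later tells how many derivatives to
    take. *)
Lemma A_poly_factor T (p : {poly F}) : (forall i, A T p`_i) -> p != 0 ->
  exists e (p' : {poly F}), [/\ p = mF ^+ e * p', forall i, A T p'`_i, p'.[alpha] != 0 &
    (e < size p)%N].
Proof.
elim: {p}_.+1 {-2}p (ltnSn (size p)) => // n IH p szp hp p0.
have [pa|pa] := eqVneq p.[alpha] 0; last first.
  by exists 0%N, p; rewrite expr0 mul1r size_poly_gt0.
have [u [v [e1 hu hv szv]]] := A_poly_div hp.
have v0 : v = 0.
  apply/eqP; apply/negPn/negP => v0; have [K] := A_poly_root hv szv v0.
  move: pa; rewrite e1 hornerD hornerM m_root mul0r add0r => ->.
  by rewrite normr0 mulr0 ler10.
have u0 : u != 0 by apply/eqP => u0; move: p0; rewrite e1 v0 u0 mulr0 addr0 eqxx.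
have szu : (size u < size p)%N.
  have m0 : mF != 0 by rewrite monic_neq0 // mF_monic.
  rewrite e1 v0 addr0 size_mul // mF_size; move: m_size; case: (size m) => [|[|s]] // _.
  by rewrite !addSn /= ltnS leq_addl.
have [e [p' [ue hp' p'0 eu]]] := IH _ (leq_trans szu szp) hu u0.
exists e.+1, p'; split=> //; first by rewrite e1 v0 addr0 ue exprS mulrA.
exact: leq_ltn_trans eu szu.
Qed.

Lemma horner_close (p : {poly F}) G J : 0 <= G -> (forall i, nb G p`_i) ->
  nb (G * q ^+ J) (p.[alpha] - p.[r J]).
Proof.
move=> G0 hp; rewrite !horner_coef -sumrB; apply: nb_sum => i _.
rewrite -mulrBr; apply: nat_boundedM => //.
have /andP[r0 r1] := rr_bound hS om J 0; have /andP[a0 a1] := alpha01.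
exists i; rewrite subrXX normrM mulrC ler_pM // (le_trans (ler_norm_sum _ _ _)) //.
apply: le_trans (_ : \sum_(j < i) (1 : F) <= _); last by rewrite sumr_const card_ord.
apply: ler_sum => j _; rewrite ger0_norm ?mulr_ge0 ?exprn_ge0 //.
by rewrite mulr_ile1 ?exprn_ge0 // exprn_ile1.
Qed.

Lemma A_rat (a : rat) T : A T (ratr a).
Proof. by rewrite -[ratr a]mulr1; apply: AdegZ; apply: Adeg1. Qed.

(** Liouville's inequality at degree [T = 0] bounds the derivative of [m] at [alpha] below by a
    standard positive number. *)
Lemma deriv_lower : exists J0 : nat, forall J, (J0 <= J)%N -> q <= `|(map_poly ratr (deriv m)).[r J]|.
Proof.
have szm' : (size (map_poly (ratr : rat -> F) (deriv m)) < size m)%N.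
  by rewrite size_map_poly lt_size_deriv // monic_neq0.
have m'0 : map_poly (ratr : rat -> F) (deriv m) != 0.
  rewrite map_poly_eq0; apply/eqP => e.
  have := congr1 (fun p : {poly rat} => p`_(size m).-2) e.
  have e2 : ((size m).-2.+1 = (size m).-1)%N by case: (size m) m_size => [|[]].
  rewrite coef_deriv coef0 e2 -lead_coefE (monicP m_monic) => /eqP.
  by rewrite pnatr_eq0 -e2.
have A0 i : A 0 (map_poly (ratr : rat -> F) (deriv m))`_i by rewrite coef_map; apply: A_rat.
have [K] := A_poly_root A0 szm' m'0; rewrite muln0 mul0n expr0 mulr1 => hK.
have hnb i : nb 1 (map_poly (ratr : rat -> F) (deriv m))`_i.
  by have := A_nb (A0 i); rewrite muln0 expr0.
exists 3%N => J J3; have := horner_close J ler01 hnb.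
rewrite mul1r => /nb_q_lt h; have {}h := h 2%N J3.
have K1 : 0 < (K.+1%:R : F) by [].
have low : (K.+1%:R)^-1 <= `|(map_poly (ratr : rat -> F) (deriv m)).[alpha]|.
  rewrite -div1r ler_pdivrMr // mulrC (le_trans hK) // ler_wpM2r // ler_nat.
  exact: leqnSn.
have big : 2 * q <= (K.+1%:R)^-1.
  rewrite -[X in _ <= X]div1r ler_pdivlMr // mulrAC ler_pdivrMr // mul1r -natrM.
  exact: ltW (ls_inf hS _).
have q2 : q ^+ 2 <= q by rewrite expr2 ler_piMl // ltW.
have := lerB_dist (map_poly (ratr : rat -> F) (deriv m)).[alpha]
  ((map_poly (ratr : rat -> F) (deriv m)).[alpha] - (map_poly ratr (deriv m)).[r J]).
rewrite subKr => hh; apply: le_trans hh; rewrite lerBrDr.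
by apply: le_trans (le_trans big low); rewrite mulr_natl mulr2n lerD2l (le_trans (ltW h)).
Qed.

Lemma cls_horner H ds G (p : {poly F}) y : derivations Lg ds ->
  (forall i, cls Lg H ds G p`_i) -> cls Lg H ds 1 y -> cls Lg H ds G p.[y].
Proof.
move=> hds hp hy; rewrite horner_coef; apply: (cls_sum hL) => // i _.
rewrite -[G]mulr1 -(expr1n _ i); apply: (clsM hL) => //; exact: (clsX hL).
Qed.

Lemma q_half : 2 * q <= 1.
Proof. by rewrite ler_pdivrMr // mul1r ltW // (ls_inf hS 2). Qed.

Lemma lower_perturb a (x y : F) : q ^+ a <= `|x| -> `|x - y| < q ^+ a.+1 -> q ^+ a.+1 <= `|y|.
Proof.
move=> hx hxy; have := lerB_dist x (x - y); rewrite subKr => h.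
have qa : 0 < q ^+ a by rewrite exprn_gt0.
have : 2 * q ^+ a.+1 <= q ^+ a by rewrite exprS mulrA ler_piMl ?q_half // ltW.
lra.
Qed.

Lemma tiny_all_below (D : F -> F) k (tau : nat) :
  (forall i, (i < k)%N -> forall kappa, (0 < i)%N -> exists J0 : nat, forall J, (J0 <= J)%N ->
    `|iter i D (r J)| <= q ^+ kappa) ->
  exists J1 : nat, forall i, (0 < i < k)%N -> forall J, (J1 <= J)%N -> `|iter i D (r J)| <= q ^+ tau.
Proof.
move=> h; suff: forall n, (n <= k)%N -> exists J1 : nat, forall i, (0 < i < n)%N ->
    forall J, (J1 <= J)%N -> `|iter i D (r J)| <= q ^+ tau by apply.
elim=> [_|n IH nk]; first by exists 0%N => i; rewrite ltn0 andbF.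
have [J1 h1] := IH (ltnW nk).
have [n0|n0] := posnP n; first by exists 0%N => -[|i] //; rewrite n0 andbF.
have [J2 h2] := h n nk tau n0.
exists (J1 + J2)%N => i /andP[i0]; rewrite ltnS leq_eqVlt => /predU1P[->|ik] J JJ.
  by apply: h2; apply: leq_trans JJ; rewrite leq_addl.
by apply: h1; rewrite ?i0 //; apply: leq_trans JJ; rewrite leq_addr.
Qed.

(** Suppose the lower derivatives are negligible and [D ^ k r_J] is not. The auxiliary polynomial
    [mF ^+ e * P'] at [r_J], differentiated [k * e] times, has main term
    [c * (m'(r_J) * D ^ k r_J) ^+ e * P'(r_J)]. Liouville bounds it below, whereas Siegel makes the
    whole derivative too small. *)
Lemma derivative_tiny (D : F -> F) k kappa : derivation Lg D -> (0 < k)%N ->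
  exists J0 : nat, forall J, (J0 <= J)%N -> `|iter k D (r J)| <= q ^+ kappa.
Proof.
move=> hD; elim/ltn_ind: k kappa => k IHk kappa k0.
apply: contrapT => neg.
have {}neg J0 : exists2 J, (J0 <= J)%N & q ^+ kappa < `|iter k D (r J)|.
  apply: contrapT => h; apply: neg; exists J0 => J JJ; rewrite leNgt.
  by apply/negP => h'; apply: h; exists J.
have [C0 [de [Ade de0 hde]]] : exists C de, [/\ A C de, de != 0 &
    forall x, x \in letter_family la lc ld eps -> A C (de * x)].
  by apply: Lgen_A_seq => x xf; apply: (all_family_in hS); rewrite mem_cat xf.
have [cA' cAE] : {c : nat | c = cA} by exists cA.
(* With [S = lam * T], the coefficients lose [cA' * T] and Liouville loses [cA' * T * dd]; the
   margin [2 * T] beats all exponents fixed before [T]. *)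
have [lam lamE] : {n : nat | n = (cA' * dd.+1 + 2)%N} by eexists.
(* Chosen so that [T + C0 * (E + S) <= La * T] as soon as [E <= T]; [E] then exceeds the ratio of
   dimensions granted by [dimA_doubling]. *)
have [La [LaE La1]] : {n : nat | n = (C0 * lam.+1).+2 /\ (1 < n)%N} by eexists.
have [E [E1 Edim]] : {n : nat | (0 < n)%N /\
    forall T T', (dimA entry T' <= La ^ #|{: 'I_4 * 'I_B}|.+1 * dimA entry T ->
      dimA entry T' < n.+1 * dimA entry T)%N}.
  exists (La ^ #|{: 'I_4 * 'I_B}|.+1)%N; split; first by rewrite expn_gt0 (ltnW La1).
  by move=> T T' h; apply: leq_ltn_trans h _; rewrite ltn_mul2r dimA_gt0 /= ltnS.
have [N NE] : {n : nat | n = (k * E)%N} by eexists.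
pose ds := nseq N D.
have hnseq n : derivations Lg (nseq n D) by elim: n.
have hds : derivations Lg ds := hnseq N.
have [C1 /(_ C1 (leqnn _)) hf] := cls_exists Q1 (Lgen_mod hS) hds (@all_family_in _ _ _ _ _ _ _ _ _ _ hS).
have [T TT0 /Edim Tdim] := @dimA_doubling _ _ entry La (E + C1 * N + kappa.+2 * E + 3) La1.
have [sm smE] : {n : nat | n = size m} by eexists.
have [S SE] : {n : nat | n = (lam * T)%N} by eexists.
have [a aE] : {n : nat | n = (cA' * T * dd)%N} by eexists.
have [Om OmE] : {n : nat | n = (kappa.+2 * E + a + 2)%N} by eexists.
have [W WE] : {n : nat | n = (cA' * T + C1 * N).+1} by eexists.
(* The smallness demanded of the lower derivatives and of [alpha - r_J]: it absorbs every power of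
   [Q ^+ W] met below and still beats the lower bound [q ^+ Om]. *)
have [kap kapE] : {n : nat | n = (W * (sm + E + 2) + Om + kappa + 5)%N} by eexists.
have [J1 hJ1] := tiny_all_below kap IHk.
have [J2 hJ2] := deriv_lower.
have [[|n] JJ hJ] := neg (J1 + J2 + kap + 1)%N; first by move: JJ; rewrite addn1.
have JJ1 : (J1 <= n.+1)%N by apply: leq_trans JJ; rewrite -!addnA leq_addr.
have JJ2 : (J2 <= n.+1)%N by apply: leq_trans JJ; rewrite -!addnA addnCA leq_addr.
have JJ3 : (kap <= n.+1)%N by apply: leq_trans JJ; rewrite addn1 leqW // leq_addl.
have [Y hY] := rr_powers hS om hds hf Ade hde E S n 0.
have [g [gA [i0 i0E gi0] gY]] : exists g : nat -> F, [/\ forall i, A T (g i),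
    exists2 i, (i <= E)%N & g i != 0 & \sum_(i < E.+1) g i * Y i = 0].
  apply: (@Siegel _ _ entry T (C0 * (E + S)) (La * T) E (de ^+ (E + S))).
  - exact: expf_neq0.
  - have ET : (E <= T)%N by apply: leq_trans TT0; rewrite -!addnA leq_addr.
    have : (C0 * E <= C0 * T)%N by rewrite leq_mul2l ET orbT.
    by clear -LaE SE => h; rewrite LaE SE; lia.
  - by move=> i iE; have [] := hY i iE.
  - exact: Tdim.
pose P := \poly_(i < E.+1) g i.
have PA i : A T P`_i by rewrite coef_poly; case: ifP => _ //; apply: Adeg0.
have P0 : P != 0.
  apply/eqP => e; move: gi0; have := congr1 (fun p : {poly F} => p`_i0) e.
  by rewrite coef_poly ltnS i0E coef0 => ->; rewrite eqxx.
have [e [P' [Pe P'A P'a eP]]] := A_poly_factor PA P0.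
have eE : (e <= E)%N by rewrite -ltnS; apply: leq_trans eP (size_poly _ _).
have keN : (k * e <= N)%N by rewrite NE leq_mul2l eE orbT.
set rJ := r n.+1 in hJ *.
have clr : cls Lg (Q ^+ C1) ds 1 rJ by apply: (cls_rr hS om hds hf).
have Lr : Lg rJ := filtered_in clr.
have clP : cls Lg (Q ^+ C1) ds (Q ^+ (cA' * T) * q ^+ S) P.[rJ].
  (* The combination of the [Y i] vanishes exactly, so only the approximation errors survive. *)
  have -> : P.[rJ] = \sum_(i < E.+1) g i * (rJ ^+ i - Y i).
    rewrite horner_poly; under [RHS]eq_bigr => i _ do rewrite mulrBr.
    by rewrite sumrB gY subr0.
  apply: (cls_sum hL) => // i _; apply: (clsM hL) => //.
    by rewrite cAE; apply: A_cls.
  by have [|_] := hY i; rewrite ?ltnS // -ltnS.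
pose x := mF.[rJ]; pose z := P'.[rJ].
have clz : cls Lg (Q ^+ C1) ds (Q ^+ (cA' * T)) z.
  by apply: cls_horner => // i; rewrite cAE; apply: A_cls.
have clp (p : {poly rat}) : cls Lg (Q ^+ C1) ds 1 (map_poly ratr p).[rJ].
  by apply: cls_horner => // i; rewrite coef_map; apply: (cls_rat hL).
have clx : cls Lg (Q ^+ C1) ds 1 x by apply: clp.
pose M := Q ^+ W; pose tau := q ^+ kap; pose tau2 := tau * M ^+ sm.
have M1 : 1 <= M by rewrite exprn_ege1.
have tau0 : 0 <= tau by rewrite exprn_ge0 // ltW.
have tau20 : 0 <= tau2 by rewrite mulr_ge0 // exprn_ge0 // (le_trans ler01).
have tautau2 : tau <= tau2 by rewrite ler_peMr // exprn_ege1.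
have nbM u : cls Lg (Q ^+ C1) ds (Q ^+ (cA' * T)) u -> forall i, (i <= N)%N -> nb M (iter i D u).
  move=> hu i iN; have := filtered_iter iN hu; apply: nat_bounded_le.
  by rewrite -exprM -exprD ler_weXn2l // WE leqW // leq_add2l leq_mul2l iN orbT.
have cl1 u : cls Lg (Q ^+ C1) ds 1 u -> cls Lg (Q ^+ C1) ds (Q ^+ (cA' * T)) u.
  by apply: cls_le; rewrite ?exprn_ege1 // exprn_ge0 // ltW.
have kN : (k <= N)%N by rewrite NE leq_pmulr.
have rtau i : (0 < i < k)%N -> nb tau (iter i D rJ).
  by move=> ik; exists 1%N; rewrite mul1r; apply: hJ1.
have [ch1 ch2] := chain_rule hL hD M1 tau0 Lr k0
  (fun i ik => nbM _ (cl1 _ clr) i (leq_trans ik kN))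
  (fun p i ik => nbM _ (cl1 _ (clp p)) i (leq_trans ik kN)) rtau (eq_leq (esym smE)).
have xt i : (i < k)%N -> nb tau2 (iter i D x).
  case: i => [|i] ik; last by apply: ch1.
  rewrite /= -[x]opprK -[- x]add0r -m_root; apply: nbN.
  have h1 j : nb 1 mF`_j by rewrite coef_map; apply: nat_bounded_rat.
  apply: nat_bounded_le (horner_close n.+1 ler01 h1); rewrite mul1r.
  by apply: le_trans tautau2; rewrite ler_wiXn2l // ltW.
have [c c0 hc] := lead_power hL hD M1 tau20 (filtered_in clx) (filtered_in clz)
  (nbM _ (cl1 _ clx)) (nbM _ clz) xt keN.
have tauM b s : (W * s + b <= kap)%N -> tau * M ^+ s <= q ^+ b.
  by move=> h; rewrite mulrC -exprM; apply: Qq_le.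
have WW s : (s <= sm + E + 2)%N -> (W * s <= W * (sm + E + 2))%N.
  by move=> h; rewrite leq_mul2l h orbT.
have Dx : q ^+ kappa.+2 <= `|iter k D x|.
  apply: (@lower_perturb kappa.+1 ((map_poly ratr (deriv m)).[rJ] * iter k D rJ)).
    by rewrite exprS normrM ler_pM ?exprn_ge0 ?(ltW q0) ?(ltW hJ) // hJ2.
  apply: (@nb_q_lt kappa.+3) => //; rewrite -opprB; apply: nbN.
  apply: nat_bounded_le ch2; apply: tauM.
  have /WW : (sm <= sm + E + 2)%N by rewrite -addnA leq_addr.
  by clear -kapE; rewrite kapE; lia.
have zl : q ^+ a.+2 <= `|z|.
  apply: (@lower_perturb a.+1 P'.[alpha]).
    have [u [v [e1 hu hv szv]]] := A_poly_div P'A.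
    have va : P'.[alpha] = v.[alpha] by rewrite e1 hornerD hornerM m_root mul0r add0r.
    have v0 : v != 0 by apply/eqP => v0; move: P'a; rewrite va v0 horner0 eqxx.
    have [K] := A_poly_root hv szv v0; rewrite -va -cAE -aE => hK.
    rewrite exprVn -div1r ler_pdivrMr ?exprn_gt0 // mulrC (le_trans hK) // ler_wpM2r //.
    exact: ltW (lsQ_absorb hS K (ltnSn a)).
  have hnbP' i : nb (Q ^+ (cA' * T)) P'`_i by rewrite cAE; apply: A_nb.
  apply: (@nb_q_lt a.+3) => //.
  apply: nat_bounded_le (horner_close n.+1 (exprn_ge0 (cA' * T) (ltW Q0)) hnbP').
  apply: Qq_le; apply: leq_trans JJ3.
  have /WW : (1 <= sm + E + 2)%N by rewrite addn2.
  by clear -kapE OmE WE; rewrite muln1 kapE OmE; lia.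
have low : q ^+ Om <= `|iter k D x ^+ e * z|.
  rewrite normrM normrX; apply: le_trans (_ : (q ^+ kappa.+2) ^+ e * q ^+ a.+2 <= _).
    rewrite -exprM -exprD ler_wiXn2l // ?(ltW q0) //.
    have : (kappa.+2 * e <= kappa.+2 * E)%N by rewrite leq_mul2l eE orbT.
    by clear -OmE; rewrite OmE; lia.
  have qk b : 0 <= q ^+ b by rewrite exprn_ge0 // ltW.
  apply: ler_pM => //; first exact: exprn_ge0.
  by apply: lerXn2r; rewrite // nnegrE.
have up : nb (q ^+ Om.+1) (c%:R * (iter k D x ^+ e * z)).
  rewrite -[X in nb _ X](subKr (iter (k * e) D (x ^+ e * z))); apply: nat_boundedD.
    have -> : x ^+ e * z = P.[rJ] by rewrite Pe hornerM horner_exp.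
    have := filtered_iter keN clP; apply: nat_bounded_le.
    rewrite mulrAC -exprM -exprD; apply: Qq_le.
    have : (C1 * (k * e) <= C1 * N)%N by rewrite leq_mul2l keN orbT.
    by clear -TT0 SE lamE OmE aE; rewrite SE lamE OmE aE; lia.
  apply: nbN; apply: nat_bounded_le hc; rewrite /tau2 -mulrA -exprD; apply: tauM.
  have /WW : (sm + e.+1 <= sm + E + 2)%N by clear -eE; lia.
  by clear -kapE; rewrite kapE; lia.
have := nb_q_lt (ltnSn Om) up; rewrite ltNge => /negP; apply.
apply: le_trans low _; by rewrite [X in _ <= X]normrM normr_nat ler_peMl // ler1n.
Qed.

End Mahler.

(** * From iterates of one derivation to mixed derivatives *)

Section Derivations.
Variables (F : realFieldType) (L : F -> Prop) (hL : subfield L).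

Lemma derivation_add D1 D2 : derivation L D1 -> derivation L D2 ->
  derivation L (fun x => D1 x + D2 x).
Proof.
move=> h1 h2; split=> [x Lx|x y Lx Ly|x y Lx Ly].
- by apply: (subfieldD hL); [apply: (der_in h1)|apply: (der_in h2)].
- by rewrite (derD h1) // (derD h2) //; ring.
- by rewrite (derM h1) // (derM h2) //; ring.
Qed.

Lemma derivation_sub D1 D2 : derivation L D1 -> derivation L D2 ->
  derivation L (fun x => D1 x - D2 x).
Proof.
move=> h1 h2; split=> [x Lx|x y Lx Ly|x y Lx Ly].
- by apply: (subfieldB hL); [apply: (der_in h1)|apply: (der_in h2)].
- by rewrite (derD h1) // (derD h2) //; ring.
- by rewrite (derM h1) // (derM h2) //; ring.
Qed.

Lemma derivation_commutator D1 D2 : derivation L D1 -> derivation L D2 ->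
  derivation L (fun x => D1 (D2 x) - D2 (D1 x)).
Proof.
move=> h1 h2; have i1 := der_in h1; have i2 := der_in h2.
have hM := subfieldM hL.
split=> [x Lx|x y Lx Ly|x y Lx Ly].
- by apply: (subfieldB hL); auto.
- by rewrite (derD h1) // (derD h2) // (derD h1) ?(derD h2); auto; ring.
- rewrite (derM h1) // (derM h2) // (derD h1) ?(derD h2); auto.
  by rewrite (derM h1) ?(derM h2) ?(derM h1) ?(derM h2); auto; ring.
Qed.

Variables (r : nat -> F) (q : F).
Hypotheses (Lr : forall J, L (r J)) (q0 : 0 < q) (q1 : q <= 1).
Hypothesis two_q : 2 * q <= 1.

Definition vanishing (f : nat -> F) := forall kappa : nat, exists J0 : nat,
  forall J, (J0 <= J)%N -> `|f J| <= q ^+ kappa.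

Lemma vanishing_ext f g : (forall J, f J = g J) -> vanishing g -> vanishing f.
Proof. by move=> fg h kap; have [J0 hJ] := h kap; exists J0 => J /hJ; rewrite fg. Qed.

Lemma vanishingD f g : vanishing f -> vanishing g -> vanishing (fun J => f J + g J).
Proof.
move=> hf hg kap; have [J0 h0] := hf kap.+1; have [J1 h1] := hg kap.+1.
exists (J0 + J1)%N => J JJ; rewrite (le_trans (ler_normD _ _)) //.
have a := h0 J (leq_trans (leq_addr _ _) JJ); have b := h1 J (leq_trans (leq_addl _ _) JJ).
apply: le_trans (lerD a b) _; rewrite -mulr2n -mulr_natl exprS mulrA ler_piMl //.
by rewrite exprn_ge0 // ltW.
Qed.

Lemma vanishingN f : vanishing f -> vanishing (fun J => - f J).
Proof. by move=> h kap; have [J0 hJ] := h kap; exists J0 => J /hJ; rewrite normrN. Qed.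

Lemma vanishingB f g : vanishing f -> vanishing g -> vanishing (fun J => f J - g J).
Proof. by move=> hf hg; apply: vanishingD => //; apply: vanishingN. Qed.

Lemma vanishing_natV f (n : nat) : (0 < n)%N -> vanishing (fun J => f J *+ n) -> vanishing f.
Proof.
move=> n0 h kap; have [J0 hJ] := h kap; exists J0 => J /hJ; apply: le_trans.
by rewrite -mulr_natl normrM normr_nat ler_peMl // ler1n.
Qed.

Hypothesis pure : forall D k, derivation L D -> (0 < k)%N ->
  vanishing (fun J => iter k D (r J)).

Lemma vanishing1 D : derivation L D -> vanishing (fun J => D (r J)).
Proof. by move=> hD; apply: (pure (k := 1)). Qed.

(** Polarisation: [2 D1 D2 = (D1 + D2)^2 - D1^2 - D2^2 + [D1, D2]], and the commutator is again a
    derivation. *)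
Lemma vanishing2 D1 D2 : derivation L D1 -> derivation L D2 ->
  vanishing (fun J => D1 (D2 (r J))).
Proof.
move=> h1 h2; apply: (vanishing_natV (n := 2)) => //.
have a := pure (k := 2) (derivation_add h1 h2) isT.
have b := pure (k := 2) h1 isT; have c := pure (k := 2) h2 isT.
have d := vanishing1 (derivation_commutator h1 h2).
apply: vanishing_ext (vanishingD (vanishingB (vanishingB a b) c) d) => J /=.
have i1 := der_in h1; have i2 := der_in h2.
by rewrite (derD h1) ?(derD h2); auto; rewrite -mulr_natl; ring.
Qed.

(** First [x y y]: up to terms with a commutator, which [vanishing2] settles,
    [(x + y)^3 + (x - y)^3 - 2 x^3] is [6 x y y]. Then polarise in the last two arguments. *)
Lemma vanishing3 D1 D2 D3 : derivation L D1 -> derivation L D2 -> derivation L D3 ->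
  vanishing (fun J => D1 (D2 (D3 (r J)))).
Proof.
have sq x y : derivation L x -> derivation L y -> vanishing (fun J => x (y (y (r J)))).
  move=> hx hy; apply: (vanishing_natV (n := 6)) => //.
  have a := pure (k := 3) (derivation_add hx hy) isT.
  have b := pure (k := 3) (derivation_sub hx hy) isT.
  have c := pure (k := 3) hx isT.
  have xy := derivation_commutator hx hy.
  have d := vanishing2 xy hy; have e := vanishing2 hy xy.
  apply: vanishing_ext (vanishingD (vanishingD (vanishingB (vanishingB (vanishingD a b) c) c)
    (vanishingD (vanishingD d d) (vanishingD d d))) (vanishingD e e)) => J /=.
  have i1 := der_in hx; have i2 := der_in hy.
  have LD := subfieldD hL; have LN := subfieldN hL.
  rewrite !(derD hx, derD hy, derN hL hx, derN hL hy); auto 30.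
  by rewrite -mulr_natl; ring.
move=> h1 h2 h3; apply: (vanishing_natV (n := 2)) => //.
have a := sq _ _ h1 (derivation_add h2 h3); have b := sq _ _ h1 h2; have c := sq _ _ h1 h3.
have d := vanishing2 h1 (derivation_commutator h2 h3).
apply: vanishing_ext (vanishingD (vanishingB (vanishingB a b) c) d) => J /=.
have i1 := der_in h1; have i2 := der_in h2; have i3 := der_in h3.
have LD := subfieldD hL; have LN := subfieldN hL.
rewrite !(derD h1, derD h2, derD h3, derN hL h1); auto 30.
by rewrite -mulr_natl; ring.
Qed.

End Derivations.

(** * Finitely many derivations that detect the constants *)

Section FiniteFamily.
Variables (F : realFieldType) (B : nat) (la lb lc ld : 'I_B -> F).
Notation Lg := (Lgen la lb lc ld).
Notation hL := (Lgen_subfield la lb lc ld).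
Notation entry := (letter_entry la lb lc ld).

Definition entry_mx n (Ds : 'I_n -> F -> F) : 'M[F]_(n, #|{: 'I_4 * 'I_B}|) :=
  \matrix_(i, k) Ds i (entry (enum_val k)).

(** Take a family whose values on the entries have maximal rank. The values of any further
    derivation lie in the row space, and they determine it on the generated field. Finiteness allows
    uniform constants later. *)
Lemma derivation_family : exists n (Ds : 'I_n -> F -> F),
  (forall i, derivation Lg (Ds i)) /\
  forall D, derivation Lg D -> forall x, Lg x -> (forall i, Ds i x = 0) -> D x = 0.
Proof.
pose P k := `[< exists n (Ds : 'I_n -> F -> F), (forall i, derivation Lg (Ds i)) /\
  \rank (entry_mx Ds) = k >].
have exP : exists k, P k.
  exists (\rank (entry_mx (fun (i : 'I_0) (x : F) => x))); apply/asboolP.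
  by exists 0%N, (fun (i : 'I_0) (x : F) => x); split=> // -[].
have Pub k : P k -> (k <= #|{: 'I_4 * 'I_B}|)%N.
  by move=> /asboolP [n [Ds [_ <-]]]; apply: rank_leq_col.
case: (ex_maxnP exP Pub) => k /asboolP [n [Ds [hDs rk]]] kmax.
exists n, Ds; split=> // D hD x Lx Dsx.
pose Ds' (i : 'I_(1 + n)) := if fintype.split i is inr j then Ds j else D.
have hDs' i : derivation Lg (Ds' i) by rewrite /Ds'; case: fintype.split.
pose v : 'rV[F]_#|{: 'I_4 * 'I_B}| := \row_k D (entry (enum_val k)).
have eM : entry_mx Ds' = col_mx v (entry_mx Ds).
  apply/matrixP => i j; rewrite !mxE /Ds'; case: fintype.split => i'; by rewrite !mxE.
have vM : (v <= entry_mx Ds)%MS.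
  have h : (\rank (entry_mx Ds') <= k)%N by apply: kmax; apply/asboolP; exists (1 + n)%N, Ds'.
  have h2 : (entry_mx Ds <= v + entry_mx Ds)%MS by apply: addsmxSr.
  have h3 : (\rank (v + entry_mx Ds)%MS <= \rank (entry_mx Ds))%N.
    by rewrite rk addsmxE -eM.
  have := mxrank_leqif_sup h2 => -[_ e].
  have : (v + entry_mx Ds <= entry_mx Ds)%MS by rewrite -e eqn_leq h3 mxrankS.
  by apply: submx_trans; apply: addsmxSl.
have [f vE] := submxP vM.
have main y : Lg y -> Lg y /\ D y = \sum_i f 0 i * Ds i y.
  move=> Ly; apply: (Ly (fun y => Lg y /\ D y = \sum_i f 0 i * Ds i y)).
    have LB := subfieldB hL; have LM := subfieldM hL.
    split=> [|y1 y2 [L1 e1] [L2 e2]|y1 y2 [L1 e1] [L2 e2]|y1 [L1 e1]].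
    - split; first exact: (subfield1 hL).
      rewrite (der1 hL hD) big1 // => i _; by rewrite (der1 hL (hDs i)) mulr0.
    - split; first exact: LB.
      rewrite (derB hL hD) // e1 e2 -sumrB; apply: eq_bigr => i _.
      by rewrite (derB hL (hDs i)) // mulrBr.
    - split; first exact: LM.
      rewrite (derM hD) // e1 e2 mulr_suml mulr_sumr -big_split /=; apply: eq_bigr => i _.
      by rewrite (derM (hDs i)) //; ring.
    - split; first exact: (subfieldV hL).
      rewrite (derV hL hD) // e1 mulNr mulr_suml -sumrN; apply: eq_bigr => i _.
      by rewrite (derV hL (hDs i)) //; ring.
  move=> k'; split; first exact: Lgen_entry.
  have /matrixP/(_ 0 (enum_rank k')) := vE; rewrite !mxE enum_rankK => ->.
  by apply: eq_bigr => i _; rewrite mxE enum_rankK.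
have [_ ->] := main x Lx; rewrite big1 // => i _; by rewrite Dsx mulr0.
Qed.

End FiniteFamily.

(** * Matrices of words: sizes and denominators *)

Section Words.
Variables (F : realFieldType) (ZZ : F -> Prop) (B cc : nat) (Q : F).
Variables (la lb lc ld eps : 'I_B -> F).
Hypothesis hS : letter_system ZZ cc Q la lb lc ld eps.
Variable om : nat -> 'I_B.
Notation Lg := (Lgen la lb lc ld).
Notation hL := (Lgen_subfield la lb lc ld).
Notation entry := (letter_entry la lb lc ld).
Notation rr := (rr la lb lc ld om).
Notation q := (Q^-1).

Fixpoint word_mx (j i : nat) : F * F * F * F :=
  if j is j'.+1 then
    let: (a, b, c, d) := word_mx j' i.+1 in
    (la (om i) * a + lb (om i) * c, la (om i) * b + lb (om i) * d,
     lc (om i) * a + ld (om i) * c, lc (om i) * b + ld (om i) * d)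
  else (1, 0, 0, 1).

Fixpoint word_size (j i : nat) : F := if j is j'.+1 then ld (om i) * word_size j' i.+1 else 1.

(** The inverse of [c * y + d], where [c], [d] form the lower row of the word matrix and [y] is the
    tail convergent. As a product over letters it visibly has class [(word_size j i)^-1]. *)
Fixpoint word_u (j n i : nat) : F :=
  if j is j'.+1 then (lc (om i) * rr (j' + n) i.+1 + ld (om i))^-1 * word_u j' n i.+1 else 1.

Lemma word_size_ge1 j i : 1 <= word_size j i.
Proof.
elim: j i => //= j IH i; apply: mulr_ege1 => //; exact: ld_ge1 hS _.
Qed.

Lemma word_size_le j i : word_size j i <= Q ^+ (cc * j).
Proof.
elim: j i => [|j IH] i /=; first by rewrite muln0.
rewrite mulnS exprD; apply: ler_pM => //; last exact: ls_dQ hS _.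
  exact: ltW (ls_ld0 hS _).
exact: le_trans ler01 (word_size_ge1 _ _).
Qed.

Lemma word_mx_facts j n i : exists e, let: (a, b, c, d) := word_mx j i in
  [/\ e = 1 \/ e = -1, a * d - b * c = e,
     word_u j n i * (c * rr n (i + j) + d) = 1 &
     rr (j + n) i * (c * rr n (i + j) + d) = a * rr n (i + j) + b].
Proof.
elim: j i => [|j IH] i /=.
  exists 1; rewrite addn0; split; [by left| | |]; by rewrite ?mulr0 ?mul0r ?subr0 ?add0r ?addr0 ?mul1r ?mulr1.
have [e] := IH i.+1; case: (word_mx j i.+1) => [[[a b] c] d].
rewrite addSnnS => -[he hdet hu hr]; exists (eps (om i) * e); set r' := rr n _ in hu hr *.
set y := rr (j + n) i.+1 in hr *.
have den0 : lc (om i) * y + ld (om i) != 0 by rewrite gt_eqF ?(mob_den_gt0 hS) ?(rr_ge0 hS).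
have E : (lc (om i) * a + ld (om i) * c) * r' + (lc (om i) * b + ld (om i) * d) =
    (lc (om i) * y + ld (om i)) * (c * r' + d).
  by rewrite [RHS]mulrDl -[lc _ * y * _]mulrA hr; ring.
split.
- by case: (ls_eps hS (om i)) => ->; case: he => ->; rewrite ?mulrNN ?mulr1 ?mul1r; auto.
- by rewrite -hdet -(ls_det hS (om i)); ring.
- by rewrite E mulrACA mulVf // mul1r.
- by rewrite E /mob mulrA mulfVK // [LHS]mulrDl -[la _ * y * _]mulrA hr; ring.
Qed.

Lemma word_mx_pos j i : let: (a, b, c, d) := word_mx j i in
  [/\ 0 <= a, 0 <= c, ((0 < j)%N -> Q <= c ^+ 2) & ZZ c /\ ZZ a].
Proof.
elim: j i => [|j IH] i /=.
  by split=> //; split; [apply: (ls_0 hS)|apply: (ls_1 hS)].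
have := IH i.+1; case: j {IH} => [|j].
  move=> _ /=; rewrite !mulr1 !mulr0 !addr0.
  split; rewrite ?(ls_la0 hS) ?(ls_Qc hS) ?(ltW (ls_lc0 hS _)) //.
  by split; [apply: (ls_lc hS)|apply: (ls_la hS)].
case: (word_mx j.+1 i.+1) => [[[a b] c] d] [a0 c0 /(_ isT) cQ [Zc Za]].
have h1 := ls_la0 hS (om i); have h2 := ls_lb0 hS (om i); have h3 := ltW (ls_lc0 hS (om i)).
have h4 := ltW (ls_ld0 hS (om i)).
split; rewrite ?addr_ge0 ?mulr_ge0 //.
  move=> _; apply: le_trans cQ _; rewrite lerXn2r ?nnegrE ?addr_ge0 ?mulr_ge0 //.
  rewrite (le_trans (_ : c <= ld (om i) * c)) ?lerDr ?mulr_ge0 //.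
  by rewrite ler_peMl // (ld_ge1 hS).
by split; apply: (ls_D hS); apply: (ls_M hS) => //;
  [apply: (ls_lc hS)|apply: (ls_ld hS)|apply: (ls_la hS)|apply: (ls_lb hS)].
Qed.

Lemma word_mx_filtered P H ds (G : nat -> nat -> F) j i :
  (forall G, P G 0) -> (forall G x y, P G x -> P G y -> P G (x + y)) ->
  (forall G G' x y, P G x -> P G' y -> P (G * G') (x * y)) -> P 1 (-1) ->
  derivations Lg ds -> (forall i, G 0 i = 1) ->
  (forall k j i, k.2 = om i -> exists g, filtered Lg P H ds g (entry k) /\ g * G j i.+1 = G j.+1 i) ->
  let: (a, b, c, d) := word_mx j i in
  [/\ filtered Lg P H ds (G j i) a, filtered Lg P H ds (G j i) b,
      filtered Lg P H ds (G j i) c & filtered Lg P H ds (G j i) d].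
Proof.
move=> P0 PD PM PN hds G0 hG; elim: j i => [|j IH] i /=.
  by rewrite G0; split; [exact: (filtered1 hL)|exact: (filtered0 hL)|
    exact: (filtered0 hL)|exact: (filtered1 hL)].
have := IH i.+1; case: (word_mx j i.+1) => [[[a b] c] d] [fa fb fc fd].
have t (k : 'I_4) y : filtered Lg P H ds (G j i.+1) y ->
    filtered Lg P H ds (G j.+1 i) (entry (k, om i) * y).
  by move=> fy; have [g [fg <-]] := hG (k, om i) j i erefl; apply: (filteredM hL).
pose ka := @Ordinal 4 0 isT; pose kb := @Ordinal 4 1 isT.
pose kc := @Ordinal 4 2 isT; pose kd := @Ordinal 4 3 isT.
split; apply: (filteredD hL) => //.
- exact: (t ka). - exact: (t kb). - exact: (t ka). - exact: (t kb).
- exact: (t kc). - exact: (t kd). - exact: (t kc). - exact: (t kd).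
Qed.

Section WordCls.
Variables (ds : seq (F -> F)) (C1 : nat).
Hypothesis hds : derivations Lg ds.
Hypothesis cls_family : forall x, x \in all_family la lb lc ld eps ->
  forall G, q <= G -> `|x| <= G -> cls Lg (Q ^+ C1) ds G x.

Lemma word_mx_cls j i : let: (a, b, c, d) := word_mx j i in
  let clsw := cls Lg (Q ^+ C1) ds (word_size j i) in [/\ clsw a, clsw b, clsw c & clsw d].
Proof.
apply: (@word_mx_filtered _ _ _ word_size) => //.
- exact: nat_bounded0.
- exact: nat_boundedD.
- exact: nat_boundedM.
- exact: nat_boundedN1.
move=> [k k'] j' i' /= ->; exists (ld (om i')); split=> //.
exact: (cls_entry hS cls_family (k, om i')).
Qed.

Lemma word_u_cls j n i : cls Lg (Q ^+ C1) ds (word_size j i)^-1 (word_u j n i).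
Proof.
elim: j i => [|j IH] i /=; first by rewrite invr1; apply: (cls1 hL).
rewrite invfM; apply: (clsM hL) => //.
apply: (cls_mob_inv hS hds cls_family); first exact: (rr_ge0 hS).
exact: (cls_rr hS om hds cls_family).
Qed.

End WordCls.

Definition integral_at (G x : F) := ZZ (G * x).

(** The free multiple [h2] leaves room for other denominators, so that constants obtained separately
    can be merged into one product. *)
Lemma den_exists ds (xs : seq F) : derivations Lg ds -> (forall x, x \in xs -> Lg x) ->
  exists C h, [/\ ZZ h, h != 0, `|h| <= Q ^+ C & forall h2, ZZ h2 -> forall x, x \in xs ->
    forall g, ZZ g -> ZZ (g * x) -> filtered Lg integral_at (h * h2) ds g x].
Proof.
have Q1 := lsQ1 hS.
elim: ds xs => [|D ds IH] xs /=.
  move=> _ hxs; exists 0%N, 1; rewrite normr1 oner_eq0; split=> //; first exact: (ls_1 hS).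
  by move=> h2 _ x xxs g Zg Zgx; split; [apply: hxs|].
move=> [hD hds] hxs.
have [|C [h [Zh h0 hC hh]]] := IH (xs ++ map D xs) hds.
  move=> x; rewrite mem_cat => /orP[/hxs//|/mapP[y yxs ->]].
  exact: (der_in hD (hxs _ yxs)).
have [C' [h' [Zh' h0' hC' hh']]] : exists C' h', [/\ ZZ h', h' != 0, `|h'| <= Q ^+ C' &
    forall x, x \in xs -> ZZ (h' * D x)].
  elim: xs hxs {IH hh} => [|x xs IHx] hxs.
    by exists 0%N, 1; rewrite normr1 oner_eq0; split=> //; exact: (ls_1 hS).
  have [|C' [h' [Zh' h0' hC' hh']]] := IHx; first by move=> y yxs; apply: hxs; rewrite inE yxs orbT.
  have [C2 [h2 [Zh2 h20 hC2 hh2]]] := Lgen_den hS (der_in hD (hxs x (mem_head _ _))).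
  exists (C' + C2)%N, (h' * h2); split; [exact: (ls_M hS)|exact: mulf_neq0| |].
    by rewrite normrM exprD ler_pM.
  move=> y; rewrite inE => /predU1P[->|/hh' Zy].
    by rewrite -mulrA; apply: (ls_M hS).
  by rewrite mulrAC; apply: (ls_M hS).
exists (C + C')%N, (h * h'); split; [exact: (ls_M hS)|exact: mulf_neq0| |].
  by rewrite normrM exprD ler_pM.
move=> h2 Zh2 x xxs g Zg Zgx; rewrite -mulrA.
have Z2 : ZZ (h' * h2) by apply: (ls_M hS).
split; first by apply: hh => //; rewrite mem_cat xxs.
apply: hh => //; first by rewrite mem_cat map_f ?orbT.
  by apply: (ls_M hS) => //; apply: (ls_M hS).
have -> : g * (h * (h' * h2)) * D x = (g * h * h2) * (h' * D x) by ring.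
by apply: (ls_M hS); [do !apply: (ls_M hS)|apply: hh'].
Qed.

(** The constants are tied to a finite list of elements and of derivations; applied to the entries,
    they serve words of every length. *)
Lemma uniform_constants (K : finType) (dsf : K -> seq (F -> F)) (xs : seq F) :
  (forall k, derivations Lg (dsf k)) -> (forall x, x \in xs -> Lg x) ->
  exists C1 C2 h, [/\ ZZ h, h != 0, `|h| <= Q ^+ C2,
    forall k x, x \in xs -> forall G, q <= G -> `|x| <= G -> cls Lg (Q ^+ C1) (dsf k) G x &
    forall k x, x \in xs -> ZZ x -> filtered Lg integral_at h (dsf k) 1 x].
Proof.
move=> hds hxs; have Q1 := lsQ1 hS.
suff [C1 [C2 [h [Zh h0 hC hc hi]]]] : exists C1 C2 h, [/\ ZZ h, h != 0, `|h| <= Q ^+ C2,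
    forall C, (C1 <= C)%N -> forall k, k \in enum K -> forall x, x \in xs ->
      forall G, q <= G -> `|x| <= G -> cls Lg (Q ^+ C) (dsf k) G x &
    forall h2, ZZ h2 -> forall k, k \in enum K -> forall x, x \in xs -> ZZ x ->
      filtered Lg integral_at (h * h2) (dsf k) 1 x].
  exists C1, C2, h; split=> //; first by move=> k x xxs; apply: hc; rewrite ?mem_enum.
  move=> k x xxs Zx; rewrite -[h]mulr1; apply: hi => //; first exact: (ls_1 hS).
  by rewrite mem_enum.
elim: (enum K) => [|k s [C1 [C2 [h [Zh h0 hC hc hi]]]]].
  by exists 0%N, 0%N, 1; rewrite normr1 oner_eq0; split=> //; exact: (ls_1 hS).
have [C1' hc'] := cls_exists Q1 (Lgen_mod hS) (hds k) hxs.
have [C2' [h' [Zh' h0' hC' hi']]] := den_exists (hds k) hxs.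
exists (C1 + C1')%N, (C2 + C2')%N, (h * h'); split; [exact: (ls_M hS)|exact: mulf_neq0| | |].
- by rewrite normrM exprD ler_pM.
- move=> C CC k'; rewrite inE => /predU1P[->|ks] x xxs.
    by apply: hc' => //; apply: leq_trans CC; rewrite leq_addl.
  by apply: hc => //; apply: leq_trans CC; rewrite leq_addr.
- move=> h2 Zh2 k'; rewrite inE => /predU1P[->|ks] x xxs Zx.
    rewrite [h * h']mulrC -mulrA; apply: hi' => //; rewrite ?mul1r //; last exact: (ls_1 hS).
    exact: (ls_M hS).
  by rewrite -mulrA; apply: hi => //; apply: (ls_M hS).
Qed.

End Words.

(** * Logarithmic derivatives in coordinates adapted to a convergent *)

Section Forms.
Variables (F : realFieldType) (L : F -> Prop) (hL : subfield L).
Variables (H mm lam rJ : F).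
Hypotheses (H1 : 1 <= H) (mm1 : 1 <= mm) (lam0 : 0 <= lam) (lam1 : lam <= 1).
Hypothesis Lr : L rJ.
Notation clsL := (cls L H).
Let H0 : 0 <= H. Proof. exact: le_trans ler01 H1. Qed.
Let mm0 : 0 < mm. Proof. exact: lt_le_trans ltr01 mm1. Qed.

(* For r the slope of an eigenvector, xi21, xi22 and v3 are the entries of the
   traceless matrix (v1, v2; v3, -v1) in the basis (r, 1), (1, 0). *)
Definition xi21 (v1 v2 v3 : F) := v2 + (rJ * v1 + rJ * v1) - rJ * (rJ * v3).
Definition xi22 (v1 v3 : F) := v1 - rJ * v3.

(** The weights [mm^-1 ^+ 2], 1 and [mm ^+ 2] have product 1, and the first coordinate has the
    additional gain [lam]. *)
Definition good ds (G v1 v2 v3 : F) : Prop :=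
  [/\ clsL ds (mm^-1 ^+ 2 * G * lam) (xi21 v1 v2 v3), clsL ds G (xi22 v1 v3),
      clsL ds (mm ^+ 2 * G) v3 & [/\ L v1, L v2 & L v3]].

(** The coordinates depend on [rJ], so differentiating them produces terms in [D rJ]; the bound on
    [tau] makes these negligible against the weights. *)
Lemma good_der D ds G tau v1 v2 v3 : derivation L D -> derivations L ds -> 0 <= G ->
  clsL ds tau (D rJ) -> tau <= mm^-1 ^+ 2 * lam ->
  good (D :: ds) G v1 v2 v3 -> good ds (G * H) (D v1) (D v2) (D v3).
Proof.
move=> hD hds G0 ct htau [/= [c1 c1'] [c2 c2'] [c3 c3'] [L1 L2 L3]].
have LM := subfieldM hL; have LD := subfieldD hL; have LN := subfieldN hL.
have GH : G <= G * H by rewrite ler_peMr.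
have e2 : xi22 (D v1) (D v3) = D (xi22 v1 v3) + D rJ * v3.
  by rewrite /xi22 (derB hL hD) // ?(derM hD) //; [ring|apply: LM].
have e1 : xi21 (D v1) (D v2) (D v3) = D (xi21 v1 v2 v3) - (D rJ * xi22 v1 v3 + D rJ * xi22 v1 v3).
  by rewrite /xi21 /xi22 !(derD hD, derN hL hD, derM hD); auto 20; ring.
have mi : 0 <= mm^-1 ^+ 2 by rewrite exprn_ge0 // invr_ge0 ltW.
split.
- rewrite e1; apply: (clsB hL) => //; first by rewrite mulrA mulrAC.
  have := cls_le H0 (_ : tau * G <= mm^-1 ^+ 2 * (G * H) * lam) (clsM hL hds ct c2).
  move=> h; have {}h := h (le_trans (ler_wpM2r G0 htau) _).
  apply: (clsD hL) => //; apply: h;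
  by rewrite mulrAC ler_wpM2r // ler_wpM2l.
- rewrite e2; apply: (clsD hL) => //.
  apply: (cls_le H0 (G := tau * (mm ^+ 2 * G))); last exact: (clsM hL).
  apply: le_trans GH; rewrite mulrA ler_piMl //.
  apply: le_trans (ler_wpM2r (exprn_ge0 2 (ltW mm0)) htau) _.
  by rewrite mulrAC -exprMn mulVf ?gt_eqF // expr1n mul1r.
- by rewrite mulrA.
- by split; apply: (der_in hD).
Qed.

Lemma good_behead D ds G v1 v2 v3 : good (D :: ds) G v1 v2 v3 -> good ds G v1 v2 v3.
Proof. by move=> [[? _] [? _] [? _] ?]. Qed.

Definition det3 (v1 v2 v3 w1 w2 w3 z1 z2 z3 : F) :=
  v1 * (w2 * z3 - w3 * z2) - v2 * (w1 * z3 - w3 * z1) + v3 * (w1 * z2 - w2 * z1).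

(** In these coordinates each term of the determinant has one factor of each kind: the weights
    cancel and one [lam] remains. *)
Lemma good_det G1 G2 G3 v1 v2 v3 w1 w2 w3 z1 z2 z3 :
  good [::] G1 v1 v2 v3 -> good [::] G2 w1 w2 w3 -> good [::] G3 z1 z2 z3 ->
  nat_bounded (G1 * G2 * G3 * lam) (det3 v1 v2 v3 w1 w2 w3 z1 z2 z3).
Proof.
move=> [[_ a1] [_ a2] [_ a3] _] [[_ b1] [_ b2] [_ b3] _] [[_ c1] [_ c2] [_ c3] _].
have -> : det3 v1 v2 v3 w1 w2 w3 z1 z2 z3 =
    xi22 v1 v3 * xi21 w1 w2 w3 * z3 - xi22 v1 v3 * xi21 z1 z2 z3 * w3
    - xi21 v1 v2 v3 * xi22 w1 w3 * z3 + xi21 v1 v2 v3 * xi22 z1 z3 * w3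
    + v3 * xi22 w1 w3 * xi21 z1 z2 z3 - v3 * xi21 w1 w2 w3 * xi22 z1 z3.
  by rewrite /det3 /xi21 /xi22; ring.
have t (A B C x y z : F) : A * B * C = G1 * G2 * G3 * lam ->
    nat_bounded A x -> nat_bounded B y -> nat_bounded C z -> nat_bounded (G1 * G2 * G3 * lam) (x * y * z).
  by move=> <- hx hy hz; apply: nat_boundedM => //; apply: nat_boundedM.
have m2 := gt_eqF mm0.
repeat apply: nat_boundedD; try apply: nbN;
  by (eapply t; [|eassumption|eassumption|eassumption]); field; rewrite m2.
Qed.

Section LogDerivative.
Variables (D : F -> F) (ds : seq (F -> F)).
Hypotheses (hD : derivation L D) (hds : derivations L ds).
Variables (a b c d e u r' tau : F).
Hypotheses (he : e = 1 \/ e = -1) (hdet : a * d - b * c = e).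
Hypotheses (hu : u * (c * r' + d) = 1) (hr : rJ * (c * r' + d) = a * r' + b).

(** The entries of [D(M) M^-1] for [M] with rows [(a, b)] and [(c, d)], whose inverse is [e] times
    the adjugate. The fourth entry is [- lx1] because the determinant is constant, see [det_der]. *)
Definition lx1 := e * (D a * d - D b * c).
Definition lx2 := e * (D b * a - D a * b).
Definition lx3 := e * (D c * d - D d * c).

Hypotheses (La : L a) (Lb : L b) (Lc : L c) (Ld : L d) (Lr' : L r').

Let ee : e * e = 1. Proof. by case: he => ->; rewrite ?mulrNN mulr1. Qed.

Lemma det_der : D a * d + a * D d - (D b * c + b * D c) = 0.
Proof.
have LM := subfieldM hL.
have : D (a * d - b * c) = 0.
  rewrite hdet; case: he => ->; rewrite ?(derN hL hD) ?(der1 hL hD) ?oppr0 //.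
  exact: (subfield1 hL).
by have LN := subfieldN hL; rewrite !(derD hD, derN hL hD, derM hD); auto.
Qed.

Let w0 : c * r' + d != 0.
Proof. by apply/eqP => w0; move: hu; rewrite w0 mulr0 => /eqP; rewrite eq_sym oner_eq0. Qed.

Let rE : rJ = (a * r' + b) * u. Proof. by rewrite -hr -mulrA [_ * u]mulrC hu mulr1. Qed.

Lemma xi22_log : xi22 lx1 lx3 = - u * (D c * r' + D d).
Proof.
have h := det_der; apply: (mulIf w0); rewrite /xi22 mulrBl [rJ * _ * _]mulrAC hr.
have -> : - u * (D c * r' + D d) * (c * r' + d) = - (D c * r' + D d) * (u * (c * r' + d)) by ring.
rewrite hu mulr1 /lx1 /lx3.
have -> : D a * d - D b * c = b * D c - a * D d.
  by apply/eqP; rewrite -subr_eq0 -h; apply/eqP; ring.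
have -> : e * (b * D c - a * D d) * (c * r' + d) - (a * r' + b) * (e * (D c * d - D d * c)) =
   - (D c * r' + D d) * (e * (a * d - b * c)) by ring.
by rewrite hdet ee mulr1.
Qed.

(** The derivative of [rJ = M r'] has two parts: the infinitesimal action of [D(M) M^-1] at [rJ],
    which is [xi21], and the slope [e * u * u] of the Moebius map times [D r']. *)
Lemma xi21_log : xi21 lx1 lx2 lx3 = D rJ - e * u * u * D r'.
Proof.
have LM := subfieldM hL; have LD := subfieldD hL.
have x1E : lx1 = e * (b * D c - a * D d).
  rewrite /lx1; congr (_ * _); apply/eqP; rewrite -subr_eq0 -det_der; apply/eqP; ring.
have hDr : D rJ * (c * r' + d) = D a * r' + a * D r' + D b - rJ * (D c * r' + c * D r' + D d).
  have := congr1 D hr; rewrite !(derD hD, derM hD); auto => <-; ring.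
apply: (mulIf w0); apply: (mulIf w0); rewrite /xi21 {2}x1E.
have hu' := hu; have hr' := hr; set w := c * r' + d in hu' hr' hDr *.
have -> : (lx2 + (rJ * lx1 + rJ * (e * (b * D c - a * D d))) - rJ * (rJ * lx3)) * w * w =
    lx2 * w * w + ((rJ * w) * lx1 + (rJ * w) * (e * (b * D c - a * D d))) * w - (rJ * w) * ((rJ * w) * lx3).
  by ring.
have -> : (D rJ - e * u * u * D r') * w * w = (D rJ * w) * w - e * (u * w) * (u * w) * D r'.
  by ring.
rewrite hDr hu' hr' !mulr1 mulrBl [rJ * _ * w]mulrAC hr'.
have -> : lx2 * w * w + ((a * r' + b) * lx1 + (a * r' + b) * (e * (b * D c - a * D d))) * w -
    (a * r' + b) * ((a * r' + b) * lx3) =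
    (e * (a * d - b * c)) * ((D a * r' + D b) * w - (a * r' + b) * (D c * r' + D d)).
  by rewrite /lx1 /lx2 /lx3 /w; ring.
by rewrite hdet ee mul1r -{1}hdet /w; ring.
Qed.

Hypotheses (r'01 : clsL ds 1 r') (cr : clsL ds 1 rJ).
Hypotheses (ca : clsL (D :: ds) mm a) (cb : clsL (D :: ds) mm b).
Hypotheses (ccc : clsL (D :: ds) mm c) (cd : clsL (D :: ds) mm d).
Hypotheses (cu : clsL ds mm^-1 u) (cdiff : clsL (D :: ds) lam (rJ - r')).
Hypotheses (ct : clsL ds tau (D rJ)) (htau : tau <= mm^-1 ^+ 2 * lam).

(** In [xi21_log] the term [D rJ] is negligible and [D r'] is close to it because [rJ - r'] has
    class [lam]. In [xi22_log] the factor [u] cancels the size [mm] of the derivatives of [c] and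
    [d]. *)
Lemma log_good : good ds H lx1 lx2 lx3.
Proof.
move: ca cb ccc cd cdiff => /= [ca1 ca2] [cb1 cb2] [cc1 cc2] [cd1 cd2] [_ cf].
have mi : 0 <= mm^-1 ^+ 2 by rewrite exprn_ge0 // invr_ge0 ltW.
have mi1 : mm^-1 ^+ 2 <= 1 by rewrite exprn_ile1 // ?invr_ge0 ?(ltW mm0) // invf_le1.
have ce : clsL ds 1 e.
  by case: he => ->; [|apply: (clsN hL) => //]; apply: (cls1 hL).
have cx x y : clsL ds (mm * H) x -> clsL ds mm y -> clsL ds (mm ^+ 2 * H) (x * y).
  by move=> hx hy; rewrite expr2 mulrAC; apply: (clsM hL).
have cl x y z w : clsL ds (mm * H) x -> clsL ds mm y -> clsL ds (mm * H) z -> clsL ds mm w ->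
    clsL ds (mm ^+ 2 * H) (e * (x * y - z * w)).
  move=> hx hy hz hw; rewrite -[X in clsL _ X _]mul1r; apply: (clsM hL) => //.
  by apply: (clsB hL) => //; apply: cx.
split.
- rewrite xi21_log.
  have -> : D rJ - e * u * u * D r' = D rJ * (1 - e * u * u) + e * (u * u * D (rJ - r')).
    by rewrite (derB hL hD) //; ring.
  have cuu : clsL ds (mm^-1 ^+ 2) (u * u) by rewrite expr2; apply: (clsM hL).
  apply: (clsD hL) => //.
    apply: (cls_le H0 (G := tau * 1)).
      by rewrite mulr1 (le_trans htau) // ler_wpM2r // ler_peMr.
    apply: (clsM hL) => //; apply: (clsB hL) => //; first exact: (cls1 hL).
    by rewrite -mulrA -[X in clsL _ X _]mul1r; apply: (clsM hL) => //; apply: (cls_le H0 mi1).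
  rewrite -[X in clsL _ X _]mul1r; apply: (clsM hL) => //.
  by rewrite -mulrA [H * lam]mulrC; apply: (clsM hL).
- rewrite xi22_log mulNr; apply: (clsN hL) => //.
  rewrite [X in clsL _ X _](_ : _ = mm^-1 * (mm * H)); last by rewrite mulrA mulVf ?gt_eqF // mul1r.
  apply: (clsM hL) => //; apply: (clsD hL) => //.
  by rewrite -[mm * H]mulr1; apply: (clsM hL).
- exact: cl.
- by split; [apply: (filtered_in (cl _ _ _ _ ca2 cd1 cb2 cc1))|
    apply: (filtered_in (cl _ _ _ _ cb2 ca1 ca2 cb1))|
    apply: (filtered_in (cl _ _ _ _ cc2 cd1 cd2 cc1))].
Qed.

End LogDerivative.
End Forms.

Lemma finite_eventually (K : finType) (P : K -> nat -> Prop) :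
  (forall k, exists J0 : nat, forall J, (J0 <= J)%N -> P k J) ->
  exists J0 : nat, forall k J, (J0 <= J)%N -> P k J.
Proof.
move=> /choice [f hf]; exists (\max_k f k) => k J JJ; apply: hf.
by apply: leq_trans JJ; apply: leq_bigmax.
Qed.

(** * The contradiction in the ultrapower *)

Section Main.
Variables (F : realFieldType) (ZZ : F -> Prop) (B cc : nat) (Q : F).
Variables (la lb lc ld eps : 'I_B -> F).
Hypothesis hS : letter_system ZZ cc Q la lb lc ld eps.
Variables (om : nat -> 'I_B) (alpha : F) (m : {poly rat}) (dd : nat).
Notation Lg := (Lgen la lb lc ld).
Notation hL := (Lgen_subfield la lb lc ld).
Notation entry := (letter_entry la lb lc ld).
Notation A := (Adeg entry).
Notation rr := (rr la lb lc ld om).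
Notation r J := (rr J 0).
Notation nb := (@nat_bounded F).
Notation mF := (map_poly (ratr : rat -> F) m).
Notation q := (Q^-1).
Hypothesis alpha01 : 0 <= alpha <= 1.
Hypothesis alpha_r : forall J, `|alpha - r J| <= q ^+ J.
Hypothesis m_monic : m \is monic.
Hypothesis m_size : (3 < size m)%N.
Hypothesis m_root : mF.[alpha] = 0.
Hypothesis Liouville : forall (p : {poly F}) (G : F), 1 <= G ->
  (size p < size m)%N -> (forall i, ZZ p`_i) -> (forall i, `|p`_i| <= G) -> p != 0 ->
  exists K : nat, 1 <= K%:R * G ^+ dd * `|p.[alpha]|.
Hypothesis om_rec : forall L' : nat, exists2 j, (0 < j)%N &
  forall l, (l < L')%N -> om (j + l) = om l.
Hypothesis ZZ_algebraic : forall x y, ZZ x -> ZZ y -> y != 0 ->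
  (exists2 p : {poly rat}, p != 0 & (map_poly ratr p).[x / y] = 0) ->
  exists a : rat, x / y = ratr a.

Let Q1 := lsQ1 hS.
Let Q0 := lsQ0 hS.
Let q0 : 0 < q. Proof. by rewrite invr_gt0. Qed.
Let q1 : q <= 1. Proof. by rewrite invf_le1. Qed.

(** Here [alpha] has degree at least 3, so Liouville's inequality keeps a nonzero rational
    polynomial of degree at most 2 away from 0 at [alpha] by a standard amount. *)
Lemma no_quadratic_relation (a b c : rat) J : (0 < J)%N ->
  nb q (ratr a + ratr b * r J + ratr c * (r J) ^+ 2) -> [/\ a = 0, b = 0 & c = 0].
Proof.
move=> J0 hnb; pose p : {poly rat} := \poly_(i < 3) [:: a; b; c]`_i.
have hp y : (map_poly (ratr : rat -> F) p).[y] = ratr a + ratr b * y + ratr c * y ^+ 2.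
  rewrite (@horner_coef_wide _ 3) ?size_map_poly ?size_poly //.
  by rewrite !big_ord_recl big_ord0 !coef_map !coef_poly /= expr0 expr1 mulr1 addr0 addrA.
have [p0|p0] := eqVneq p 0.
  have e i : p`_i = 0 by rewrite p0 coef0.
  by have := e 0%N; have := e 1%N; have := e 2%N; rewrite !coef_poly /=.
have A0 i : A 0 (map_poly (ratr : rat -> F) p)`_i by rewrite coef_map; apply: A_rat.
have szp : (size (map_poly (ratr : rat -> F) p) < size m)%N.
  by rewrite size_map_poly; apply: leq_ltn_trans m_size; apply: size_poly.
have pF0 : map_poly (ratr : rat -> F) p != 0 by rewrite map_poly_eq0.
have [K] := A_poly_root hS Liouville A0 szp pF0; rewrite muln0 mul0n expr0 mulr1 => hK.
have hnbp i : nb 1 (map_poly (ratr : rat -> F) p)`_i.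
  by rewrite coef_map; apply: nat_bounded_rat.
have := horner_close hS alpha01 alpha_r J ler01 hnbp; rewrite mul1r => hcl.
have : nb q (map_poly (ratr : rat -> F) p).[alpha].
  rewrite -(subrK (map_poly ratr p).[r J] (map_poly ratr p).[alpha]); apply: nat_boundedD.
    by apply: nat_bounded_le hcl; rewrite -[X in _ <= X]expr1 ler_wiXn2l // ltW.
  by rewrite hp.
move=> [K' hK']; have : K%:R * (K'%:R * q) < 1.
  by rewrite mulrA -natrM ltr_pdivrMr // mul1r (ls_inf hS).
by rewrite ltNge (le_trans hK) // ler_wpM2l.
Qed.

Lemma integral_at_closed : [/\ forall G, integral_at ZZ G 0,
  forall G x y, integral_at ZZ G x -> integral_at ZZ G y -> integral_at ZZ G (x + y),
  forall G G' x y, integral_at ZZ G x -> integral_at ZZ G' y -> integral_at ZZ (G * G') (x * y) &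
  integral_at ZZ 1 (-1)].
Proof.
rewrite /integral_at; split.
- by move=> G; rewrite mulr0; apply: (ls_0 hS).
- by move=> G x y hx hy; rewrite mulrDr; apply: (ls_D hS).
- by move=> G G' x y hx hy; rewrite mulrACA; apply: (ls_M hS).
- by rewrite mul1r; apply: (ls_N hS); apply: (ls_1 hS).
Qed.

Lemma integral_zero g x a b : ZZ (g * x) -> g != 0 -> `|g| <= Q ^+ b ->
  nb (Q ^+ a * q ^+ (a + b).+1) x -> x = 0.
Proof.
move=> Zgx g0 gb [K hx]; have /eqP : g * x = 0.
  apply: (ls_discrete hS Zgx); rewrite -[X in _ < X](expr0 q); apply: (nb_q_lt hS (a := 1)) => //.
  exists K; rewrite normrM.
  apply: le_trans (ler_pM _ _ gb hx) _; rewrite // mulrCA ler_wpM2l // mulrA -exprD.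
  by apply: (Qq_le hS); rewrite addn1 addnC.
by rewrite mulf_eq0 (negbTE g0) => /eqP.
Qed.

Lemma det3_scale g1 g2 g3 v1 v2 v3 w1 w2 w3 z1 z2 z3 :
  ZZ (g1 * v1) -> ZZ (g1 * v2) -> ZZ (g1 * v3) -> ZZ (g2 * w1) -> ZZ (g2 * w2) -> ZZ (g2 * w3) ->
  ZZ (g3 * z1) -> ZZ (g3 * z2) -> ZZ (g3 * z3) ->
  ZZ (g1 * g2 * g3 * det3 v1 v2 v3 w1 w2 w3 z1 z2 z3).
Proof.
move=> *; have -> : g1 * g2 * g3 * det3 v1 v2 v3 w1 w2 w3 z1 z2 z3 =
    det3 (g1 * v1) (g1 * v2) (g1 * v3) (g2 * w1) (g2 * w2) (g2 * w3) (g3 * z1) (g3 * z2) (g3 * z3).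
  by rewrite /det3; ring.
by rewrite /det3; apply: (ls_D hS); [apply: (ls_B hS)|]; apply: (ls_M hS) => //;
  apply: (ls_B hS); apply: (ls_M hS).
Qed.

Theorem no_hyper_expansion : False.
Proof.
have [n [Ds [hDs Dsconst]]] := derivation_family la lb lc ld.
(* An element killed by the whole family is algebraic, as otherwise some derivation would send it to
   1; an algebraic quotient of hyperintegers is a standard rational. *)
have const x : Lg x -> (forall i, Ds i x = 0) -> exists a : rat, x = ratr a.
  move=> Lx hx; have [C [a [b [Za Zb b0 _ [_ xE]]]]] := Lgen_frac hS Lx.
  rewrite xE; apply: ZZ_algebraic => //; apply: contrapT => nal.
  have [|D hD D1] := derivation_exists hL Lx.
    by move=> p p0; apply/eqP => px; apply: nal; exists p; rewrite -?xE.
  by have /eqP := Dsconst D hD x Lx hx; rewrite D1 oner_eq0.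
have ratio x y : Lg x -> Lg y -> y != 0 -> (forall i, Ds i x * y = x * Ds i y) ->
    exists a : rat, x = y * ratr a.
  move=> Lx Ly y0 h; have [||a ha] := const (x / y); first exact: (subfield_div hL).
    move=> i; rewrite (derM (hDs i)) ?(derV hL (hDs i)) //; last exact: (subfieldV hL).
    have -> : Ds i x / y + x * (- Ds i y * y^-1 ^+ 2) = (Ds i x * y - x * Ds i y) * y^-1 ^+ 2.
      by field.
    by rewrite h subrr mul0r.
  by exists a; rewrite -ha mulrC mulfVK.
have vec v1 v2 v3 : Lg v1 -> Lg v2 -> Lg v3 -> ~ [/\ v1 = 0, v2 = 0 & v3 = 0] ->
    (forall i, [/\ Ds i v1 * v2 = v1 * Ds i v2, Ds i v2 * v3 = v2 * Ds i v3 &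
      Ds i v1 * v3 = v1 * Ds i v3]) ->
    exists s (a b c : rat), [/\ s != 0, s = v1 \/ s = v2 \/ s = v3, v1 = s * ratr a,
      v2 = s * ratr b & v3 = s * ratr c].
  move=> L1 L2 L3 nz par.
  have one (s : F) : exists a : rat, s = s * ratr a by exists 1; rewrite rmorph1 mulr1.
  have flip x y i : Ds i x * y = x * Ds i y -> Ds i y * x = y * Ds i x.
    by move=> e; rewrite mulrC -e mulrC.
  have p12 i : Ds i v1 * v2 = v1 * Ds i v2 by case: (par i).
  have p23 i : Ds i v2 * v3 = v2 * Ds i v3 by case: (par i).
  have p13 i : Ds i v1 * v3 = v1 * Ds i v3 by case: (par i).
  have [v10|v10] := eqVneq v1 0; last first.
    have [a ha] := one v1; have [b hb] := ratio _ _ L2 L1 v10 (fun i => flip _ _ i (p12 i)).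
    have [c hc] := ratio _ _ L3 L1 v10 (fun i => flip _ _ i (p13 i)).
    by exists v1, a, b, c; split=> //; left.
  have [v20|v20] := eqVneq v2 0; last first.
    have [b hb] := one v2; have [a ha] := ratio _ _ L1 L2 v20 p12.
    have [c hc] := ratio _ _ L3 L2 v20 (fun i => flip _ _ i (p23 i)).
    by exists v2, a, b, c; split=> //; right; left.
  have [v30|v30] := eqVneq v3 0; first by case: nz.
  have [c hc] := one v3; have [a ha] := ratio _ _ L1 L3 v30 p13.
  have [b hb] := ratio _ _ L2 L3 v30 p23.
  by exists v3, a, b, c; split=> //; right; right.
(* Three derivations: one in the logarithmic derivative [X], one from [X] to [Y], one more in the
   determinants. *)
pose dsf (k : 'I_n * 'I_n * 'I_n) := [:: Ds k.1.1; Ds k.1.2; Ds k.2].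
have hdsf k : derivations Lg (dsf k) by do !split=> //; apply: hDs.
have [C1 [C2 [h [Zh h0 hC hc hi]]]] := uniform_constants hS hdsf (@all_family_in _ _ _ _ _ _ _ _ _ _ hS).
(* A determinant costs at most six factors [Q ^+ C1] and six factors [h]; the repetition of [L']
   letters has to gain more than that. *)
have [L' L'E] : {L' : nat | L' = (6 * C1 + 6 * C2).+1} by eexists.
have [j j0 hj] := om_rec L'.
(* Since [mm <= Q ^+ (cc * j)], this gives [q ^+ kap <= mm^-1 ^+ 2 * q ^+ L']. *)
have [kap kapE] : {k : nat | k = (cc * j * 2 + L')%N} by eexists.
have Lrr J i : Lg (rr J i).
  have [C hf] := @cls_exists _ Lg Q Q1 (Lgen_mod hS) [::] (all_family la lb lc ld eps) I
    (@all_family_in _ _ _ _ _ _ _ _ _ _ hS).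
  exact: filtered_in (@cls_rr _ _ _ _ _ _ _ _ _ _ hS om [::] C I (hf C (leqnn _)) J i).
have m_size1 : (1 < size m)%N by apply: leq_trans m_size.
have pure D k : derivation Lg D -> (0 < k)%N -> vanishing q (fun J => iter k D (r J)).
  by move=> hD k0 kappa; apply: (derivative_tiny hS alpha01 alpha_r m_monic m_size1 m_root Liouville).
have [Jt hJt] : exists Jt : nat, forall (k : 'I_n * 'I_n * 'I_n) J, (Jt <= J)%N ->
    [/\ `|Ds k.1.1 (r J)| <= q ^+ kap, `|Ds k.1.2 (Ds k.1.1 (r J))| <= q ^+ kap &
      `|Ds k.2 (Ds k.1.2 (Ds k.1.1 (r J)))| <= q ^+ kap].
  apply: finite_eventually => -[[i0 i1] i2] /=; have hq := q_half hS.
  have [J1 h1] := vanishing1 pure (hDs i0) kap.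
  have [J2 h2] := vanishing2 hL (fun J => Lrr J 0%N) q0 hq pure (hDs i1) (hDs i0) kap.
  have [J3 h3] := vanishing3 hL (fun J => Lrr J 0%N) q0 hq pure (hDs i2) (hDs i1) (hDs i0) kap.
  exists (J1 + J2 + J3)%N => J JJ; split; [apply: h1|apply: h2|apply: h3]; apply: leq_trans JJ.
  - by rewrite -addnA leq_addr.
  - by rewrite addnAC leq_addl.
  - by rewrite leq_addl.
(* Long enough for the derivatives of [rJ] to be negligible, and for the tail [r'] to share [L']
   letters with [rJ]. *)
have [nn nnE] : {k : nat | k = (Jt + L')%N} by eexists.
pose rJ := rr (j + nn) 0; pose r' := rr nn j.
have [CL hCL] := @cls_exists _ Lg Q Q1 (Lgen_mod hS) [::] (all_family la lb lc ld eps) I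
  (@all_family_in _ _ _ _ _ _ _ _ _ _ hS).
have wL := @word_mx_cls _ _ _ _ _ _ _ _ _ _ hS om [::] CL I (hCL CL (leqnn _)) j 0.
have wcls k := word_mx_cls hS om (hdsf k) (hc k) j 0.
have wu k := word_u_cls hS om (hdsf k) (hc k) j nn 0.
have [iP0 iPD iPM iPN] := integral_at_closed.
have wint k := @word_mx_filtered F B la lb lc ld om (integral_at ZZ) h (dsf k)
  (fun _ _ => 1) j 0 iP0 iPD iPM iPN (hdsf k) (fun=> erefl).
have wf := word_mx_facts hS om j nn 0; have wp := word_mx_pos hS om j 0.
have {}wint k : let: (a, b, c, d) := word_mx la lb lc ld om j 0 in
  [/\ filtered Lg (integral_at ZZ) h (dsf k) 1 a, filtered Lg (integral_at ZZ) h (dsf k) 1 b,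
    filtered Lg (integral_at ZZ) h (dsf k) 1 c & filtered Lg (integral_at ZZ) h (dsf k) 1 d].
  have := wint k; case: (word_mx _ _ _ _ _ _ _) => [[[a b] c] d]; apply=> k' j' i' _; exists 1; split; last by rewrite mulr1.
  apply: hi; first by rewrite mem_cat map_f ?orbT ?mem_enum.
  apply: (letter_entryP (P := ZZ)) => k2.
  by split; [apply: (ls_la hS)|apply: (ls_lb hS)|apply: (ls_lc hS)|apply: (ls_ld hS)].
set u := word_u _ _ _ _ _ j nn 0 in wu wf.
set mm := word_size _ _ _ _ in wcls wu.
have mm1 : 1 <= mm := word_size_ge1 hS om j 0.
have mmQ : mm <= Q ^+ (cc * j) := word_size_le hS om j 0.
have mm0 : 0 < mm := lt_le_trans ltr01 mm1.
move: wf wp wcls wint wL; case: (word_mx _ _ _ _ _ j 0) => [[[a b] c] d] /=.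
rewrite add0n -/rJ -/r' => -[e [he hdet hu hr]] [a0 c0 /(_ j0) cQ [Zc Za]] wcls wint wL.
pose H := Q ^+ C1; pose lam := q ^+ L'; pose tau := q ^+ kap.
have H1 : 1 <= H by rewrite exprn_ege1.
have H0 : 0 <= H by apply: le_trans H1.
have lam0 : 0 <= lam by rewrite exprn_ge0 // ltW.
have lam1 : lam <= 1 by rewrite exprn_ile1 // ltW.
have tau0 : 0 <= tau by rewrite exprn_ge0 // ltW.
have htau : tau <= mm^-1 ^+ 2 * lam.
  rewrite /tau kapE exprD exprM ler_wpM2r // lerXn2r ?nnegrE ?exprn_ge0 ?invr_ge0 ?(ltW q0) ?(ltW Q0) ?(ltW mm0) //.
  by rewrite exprVn lef_pV2 ?posrE ?exprn_gt0.
have JJt : (Jt <= j + nn)%N by rewrite nnE addnCA leq_addr.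
have tcls i0 i1 i2 : cls Lg H [:: Ds i1; Ds i2] tau (Ds i0 rJ).
  have nbt x G : 1 <= G -> `|x| <= tau -> nb (tau * G) x.
    by move=> G1 hx; exists 1%N; rewrite mul1r (le_trans hx) // ler_peMr.
  have [/= t1 t2 t3] := hJt (i0, i1, i2) _ JJt; have [/= _ t4 _] := hJt (i0, i2, i2) _ JJt.
  have Ld i x : Lg x -> Lg (Ds i x) by apply: (der_in (hDs i)).
  have LrJ := Lrr (j + nn)%N 0%N.
  by split; split; split; auto; first [exact: nbt | rewrite -mulrA; apply: nbt => //; exact: mulr_ege1
    | have := nbt _ 1 (lexx _) t1; rewrite mulr1].
have LrJ : Lg rJ by apply: Lrr.
have L3 : [/\ Lg a, Lg b, Lg c & Lg d].
  by have [[x1 _] [x2 _] [x3 _] [x4 _]] := wL.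
have Lr' : Lg r' by apply: Lrr.
pose X1 i := lx1 (Ds i) a b c d e; pose X2 i := lx2 (Ds i) a b e; pose X3 i := lx3 (Ds i) c d e.
have Xgood i0 i1 i2 : good Lg H mm lam rJ [:: Ds i1; Ds i2] H (X1 i0) (X2 i0) (X3 i0).
  pose k := (i0, i1, i2); have [wa wb wc wd] := wcls k; have [La Lb Lc Ld] := L3.
  have hk := hc k; have hd := hdsf k.
  have hds2 : derivations Lg [:: Ds i1; Ds i2] by case: hd.
  apply: (@log_good _ _ hL H mm lam rJ H1 mm1 lam0 LrJ _ _ (hDs i0) hds2 a b c d e u r' tau) => //.
  - by have [] := cls_rr hS om hd hk nn j.
  - by have [] := wu k.
  - apply: (cls_rr_diff hS hd hk); rewrite ?nnE ?leq_addl //; first by rewrite addnA leq_addl.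
    by move=> l /hj; rewrite add0n.
have Xint i0 i1 i2 : let f := filtered Lg (integral_at ZZ) h [:: Ds i1; Ds i2] h in
    [/\ f (X1 i0), f (X2 i0) & f (X3 i0)].
  have [[wa wa'] [wb wb'] [wc wc'] [wd wd']] := wint (i0, i1, i2).
  have hds2 : derivations Lg [:: Ds i1; Ds i2] by case: (hdsf (i0, i1, i2)).
  have fe : filtered Lg (integral_at ZZ) h [:: Ds i1; Ds i2] 1 e.
    case: he => ->; first exact: (filtered1 hL).
    by apply: (filteredN hL) => //; apply: (filtered1 hL).
  have t x y z w : filtered Lg (integral_at ZZ) h [:: Ds i1; Ds i2] (1 * h) x ->
      filtered Lg (integral_at ZZ) h [:: Ds i1; Ds i2] 1 y ->
      filtered Lg (integral_at ZZ) h [:: Ds i1; Ds i2] (1 * h) z ->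
      filtered Lg (integral_at ZZ) h [:: Ds i1; Ds i2] 1 w ->
      filtered Lg (integral_at ZZ) h [:: Ds i1; Ds i2] h (e * (x * y - z * w)).
    move=> hx hy hz hw.
    have hB : filtered Lg (integral_at ZZ) h [:: Ds i1; Ds i2] (1 * h * 1) (x * y - z * w).
      by apply: (filteredB hL) => //; apply: (filteredM hL).
    by have := filteredM hL iPD iPM hds2 fe hB; rewrite !mul1r mulr1.
  by split; apply: t.
(* Otherwise [c] would be a standard rational, whereas its square is at least the infinite [Q]. *)
have [i0 Di0] : exists i0, Ds i0 c != 0.
  apply: contrapT => nex; have [|i|x cx] := const c.
  - by case: L3.
  - by apply/eqP/negPn/negP => hne; apply: nex; exists i.
  have [K hK] := nat_bounded_rat F x; rewrite -cx mulr1 ger0_norm // in hK.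
  have : c ^+ 2 <= K%:R ^+ 2 by rewrite lerXn2r // ?nnegrE.
  by rewrite leNgt (lt_le_trans _ cQ) // -natrX (ls_inf hS).
(* The lower left entry of [D(M) = X M] reads [D c = X3 * a - X1 * c], up to the vanishing
   derivative of the determinant. *)
have Xn0 : ~ [/\ X1 i0 = 0, X2 i0 = 0 & X3 i0 = 0].
  have [La Lb Lc Ld] := L3.
  move=> [x1 _ x3]; move/eqP: Di0; apply.
  have ee : e * e = 1 by case: he => ->; rewrite ?mulrNN mulr1.
  have dz := det_der hL (hDs i0) he hdet La Lb Lc Ld.
  have -> : Ds i0 c = X3 i0 * a - (X1 i0 - e * (Ds i0 a * d + a * Ds i0 d - (Ds i0 b * c + b * Ds i0 c))) * c.
    by rewrite -[LHS]mul1r -ee -{2}hdet /X3 /X1 /lx1 /lx3; ring.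
  by rewrite x1 x3 dz mulr0 subr0 mul0r mul0r subr0.
have [LX1 LX2 LX3] : [/\ Lg (X1 i0), Lg (X2 i0) & Lg (X3 i0)] by case: (Xgood i0 i0 i0).
have mi1 : mm^-1 ^+ 2 <= 1 by rewrite exprn_ile1 // ?invr_ge0 ?(ltW mm0) // invf_le1.
have mi0 : 0 <= mm^-1 ^+ 2 by rewrite exprn_ge0 // invr_ge0 ltW.
(* Dividing a small form by the nonzero s, whose denominator is controlled. *)
have quot s x g k1 k2 : s != 0 -> ZZ (g * s) -> g != 0 -> `|g| <= Q ^+ k2 ->
    nb (Q ^+ k1 * lam) (s * x) -> (k1 + k2 < L')%N -> nb q x.
  move=> s0 Zgs g0 gk [K hK] kk; exists K.
  have gs1 : 1 <= `|g * s| by apply: (ls_ge1 hS Zgs); rewrite mulf_neq0.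
  apply: le_trans (_ : `|g * s| * `|x| <= _); first by rewrite ler_peMl.
  rewrite -normrM -mulrA normrM; apply: le_trans (ler_pM _ _ gk hK) _ => //.
  rewrite mulrCA ler_wpM2l // mulrA -exprD -[X in _ <= X]expr1; apply: (Qq_le hS).
  by clear -kk; lia.
have jn0 : (0 < j + nn)%N by rewrite addn_gt0 j0.
(* If [X] is parallel to all its derivatives, it is a multiple of a rational vector, and the small
   form [xi21] becomes a rational quadratic relation for [rJ]. *)
have [allpar|] := pselect (forall i, [/\ Ds i (X1 i0) * X2 i0 = X1 i0 * Ds i (X2 i0),
    Ds i (X2 i0) * X3 i0 = X2 i0 * Ds i (X3 i0) & Ds i (X1 i0) * X3 i0 = X1 i0 * Ds i (X3 i0)]).
  have [s [ra [rb [rc [s0 sX e1 e2 e3]]]]] := vec _ _ _ LX1 LX2 LX3 Xn0 allpar.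
  have [[[[_ g1] _] _] _ _ _] := Xgood i0 i0 i0.
  have [[[[_ i1] _] _] [[[_ i2] _] _] [[[_ i3] _] _]] := Xint i0 i0 i0.
  have Zs : ZZ (h * s) by case: sX => [->|[->|->]].
  have [|rb0 ra0 rc0] := @no_quadratic_relation rb (ra + ra) (- rc) (j + nn) jn0.
    apply: (quot s _ h C1 C2) => //; last by clear -L'E; lia.
    have -> : s * (ratr rb + ratr (ra + ra) * rJ + ratr (- rc) * rJ ^+ 2) =
        xi21 rJ (X1 i0) (X2 i0) (X3 i0).
      by rewrite e1 e2 e3 /xi21 rmorphD rmorphN; ring.
    by apply: nat_bounded_le g1; rewrite ler_wpM2r // ler_piMl.
  apply: Xn0; rewrite e1 e2 e3 rb0.
  have -> : ra = 0 by move/eqP: ra0; rewrite -mulr2n mulrn_eq0 => /eqP.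
  by rewrite -[rc]opprK rc0 oppr0 rmorph0 mulr0.
move=> /existsNP [i1 npar].
pose Y1 := Ds i1 (X1 i0); pose Y2 := Ds i1 (X2 i0); pose Y3 := Ds i1 (X3 i0).
have LdD i x : Lg x -> Lg (Ds i x) by apply: (der_in (hDs i)).
have [LY1 LY2 LY3] : [/\ Lg Y1, Lg Y2 & Lg Y3] by split; apply: LdD.
have HH : 0 <= H * H by rewrite mulr_ge0.
have Xg0 := good_behead (good_behead (Xgood i0 i0 i0)).
have Yg i2 : good Lg H mm lam rJ [:: Ds i2] (H * H) Y1 Y2 Y3.
  have hd1 : derivations Lg [:: Ds i2] by split.
  exact: (good_der hL H1 mm1 lam0 lam1 LrJ (hDs i1) hd1 H0 (tcls i1 i2 i2).1 htau) (Xgood i0 i1 i2).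
have DXg i2 : good Lg H mm lam rJ [::] (H * H) (Ds i2 (X1 i0)) (Ds i2 (X2 i0)) (Ds i2 (X3 i0)).
  exact: (good_der hL H1 mm1 lam0 lam1 LrJ (hDs i2) (I : derivations Lg [::]) H0 (tcls i2 i2 i2).1.1 htau)
    (good_behead (Xgood i0 i1 i2)).
have DYg i2 : good Lg H mm lam rJ [::] (H * H * H) (Ds i2 Y1) (Ds i2 Y2) (Ds i2 Y3).
  exact: (good_der hL H1 mm1 lam0 lam1 LrJ (hDs i2) (I : derivations Lg [::]) HH (tcls i2 i2 i2).1.1 htau)
    (Yg i2).
have hQ k b' : (k * C2 <= b')%N -> `|h| ^+ k <= Q ^+ b'.
  move=> kb; apply: le_trans (_ : (Q ^+ C2) ^+ k <= _).
    by rewrite lerXn2r ?nnegrE ?normr_ge0 ?exprn_ge0 ?(ltW Q0).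
  by rewrite -exprM mulnC ler_weXn2l.
have HQ k a' : (k * C1 <= a')%N -> H ^+ k * lam <= Q ^+ a' * lam.
  by move=> ka; rewrite ler_wpM2r // -exprM mulnC ler_weXn2l.
(* Otherwise [X] and some derivative [Y] span a plane. Together with [detz2], this says that every
   derivation of the family preserves it. *)
have detz1 i2 : det3 (X1 i0) (X2 i0) (X3 i0) Y1 Y2 Y3 (Ds i2 (X1 i0)) (Ds i2 (X2 i0)) (Ds i2 (X3 i0)) = 0.
  have [[[[_ x1] [_ dx1]] [[_ y1] _]] [[[_ x2] [_ dx2]] [[_ y2] _]] [[[_ x3] [_ dx3]] [[_ y3] _]]] := Xint i0 i1 i2.
  apply: (@integral_zero (h * (h * h) * (h * h)) _ (6 * C1) (6 * C2)).
  - exact: det3_scale.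
  - by rewrite !mulf_neq0.
  - rewrite !normrM [X in X <= _](_ : _ = `|h| ^+ 5); last by ring.
    by apply: hQ; rewrite leq_mul2r orbT.
  apply: nat_bounded_le (good_det mm1 Xg0 (good_behead (Yg i2)) (DXg i2)); rewrite -L'E.
  rewrite [X in X * _ <= _](_ : _ = H ^+ 5); last by ring.
  by apply: HQ; rewrite leq_mul2r orbT.
have detz2 i2 : det3 (X1 i0) (X2 i0) (X3 i0) Y1 Y2 Y3 (Ds i2 Y1) (Ds i2 Y2) (Ds i2 Y3) = 0.
  have [[[[_ x1] [_ dx1]] [[_ y1] [_ dy1]]] [[[_ x2] [_ dx2]] [[_ y2] [_ dy2]]] [[[_ x3] [_ dx3]] [[_ y3] [_ dy3]]]] := Xint i0 i1 i2.
  apply: (@integral_zero (h * (h * h) * (h * h * h)) _ (6 * C1) (6 * C2)).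
  - exact: det3_scale.
  - by rewrite !mulf_neq0.
  - rewrite !normrM [X in X <= _](_ : _ = `|h| ^+ 6); last by ring.
    exact: hQ.
  apply: nat_bounded_le (good_det mm1 Xg0 (good_behead (Yg i2)) (DYg i2)); rewrite -L'E.
  rewrite [X in X * _ <= _](_ : _ = H ^+ 6); last by ring.
  exact: HQ.
(* The cross product is normal to the stable plane, hence parallel to its derivatives and a multiple
   of a rational vector. *)
pose c1 := X2 i0 * Y3 - X3 i0 * Y2; pose c2 := X3 i0 * Y1 - X1 i0 * Y3.
pose c3 := X1 i0 * Y2 - X2 i0 * Y1.
have LM := subfieldM hL; have LB := subfieldB hL.
have [s [ra [rb [rc [s0 sX e1 e2 e3]]]]] : exists s (a b c : rat), [/\ s != 0,
    s = c1 \/ s = c2 \/ s = c3, c1 = s * ratr a, c2 = s * ratr b & c3 = s * ratr c].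
  apply: vec; rewrite /c1 /c2 /c3; auto.
    move=> [z1 z2 z3]; apply: npar; rewrite -/Y1 -/Y2 -/Y3; split; apply/eqP; rewrite -subr_eq0.
    - by rewrite -oppr_eq0 opprB [Y1 * _]mulrC z3.
    - by rewrite -oppr_eq0 opprB [Y2 * _]mulrC z1.
    - by rewrite [Y1 * _]mulrC z2.
  move=> i.
  have dB x y z w : Lg x -> Lg y -> Lg z -> Lg w ->
      Ds i (x * y - z * w) = Ds i x * y + x * Ds i y - (Ds i z * w + z * Ds i w).
    by move=> *; rewrite (derB hL (hDs i)) ?(derM (hDs i)); auto.
  have d1 := detz1 i; have d2 := detz2 i.
  set e1 := det3 _ _ _ _ _ _ _ _ _ in d1; set e2 := det3 _ _ _ _ _ _ _ _ _ in d2.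
  rewrite !dB //; split; apply/eqP; rewrite -subr_eq0; apply/eqP.
  - transitivity (Y3 * e1 - X3 i0 * e2); first by rewrite /e1 /e2 /det3; ring.
    by rewrite d1 d2 !mulr0 subrr.
  - transitivity (Y1 * e1 - X1 i0 * e2); first by rewrite /e1 /e2 /det3; ring.
    by rewrite d1 d2 !mulr0 subrr.
  - transitivity (X2 i0 * e2 - Y2 * e1); first by rewrite /e1 /e2 /det3; ring.
    by rewrite d1 d2 !mulr0 subrr.
have [[[[_ x1] _] [[_ y1] _]] [[[_ x2] _] [[_ y2] _]] [[[_ x3] _] [[_ y3] _]]] := Xint i0 i1 i1.
have Zs : ZZ (h * (h * h) * s).
  have t x y z w : ZZ (h * x) -> ZZ (h * h * y) -> ZZ (h * z) -> ZZ (h * h * w) ->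
      ZZ (h * (h * h) * (x * y - z * w)).
    move=> hx hy hz hw; rewrite mulrBr; apply: (ls_B hS); rewrite mulrACA; exact: (ls_M hS).
  by case: sX => [->|[->|->]]; apply: t.
have [|rc0 ra0 rb0] := @no_quadratic_relation rc ra (- rb) (j + nn) jn0.
  apply: (quot s _ (h * (h * h)) (3 * C1)%N (3 * C2)%N) => //.
  - by rewrite !mulf_neq0.
  - rewrite !normrM [X in X <= _](_ : _ = `|h| ^+ 3); last by ring.
    exact: hQ.
  - have -> : s * (ratr rc + ratr ra * rJ + ratr (- rb) * rJ ^+ 2) =
        c3 + c1 * rJ - c2 * rJ ^+ 2 by rewrite e1 e2 e3 rmorphN; ring.
    (* A minor of [X] and [Y] in the two lighter coordinates: its weight [mm^-1 ^+ 2] is at most 1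
       and the gain [lam] is kept. *)
    have -> : c3 + c1 * rJ - c2 * rJ ^+ 2 = xi22 rJ (X1 i0) (X3 i0) * xi21 rJ Y1 Y2 Y3 -
        xi21 rJ (X1 i0) (X2 i0) (X3 i0) * xi22 rJ Y1 Y3.
      by rewrite /c1 /c2 /c3 /xi21 /xi22; ring.
    have [[_ gx1] [_ gx2] _ _] := Xg0; have [[_ gy1] [_ gy2] _ _] := good_behead (Yg i1).
    apply: (@nat_bounded_le _ (mm^-1 ^+ 2 * (H ^+ 3 * lam))).
      by apply: le_trans (HQ 3%N _ (leqnn _)); rewrite ler_piMl // mulr_ge0 // exprn_ge0.
    apply: nat_boundedD; last apply: nbN.
      have -> : mm^-1 ^+ 2 * (H ^+ 3 * lam) = H * (mm^-1 ^+ 2 * (H * H) * lam) by ring.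
      exact: nat_boundedM.
    have -> : mm^-1 ^+ 2 * (H ^+ 3 * lam) = mm^-1 ^+ 2 * H * lam * (H * H) by ring.
    exact: nat_boundedM.
  - by clear -L'E; lia.
have z1 : c1 = 0 by rewrite e1 ra0 rmorph0 mulr0.
have z2 : c2 = 0 by rewrite e2 -[rb]opprK rb0 oppr0 rmorph0 mulr0.
have z3 : c3 = 0 by rewrite e3 rc0 rmorph0 mulr0.
by case: sX => [sE|[sE|sE]]; move: s0; rewrite sE ?z1 ?z2 ?z3 eqxx.
Qed.

End Main.

(** * Liouville's inequality with a uniform constant *)

Lemma det_bound (R : realFieldType) n (A : 'M[R]_n) (M : R) : 0 <= M ->
  (forall i j, `|A i j| <= M) -> `|\det A| <= n`!%:R * M ^+ n.
Proof.
move=> M0 hA; rewrite /determinant (le_trans (ler_norm_sum _ _ _)) //.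
apply: le_trans (_ : \sum_(s : 'S_n) M ^+ n <= _); last first.
  by rewrite sumr_const card_Sn mulr_natl.
apply: ler_sum => s _; rewrite normrM normrX normrN1 expr1n mul1r normr_prod.
rewrite -[in X in _ <= X](card_ord n) -prodr_const; apply: ler_prod => i _.
by rewrite normr_ge0 hA.
Qed.

Section LiouvilleReal.
Variables (R : realFieldType) (al : R) (m : {poly rat}).
Hypotheses (al01 : 0 <= al <= 1) (m_irr : irreducible_poly m).
Notation up := (map_poly (ratr : rat -> R)).
Hypothesis m_root : (up m).[al] = 0.

Let d := (size m).-1.
Let szm : size m = d.+1. Proof. by have [h _] := m_irr; rewrite /d prednK // ltnW. Qed.
Let d0 : (0 < d)%N. Proof. by have [h _] := m_irr; move: h; rewrite szm. Qed.
Let m0 : m != 0. Proof. by rewrite -size_poly_gt0 szm. Qed.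

Lemma modp_powers : exists De C : nat, (0 < De)%N /\ forall n j, (n < d + d)%N -> (j < d)%N ->
  (exists z : int, De%:R * ('X^n %% m)`_j = z%:~R) /\ `|ratr ('X^n %% m)`_j : R| <= C%:R.
Proof.
have one (a : rat) : exists De C : nat, [/\ (0 < De)%N, exists z : int, De%:R * a = z%:~R &
    `|ratr a : R| <= C%:R].
  exists `|denq a|%N, `|numq a|%N; split.
  - by rewrite absz_gt0 denq_neq0.
  - exists (numq a); rewrite -{2}(divq_num_den a) natr_absz gtr0_norm ?denq_gt0 //.
    by rewrite mulrC mulfVK // intr_eq0 denq_neq0.
  - rewrite /ratr normrM normfV natr_absz intr_norm.
    rewrite ler_pdivrMr ?normr_gt0 ?intr_eq0 ?denq_neq0 // ler_peMr //.
    rewrite -intr_norm -[1]/(1%:~R) ler_int gtr0_norm ?denq_gt0 //.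
    by rewrite -[1]add0r lezD1 denq_gt0.
have fam (s : seq rat) : exists De C : nat, (0 < De)%N /\ forall a, a \in s ->
    (exists z : int, De%:R * a = z%:~R) /\ `|ratr a : R| <= C%:R.
  elim: s => [|a s [De [C [De0 h]]]]; first by exists 1%N, 0%N.
  have [De' [C' [De0' [z' hz'] hC']]] := one a.
  exists (De * De')%N, (C + C')%N; rewrite muln_gt0 De0 De0'; split=> // b.
  rewrite inE => /predU1P[->|/h [[z hz] hC]]; rewrite !natrD !natrM.
    split; last by rewrite (le_trans hC') // lerDr.
    by exists (De%:Z * z'); rewrite -mulrA hz' intrM.
  split; last by rewrite (le_trans hC) // lerDl.
  by exists (De'%:Z * z); rewrite [_ * De'%:R]mulrC -mulrA hz intrM.
have [De [C [De0 h]]] := fam [seq ('X^(nat_of_ord p.1) %% m)`_(nat_of_ord p.2) | p : 'I_(d + d) * 'I_d].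
exists De, C; split=> // n j nd jd; apply: h.
by apply/mapP; exists (Ordinal nd, Ordinal jd); rewrite ?mem_enum.
Qed.

(** The norm of [p.[al]] in matrix form. Multiplication by [p] modulo [m] has a matrix [N],
    invertible since [m] is irreducible, and [De ^ d * \det N] is a nonzero integer. The powers of
    [al] form an eigenvector of eigenvalue [p.[al]], so the adjugate bounds the determinant. That
    [K] serves all [p] and [G] makes transfer to the ultrapower possible. *)
Lemma liouville_real : exists K : nat, forall (p : {poly rat}) (G : R), 1 <= G ->
  (size p < size m)%N -> (forall i, exists z : int, p`_i = z%:~R) ->
  (forall i, `|ratr p`_i| <= G) -> p != 0 ->
  1 <= K%:R * G ^+ d * `|(up p).[al]|.
Proof.
have [De [C [De0 hDe]]] := modp_powers.
exists (De ^ d * (d * (d`! * (d * C + 1) ^ d)))%N => p G G1 szp pint pG p0.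
pose N : 'M[rat]_d := \matrix_(i, j) ((p * 'X^i) %% m)`_j.
have szp' : (size p <= d)%N by rewrite -ltnS -szm.
have NE i j : N i j = \sum_(k < d) p`_k * ('X^(k + i) %% m)`_j.
  rewrite mxE; have {1}-> : p = \sum_(k < d) p`_k *: 'X^k.
    by rewrite -poly_def; apply/polyP => k; rewrite coef_poly; case: ltnP => // dk;
      rewrite nth_default // (leq_trans szp').
  rewrite mulr_suml (big_morph (fun f => f %% m) (fun a b => modpD m a b) (mod0p m)).
  rewrite coef_sum; apply: eq_bigr => k _.
  by rewrite -scalerAl modpZl coefZ exprD.
have eigen i : \sum_j ratr (N i j) * al ^+ j = (up p).[al] * al ^+ i.
  have := congr1 (fun f => (up f).[al]) (divp_eq (p * 'X^i) m).
  rewrite rmorphD !rmorphM /= hornerD !hornerM m_root mulr0 add0r map_polyXn hornerXn => ->.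
  rewrite (@horner_coef_wide _ d); last by rewrite size_map_poly -ltnS -szm ltn_modp.
  by apply: eq_bigr => j _; rewrite coef_map mxE.
have detN : \det N != 0.
  apply/negP => /eqP /eqP /det0P [v v0 vN].
  pose f := \poly_(i < d) v 0 (insubd (Ordinal d0) i).
  have fE (i : 'I_d) : f`_i = v 0 i by rewrite coef_poly ltn_ord valKd.
  have f0 : f != 0.
    apply: contraNneq v0 => f0; apply/eqP/rowP => i; rewrite -fE f0 coef0 mxE //.
  have szf : (size f <= d)%N by apply: size_poly.
  have fp : (f * p) %% m = 0.
    have {1}-> : f = \sum_(i < d) v 0 i *: 'X^i.
      rewrite /f poly_def; apply: eq_bigr => i _; by rewrite valKd.
    rewrite mulr_suml (big_morph (fun f => f %% m) (fun a b => modpD m a b) (mod0p m)).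
    apply/polyP => j; rewrite coef0 coef_sum; case: (ltnP j d) => jd; last first.
      rewrite big1 // => i _; rewrite nth_default //; apply: leq_trans jd.
      by rewrite -ltnS -szm ltn_modp.
    have /rowP/(_ (Ordinal jd)) := vN; rewrite !mxE => e0; rewrite -[RHS]e0; apply: eq_bigr => i _.
    by rewrite -scalerAl modpZl coefZ mxE [p * _]mulrC.
  have mfp : m %| f * p by apply/eqP.
  have cop (g : {poly rat}) : g != 0 -> (size g <= d)%N -> coprimep m g.
    move=> g0 szg; rewrite (irreducible_poly_coprime _ m_irr) // ; apply/negP => /(dvdp_leq g0).
    by rewrite szm ltnNge szg.
  move: mfp; rewrite (Gauss_dvdpr _ (cop _ f0 szf)) => /(dvdp_leq p0).
  by rewrite szm ltnNge szp'.
have Nint i j : exists z : int, De%:R * N i j = z%:~R.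
  rewrite NE mulr_sumr; elim/big_ind: _ => [|x y [z ->] [z' ->]|k _].
  - by exists 0.
  - by exists (z + z'); rewrite intrD.
  - have [z hz] := pint k; have [||[z' hz'] _] := @hDe (k + i)%N j _ _ => //.
      by rewrite -addSn leq_add // ltnW.
    by exists (z * z'); rewrite hz mulrCA hz' intrM.
have NB i j : `|ratr (N i j) : R| <= (d * C + 1)%:R * G.
  rewrite NE rmorph_sum (le_trans (ler_norm_sum _ _ _)) //.
  apply: le_trans (_ : \sum_(k < d) C%:R * G <= _).
    apply: ler_sum => k _; rewrite rmorphM normrM mulrC ler_pM //; last exact: pG.
    by have [||_ h] := @hDe (k + i)%N j _ _ => //; rewrite -addSn leq_add // ltnW.
  rewrite sumr_const card_ord -[X in X <= _]mulr_natl mulrA -natrM ler_wpM2r ?(le_trans ler01) // ler_nat.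
  by rewrite leq_addr.
pose NR : 'M[R]_d := map_mx ratr N.
have detR : \det NR = ratr (\det N) by rewrite det_map_mx.
have low : 1 <= (De ^ d)%:R * `|\det NR|.
  have [Z hZ] : exists Z : 'I_d -> 'I_d -> int, forall i j, De%:R * N i j = (Z i j)%:~R.
    have /choice [f hf] : forall ij : 'I_d * 'I_d, exists z : int, De%:R * N ij.1 ij.2 = z%:~R.
      by move=> [i j]; apply: Nint.
    by exists (fun i j => f (i, j)) => i j; rewrite -hf.
  have e : De%:R *: N = map_mx intr (\matrix_(i, j) Z i j).
    by apply/matrixP => i j; rewrite !mxE -hZ mxE.
  have e2 : De%:R ^+ d * \det N = (\det (\matrix_(i, j) Z i j))%:~R.
    by rewrite -detZ e det_map_mx.
  have : (De ^ d)%:R * \det NR = (\det (\matrix_(i, j) Z i j))%:~R.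
    rewrite detR natrX -(ratr_nat R De) -rmorphXn -rmorphM /= e2 ratr_int //.
  move=> e3; have : `|(De ^ d)%:R * \det NR| >= 1.
    rewrite e3 -intr_norm -[1]/(1%:~R) ler_int -gtz0_ge1 normr_gt0.
    apply: contraNneq detN => z0; move: e2; rewrite z0 => /eqP.
    by rewrite mulf_eq0 expf_eq0 pnatr_eq0 (gtn_eqF De0) andbF.
  by rewrite normrM normr_nat.
pose w : 'cV[R]_d := \col_j al ^+ j.
have Nw : NR *m w = (up p).[al] *: w.
  apply/colP => i; rewrite !mxE -eigen; apply: eq_bigr => j _; by rewrite !mxE.
have adjw : \det NR = (up p).[al] * (\adj NR *m w) (Ordinal d0) 0.
  have w1 : w (Ordinal d0) 0 = 1 by rewrite mxE expr0.
  have e1 : (\det NR *: w) (Ordinal d0) 0 = ((up p).[al] *: (\adj NR *m w)) (Ordinal d0) 0.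
    by rewrite -mul_scalar_mx -mul_adj_mx -mulmxA Nw -scalemxAr.
  by move: e1; rewrite [X in X = _]mxE [X in _ = X]mxE w1 mulr1.
have adjB i j : `|\adj NR i j| <= (d`! * (d * C + 1) ^ d)%:R * G ^+ d.
  rewrite mxE /cofactor normrM normrX normrN1 expr1n mul1r.
  have MB : 1 <= (d * C + 1)%:R * G by rewrite mulr_ege1 // ler1n addn1.
  apply: le_trans (det_bound (le_trans ler01 MB) _) _; first by move=> i' j'; rewrite 3!mxE; apply: NB.
  rewrite natrM natrX -mulrA -exprMn ler_pM ?exprn_ge0 ?(le_trans ler01 MB) //.
    by rewrite ler_nat leq_fact // leq_pred.
  by rewrite ler_weXn2l // leq_pred.
have /andP[al0 al1] := al01.
apply: le_trans low _; rewrite adjw normrM !natrM -!mulrA ler_wpM2l //.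
rewrite mulrC !mulrA ler_wpM2r //.
rewrite mxE (le_trans (ler_norm_sum _ _ _)) //.
apply: le_trans (_ : \sum_(j < d) (d`! * (d * C + 1) ^ d)%:R * G ^+ d <= _).
  apply: ler_sum => j _; rewrite normrM -[X in _ <= X]mulr1 ler_pM //.
  by rewrite mxE ger0_norm ?exprn_ge0 // exprn_ile1.
by rewrite sumr_const card_ord -[X in X <= _]mulr_natl !natrM !mulrA.
Qed.

End LiouvilleReal.

(** * Return words of a linearly recurrent sequence *)

Section Recurrence.
Variables (a : nat -> nat) (c : nat).
Hypothesis lr : forall i len, (0 < len)%N -> exists k, (0 < k <= c * len)%N /\
  forall l, (l < len)%N -> a (i + k + l)%N = a (i + l)%N.

Local Open Scope nat_scope.

(** Start from an occurrence left of [p] and follow its returns: steps of at most [c * L] cannot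
    jump over the window. *)
Lemma factor_window i p L : 0 < L -> i <= p + c * L ->
  exists2 i', p <= i' <= p + c * L & forall l, l < L -> a (i' + l) = a (i + l).
Proof.
move=> L0; have [n] : exists n, p <= i + n by exists p; rewrite leq_addl.
elim: n i => [|n IH] i; first by rewrite addn0 => pi ip; exists i; rewrite ?pi.
move=> pin ip; have [pi|ltip] := leqP p i; first by exists i; rewrite ?pi.
have [k [/andP[k0 kL] hk]] := lr i L0.
have [||i' hi' hl] := IH (i + k); [lia|lia|].
by exists i' => // l lL; rewrite hl // hk.
Qed.

Lemma prefix_recurs_beyond M i : 0 < M -> exists2 p, i <= p & forall l, l < M -> a (p + l) = a l.
Proof.
move=> M0; elim: i => [|i [p ip hp]]; first by exists 0.
have [k [/andP[k0 _] hk]] := lr p M0; exists (p + k); first by lia.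
by move=> l lM; rewrite hk ?hp.
Qed.

(** A long copy of the prefix beyond [i] contains an occurrence of the factor, which is then read in
    the prefix itself. *)
Lemma factor_early i L : 0 < L -> exists2 j, j <= c * L & forall l, l < L -> a (j + l) = a (i + l).
Proof.
move=> L0; have [|p ip hp] := @prefix_recurs_beyond (c * L + L) i; first by lia.
have [|i' /andP[pi' i'p] hi'] := @factor_window i p L L0; first by lia.
exists (i' - p); first by lia.
move=> l lL; rewrite -hp; last by lia.
by rewrite -hi' //; congr a; lia.
Qed.

Lemma bounded_letters : exists A, forall i, a i <= A.
Proof.
exists (\max_(j < (c * 1).+1) a j) => i.
have [j jc /(_ 0 isT)] := @factor_early i 1 isT; rewrite !addn0 => <-.
have jc' : j < (c * 1).+1 by [].
exact: (@leq_bigmax _ (fun j : 'I_(c * 1).+1 => a j) (Ordinal jc')).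
Qed.

(** A stretch this long sees every factor of length [k.+1], and such a factor decides whether
    [a i = a (i + k)]. *)
Lemma long_repetition_periodic p k n : 0 < k -> c * k.+1 < n ->
  (forall l, l < n -> a (p + l) = a (p + k + l)) -> forall i, a i = a (i + k).
Proof.
move=> k0 kn h i; have [j jL hj] := @factor_early i k.+1 isT.
have [|i' /andP[pi' i'p] hi'] := @factor_window j p k.+1 isT; first by lia.
have e l : l <= k -> a (i' + l) = a (i + l) by move=> lk; rewrite hi' // hj.
have := e 0 isT; have := e k (leqnn k); rewrite !addn0 => <- <-.
have := h (i' - p); rewrite (_ : p + (i' - p) = i'); last by lia.
by move=> ->; [congr a; lia|lia].
Qed.

Hypothesis c0 : 0 < c.
Hypothesis aperiodic : forall k, 0 < k -> exists i, a i <> a (i + k).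

Section Level.
Variable N : nat.
(** With this prefix length a return time below [N.+2] would force periodicity, see [gap_ge]. *)
Let n := c * N.+3.
Let n0 : 0 < n. Proof. by rewrite /n muln_gt0 c0. Qed.

Definition prefix_at p := all (fun l => a (p + l) == a l) (iota 0 n).

Lemma prefix_atP p : reflect (forall l, l < n -> a (p + l) = a l) (prefix_at p).
Proof.
apply: (iffP allP) => h l; first by move=> ln; apply/eqP/h; rewrite mem_iota.
by rewrite mem_iota => /h ->.
Qed.

Definition gap p := (find (fun k => prefix_at (p + k.+1)) (iota 0 (c * n))).+1.
Definition pos j := iter j (fun p => p + gap p) 0.

Lemma posS j : pos j.+1 = pos j + gap (pos j). Proof. by []. Qed.

Lemma gap_le p : prefix_at p -> gap p <= c * n /\ prefix_at (p + gap p).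
Proof.
move=> /prefix_atP hp; have [k [/andP[k0 kn] hk]] := lr p n0.
have hs : has (fun k => prefix_at (p + k.+1)) (iota 0 (c * n)).
  apply/hasP; exists k.-1; first by rewrite mem_iota; lia.
  by apply/prefix_atP => l ln; rewrite prednK // hk // hp.
have lt := hs; rewrite has_find size_iota in lt; split=> //.
by have := nth_find 0 hs; rewrite nth_iota.
Qed.

Lemma gap_min p k : 0 < k -> k < gap p -> k <= c * n -> ~~ prefix_at (p + k).
Proof.
move=> k0 kg kn; rewrite /gap in kg; have lt : k.-1 < find (fun k => prefix_at (p + k.+1)) (iota 0 (c * n)) by lia.
have := before_find 0 lt; rewrite nth_iota ?add0n ?prednK //; first by move=> ->.
Qed.

Lemma gap_ge p : prefix_at p -> N.+2 <= gap p.
Proof.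
move=> hp; have [_ /prefix_atP hg] := gap_le hp; move/prefix_atP: hp => hp.
rewrite leqNgt; apply/negP => gN; have [i] := aperiodic (ltn0Sn _ : 0 < gap p); apply.
apply: (@long_repetition_periodic p (gap p) n) => //; last by move=> l ln; rewrite hg // hp.
by rewrite /n ltn_pmul2l //; lia.
Qed.

Lemma gap_local p p' : (forall l, l < c * n + n -> a (p + l) = a (p' + l)) -> gap p = gap p'.
Proof.
move=> h; rewrite /gap; congr _.+1; apply: eq_in_find => k; rewrite mem_iota add0n => kn.
apply: eq_in_all => l; rewrite mem_iota add0n => ln.
by rewrite -!addnA h //; lia.
Qed.

Lemma prefix_at_pos j : prefix_at (pos j).
Proof.
elim: j => [|j IH]; first by apply/prefix_atP => l; rewrite add0n.
by rewrite posS; case: (gap_le IH).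
Qed.

Lemma pos_ge j : j * N.+2 <= pos j.
Proof.
elim: j => // j IH; rewrite posS mulSn addnC leq_add //; apply: gap_ge; exact: prefix_at_pos.
Qed.

Lemma pos_le j : pos j <= j * (c * n).
Proof.
elim: j => // j IH; rewrite posS mulSn addnC leq_add //.
by case: (gap_le (prefix_at_pos j)).
Qed.

Lemma pos_onto q : prefix_at q -> exists j, pos j = q.
Proof.
move=> hq; suff [j /andP[jq qj]] : exists j, pos j <= q < pos j.+1.
  exists j; apply/eqP; rewrite eqn_leq jq leqNgt; apply/negP => jq'.
  have [gn _] := gap_le (prefix_at_pos j); rewrite posS in qj.
  have := @gap_min (pos j) (q - pos j); rewrite subnKC // hq => h.
  by have : ~~ true by apply: h; lia.
have [n1 hn1] : exists n1, q < pos n1.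
  by exists q.+1; apply: leq_trans (pos_ge _); rewrite leq_pmulr.
elim: n1 hn1 => // n1 IH hn1; have [/IH //|h] := ltnP q (pos n1).
by exists n1; rewrite h.
Qed.

(** A factor of length [c * n + n] occurs at a position at most [c * c.+1 * n], which bounds its
    index among the return positions by [index_bound]. The bound is free of [N]. *)
Definition nletters := (2 * c ^ 2 * c.+1).+1.

(** The window covers a return word and the copy of the prefix that ends it, so it determines
    [gap]. *)
Definition same_window k p := all (fun l => a (pos k + l) == a (p + l)) (iota 0 (c * n + n)).

Lemma same_windowP k p : reflect (forall l, l < c * n + n -> a (pos k + l) = a (p + l)) (same_window k p).
Proof.
apply: (iffP allP) => h l; first by move=> ln; apply/eqP/h; rewrite mem_iota.
by rewrite mem_iota => /h ->.
Qed.

(** The code depends on the window at [pos j] alone, so equal windows get equal codes; the default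
    is never taken, by [codeP]. *)
Definition code j : 'I_nletters := odflt ord0 [pick k : 'I_nletters | same_window k (pos j)].

Lemma index_bound j q M : pos j = q -> q <= M * n -> j <= 2 * c * M.
Proof.
move=> <- h; have := leq_trans (pos_ge j) h; rewrite /n => h2.
rewrite -(@leq_pmul2r N.+2) //; apply: leq_trans h2 _.
rewrite (_ : 2 * c * M * N.+2 = M * (c * (2 * N.+2))); last by ring.
by rewrite !leq_mul //; lia.
Qed.

Lemma codeP j : same_window (code j) (pos j).
Proof.
rewrite /code; case: pickP => //= none.
have [|q qL hq] := @factor_early (pos j) (c * n + n); first by lia.
have hpq : prefix_at q.
  apply/prefix_atP => l ln; rewrite hq; last by lia.
  by move/prefix_atP: (prefix_at_pos j); apply.
have [k kq] := pos_onto hpq.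
have kB : k < nletters.
  rewrite /nletters ltnS; have := @index_bound k q (c * c.+1) kq.
  have -> : 2 * c * (c * c.+1) = 2 * c ^ 2 * c.+1 by ring.
  by apply; apply: leq_trans qL _; rewrite -mulnA leq_mul2l mulSn addnC leqnn orbT.
by have := none (Ordinal kB); apply: contraFT => _; apply/same_windowP => l ll /=; rewrite kq hq.
Qed.

Lemma code_gap j : gap (pos j) = gap (pos (code j)).
Proof. by apply: gap_local => l ln; move/same_windowP: (codeP j) => ->. Qed.

Lemma code_word j l : l < gap (pos j) -> a (pos j + l) = a (pos (code j) + l).
Proof.
move=> lg; have [gn _] := gap_le (prefix_at_pos j).
by move/same_windowP: (codeP j) => -> //; lia.
Qed.

(** The bound on [j] is the same at all levels [N], so the ultrafilter can select one [j]. *)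
Lemma code_recurs L : exists2 j, 0 < j <= 2 * c * (c * (c * L + c.+1)) &
  forall l, l < L -> code (j + l) = code l.
Proof.
(* Room for [L] return words of length at most [c * n], followed by a window of length
   [c * n + n]. *)
pose M := (c * L + c.+1) * n.
have [|q [/andP[q0 qM] hq]] := @lr 0 M; first by rewrite /M muln_gt0 n0 addnS.
rewrite !add0n in hq.
have hq' l : l < M -> a (q + l) = a l by move=> /hq.
have nM : n <= M by rewrite /M leq_pmull // addnS.
have [|j jq] := pos_onto (q := q).
  by apply/prefix_atP => l ln; rewrite hq' // (leq_trans ln).
exists j.
  apply/andP; split; first by case: j jq => // jq; rewrite -jq in q0.
  by apply: (index_bound jq); rewrite -mulnA.
have key l w : l <= L -> w < c * n + n -> pos l + w < M.
  move=> lL wn; have := pos_le l; have : l * (c * n) <= L * (c * n) by rewrite leq_mul2r lL orbT.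
  rewrite /M (_ : (c * L + c.+1) * n = L * (c * n) + (c * n + n)); last by ring.
  by lia.
have pl l : l <= L -> pos (j + l) = q + pos l.
  elim: l => [|l IH] lL; first by rewrite !addn0.
  rewrite addnS !posS IH ?(ltnW lL) // addnA; congr (_ + _); apply: gap_local => w wn.
  by rewrite -addnA hq' // key // ltnW.
move=> l lL; rewrite /code pl ?(ltnW lL) //; congr odflt; apply: eq_pick => k /=.
apply: eq_in_all => w; rewrite mem_iota add0n => wn.
by rewrite -addnA hq' // key // ltnW.
Qed.

End Level.

(** The product of the matrices with rows [(0, 1)] and [(1, a i)] over the word; [(s, t)] and
    [(u, v)] are its rows. *)
Definition word_matrix := fix word_matrix p k : nat * nat * nat * nat :=
  if k is k'.+1 then
    let: (s, t, u, v) := word_matrix p k' in (t, s + a (p + k') * t, v, u + a (p + k') * v)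
  else (1, 0, 0, 1).

End Recurrence.

(** * Continued fraction matrices of words *)

Section WordMatrix.
Variable a : nat -> nat.
Local Notation word_matrix := (word_matrix a).

Lemma word_matrixS p k : word_matrix p k.+1 = let: (s, t, u, v) := word_matrix p k in
  (t, s + a (p + k) * t, v, u + a (p + k) * v)%N.
Proof. by []. Qed.

Lemma eq_word_matrix p p' k : (forall l, (l < k)%N -> a (p + l)%N = a (p' + l)%N) ->
  word_matrix p k = word_matrix p' k.
Proof.
elim: k => //= k IH h; rewrite IH; last by move=> l lk; apply: h; apply: ltnW.
by rewrite h.
Qed.

Lemma word_matrix_det (R : pzRingType) p k : let: (s, t, u, v) := word_matrix p k in
  (s%:R * v%:R - t%:R * u%:R : R) = 1 \/ (s%:R * v%:R - t%:R * u%:R : R) = -1.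
Proof.
elim: k => /= [|k]; first by left; rewrite mul0r subr0 mulr1.
case: (word_matrix p k) => [[[s t] u] v] /= IH.
have -> : t%:R * (u + a (p + k) * v)%:R - (s + a (p + k) * t)%:R * v%:R = - (s%:R * v%:R - t%:R * u%:R) :> R.
  rewrite -!natrM opprB mulnDr mulnDl !natrD opprD addrACA.
  rewrite (_ : (t * (a (p + k) * v) = a (p + k) * t * v)%N); last by lia.
  by rewrite subrr addr0.
by case: IH => ->; [right|left; rewrite opprK].
Qed.

Hypothesis apos : forall i, (0 < a i)%N.

Lemma word_matrix_bounds p k : (0 < k)%N -> let: (s, t, u, v) := word_matrix p k in
  [/\ (s <= u)%N, (t <= v)%N, (0 < u)%N, (u <= v)%N & (2 ^ k.-1 <= u * v)%N].
Proof.
case: k => // k _; elim: k => [|k IH] /=.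
  by have := apos (p + 0); split; lia.
move: IH => /=; case: (word_matrix p k) => [[[s t] u] v] /= [h1 h2 h3 h4 h5].
have := apos (p + k.+1); set x := a (p + k.+1)%N; set w := (u + a (p + k) * v)%N in h3 h4 h5 *.
set y := (s + a (p + k) * t)%N in h2 *.
move=> x0; split=> //.
- by rewrite leq_add // leq_mul.
- exact: leq_trans h4.
- by rewrite (leq_trans _ (leq_addl _ _)) // leq_pmull.
have h6 : (w * v + w * w <= w * (v + x * w))%N.
  by rewrite mulnDr leq_add2l leq_mul2l leq_pmull ?orbT.
have h7 : (v * w <= w * w)%N by rewrite leq_mul2r h4 orbT.
rewrite expnS; apply: leq_trans h6; rewrite mul2n -addnn (mulnC w v).
by rewrite leq_add // (leq_trans h5).
Qed.

(** Here [u] is the entry [v] of the word without its last letter, so its square dominates the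
    product [u * v] of that word. *)
Lemma word_matrix_lower p k : (1 < k)%N -> let: (s, t, u, v) := word_matrix p k in
  (2 ^ k.-2 <= u ^ 2)%N.
Proof.
case: k => [|[|k]] // _; have := @word_matrix_bounds p k.+1 isT.
rewrite (word_matrixS p k.+1); move: (word_matrix p k.+1) => [[[s t] u] v] /= [_ _ _ h h'].
by apply: leq_trans h' _; rewrite expnS expn1 leq_mul2r h orbT.
Qed.

Lemma word_matrix_upper A p k : (forall i, (a i <= A)%N) -> let: (s, t, u, v) := word_matrix p k in
  (u <= A.+1 ^ k)%N /\ (v <= A.+1 ^ k)%N.
Proof.
move=> hA; elim: k => //= k; case: (word_matrix p k) => [[[s t] u] v] /= [h1 h2].
rewrite expnS mulSn; split; first by rewrite (leq_trans h2) // leq_addr.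
by rewrite leq_add // leq_mul.
Qed.

Lemma word_matrix_tail (R : realFieldType) (x : nat -> R) p k :
  (forall i, x i * ((a i)%:R + x i.+1) = 1) -> let: (s, t, u, v) := word_matrix p k in
  x p * (u%:R * x (p + k)%N + v%:R) = s%:R * x (p + k)%N + t%:R.
Proof.
move=> hx; elim: k => [|k] /=; first by rewrite addn0; ring.
case: (word_matrix p k) => [[[s t] u] v] /= IH.
have h := hx (p + k)%N; rewrite addnS; set z := x (p + k).+1 in h *.
set y := x (p + k)%N in h IH *; set w := (a (p + k))%:R in h *.
rewrite !natrD !natrM -/w.
have -> : x p * (v%:R * z + (u%:R + w * v%:R)) = x p * (u%:R * y + v%:R) * (w + z) + x p * u%:R * (1 - y * (w + z)).
  by ring.
have -> : t%:R * z + (s%:R + w * t%:R) = (s%:R * y + t%:R) * (w + z) + s%:R * (1 - y * (w + z)) by ring.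
by rewrite h IH subrr !mulr0.
Qed.

End WordMatrix.

(** * Transfer of the sequence to the ultrapower *)

Section HyperTransfer.
Variable R : realFieldType.
Notation HR := (hyperreal R).
Notation hy f := (hyp f : HR).

Lemma hyp_int (z : int) : (z%:~R : HR) = hyp (fun=> z%:~R).
Proof. by case: z => k; [exact: hyp_nat|rewrite NegzE mulrNz [_%:~R]hyp_nat hypN; congr hyp]. Qed.

Lemma hyp_ratr (q : rat) : (ratr q : HR) = hyp (fun=> ratr q).
Proof. by rewrite /ratr !hyp_int hypV hypM. Qed.

Lemma hyp_sum d (F : nat -> nat -> R) :
  \sum_(i < d) hy (F i) = hyp (fun n => \sum_(i < d) F i n).
Proof.
elim: d => [|d IH].
  by rewrite big_ord0 [LHS]hyp0; congr hyp; apply/funext => n; rewrite big_ord0.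
by rewrite big_ord_recr /= IH hypD; congr hyp; apply/funext => n; rewrite big_ord_recr.
Qed.

Lemma hyp_horner d (p : {poly HR}) (P : nat -> {poly R}) f : (size p <= d)%N ->
  (forall n, (size (P n) <= d)%N) -> (forall i, (i < d)%N -> p`_i = hyp (fun n => (P n)`_i)) ->
  p.[hy f] = hyp (fun n => (P n).[f n]).
Proof.
move=> sp sP h; rewrite (horner_coef_wide _ sp).
transitivity (\sum_(i < d) hy (fun n => (P n)`_i * f n ^+ i)).
  by apply: eq_bigr => i _; rewrite h // hypX hypM.
rewrite (hyp_sum d (fun i n => (P n)`_i * f n ^+ i)); congr hyp; apply/funext => n.
by rewrite (horner_coef_wide _ (sP n)).
Qed.

Lemma hyp_horner_rat (p : {poly rat}) f :
  (map_poly (ratr : rat -> HR) p).[hy f] = hyp (fun n => (map_poly ratr p).[f n]).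
Proof.
apply: (@hyp_horner (size p)); rewrite ?size_map_poly // => i _.
by rewrite coef_map /= hyp_ratr; congr hyp; apply/funext => n; rewrite coef_map.
Qed.

Definition hyperint (x : HR) := exists z : nat -> int, x = hyp (fun n => (z n)%:~R).

(** At almost every index the quotient is a rational root of the same [p], which has finitely many;
    if no value were taken almost everywhere, more distinct roots than allowed could be
    collected. *)
Lemma hyperint_rational_root x y : hyperint x -> hyperint y -> y != 0 ->
  (exists2 p : {poly rat}, p != 0 & (map_poly ratr p).[x / y] = 0) ->
  exists q : rat, x / y = ratr q.
Proof.
move=> [z ->] [z' ->] _ [p p0]; rewrite hypV hypM hyp_horner_rat [0]hyp0 => /hypP hroot.
pose r n : rat := (z n)%:~R / (z' n)%:~R.
have rE n : (z n)%:~R / (z' n)%:~R = ratr (r n) :> R.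
  by rewrite /r rmorphM fmorphV /= !ratr_int.
have {}hroot : uae (fun n => root p (r n)).
  by apply: uaeS hroot => n; rewrite rE horner_map => /eqP; rewrite fmorph_eq0.
have [[q hq]|nq] := pselect (exists q, uae (fun n => r n = q)).
  by exists q; rewrite hyp_ratr; apply/hypP; apply: uaeS hq => n <-; rewrite rE.
have fresh (s : seq rat) : uae (fun n => r n \notin s).
  elim: s => [|b s IH]; first exact: uaeT.
  have hb : uae (fun n => r n <> b) by apply: uae_not => hb; apply: nq; exists b.
  by apply: uaeS (uaeI IH hb) => n [h1 /eqP h2]; rewrite inE negb_or h2.
have [s [ss su sr]] : exists s : seq rat, [/\ size s = size p, uniq s & all (root p) s].
  elim: (size p) => [|k [s [ss su sr]]]; first by exists [::].
  have [n [h1 h2]] := uae_ex (uaeI hroot (fresh s)).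
  by exists (r n :: s); rewrite /= ss su h2 h1 sr.
by have := max_poly_roots p0 sr su; rewrite ss ltnn.
Qed.

(** The degree is standard, so only finitely many conditions on coefficients are intersected, and
    the real constant [K] serves every index. *)
Lemma hyper_liouville (al : R) (m : {poly rat}) : 0 <= al <= 1 -> irreducible_poly m ->
  (map_poly ratr m).[al] = 0 ->
  forall (p : {poly HR}) (G : HR), 1 <= G -> (size p < size m)%N -> (forall i, hyperint p`_i) ->
  (forall i, `|p`_i| <= G) -> p != 0 ->
  exists K : nat, 1 <= K%:R * G ^+ (size m).-1 * `|p.[hyp (fun=> al)]|.
Proof.
move=> al01 m_irr m_root p G G1 szp pint pG p0; have [K hK] := liouville_real al01 m_irr m_root.
exists K; have [z hz] := choice pint; have [g gE] := hyp_surj G.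
set d := (size m).-1 in hK *.
have szm : size m = d.+1 by rewrite /d prednK //; case: m_irr => /ltnW.
have szp' : (size p <= d)%N by rewrite -ltnS -szm.
pose P n : {poly rat} := \poly_(i < d) (z i n)%:~R.
have PE n i : (i < d)%N -> (map_poly (ratr : rat -> R) (P n))`_i = (z i n)%:~R.
  by move=> id; rewrite coef_map coef_poly id /= ratr_int.
have -> : p.[hyp (fun=> al)] = hyp (fun n => (map_poly ratr (P n)).[al]).
  apply: (@hyp_horner d) => // [n|i id].
    by rewrite size_map_poly size_poly.
  by rewrite hz; congr hyp; apply/funext => n; rewrite PE.
have u1 : uae (fun n => 1 <= g n) by apply/hyp_le; rewrite -gE.
have u2 : uae (fun n => forall i, (i < d)%N -> `|(z i n)%:~R| <= g n).
  by apply: uae_forall_ltn => i _; apply/hyp_le; rewrite -hyp_norm -hz -gE.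
have u3 : uae (fun n => P n != 0).
  have i0 : ((size p).-1 < d)%N by rewrite prednK // size_poly_gt0.
  have : uae (fun n => ~ (z (size p).-1 n)%:~R = 0 :> R).
    apply: uae_not => h; have : p`_(size p).-1 = 0 by rewrite hz [RHS]hyp0; apply/hypP.
    by apply/eqP; rewrite -lead_coefE lead_coef_eq0.
  apply: uaeS => n h; apply/negP => /eqP Pn; apply: h.
  by rewrite -PE // Pn rmorph0 coef0.
pose Pa n := (map_poly (ratr : rat -> R) (P n)).[al].
have e1 : K%:R * G ^+ d = hyp (fun n => K%:R * g n ^+ d) by rewrite gE hyp_nat hypX hypM.
have e3 : hy (fun n => K%:R * g n ^+ d * `|Pa n|) = hy (fun n => K%:R * g n ^+ d) * `|hy Pa|.
  by rewrite hyp_norm hypM.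
rewrite e1; suff h : hy (fun=> 1) <= hy (fun n => K%:R * g n ^+ d * `|Pa n|).
  by apply: (le_trans h); rewrite e3; exact: lexx.
apply/hyp_le; apply: uaeS (uaeI u1 (uaeI u2 u3)) => n [h1 [h2 h3]]; apply: hK => //.
- by rewrite szm ltnS size_poly.
- by move=> i; rewrite coef_poly; case: ifP => _; [exists (z i n)|exists 0].
move=> i; rewrite coef_poly; case: ltnP => [/h2|_]; first by rewrite ratr_int.
by rewrite rmorph0 normr0 (le_trans ler01).
Qed.

Section Contradiction.
Variables (a : nat -> nat) (c : nat) (x : nat -> R) (m : {poly rat}).
Hypothesis c0 : (0 < c)%N.
Hypothesis lr : forall i len, (0 < len)%N -> exists k, (0 < k <= c * len)%N /\
  forall l, (l < len)%N -> a (i + k + l)%N = a (i + l)%N.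
Hypothesis apos : forall i, (0 < a i)%N.
Hypothesis aperiodic : forall k, (0 < k)%N -> exists i, a i <> a (i + k)%N.
Hypothesis x01 : forall i, 0 <= x i <= 1.
Hypothesis xE : forall i, x i * ((a i)%:R + x i.+1) = 1.
Hypotheses (m_irr : irreducible_poly m) (m_monic : m \is monic).
Hypothesis m_root : (map_poly ratr m).[x 0%N] = 0.

Notation B := (nletters c).
Notation posN N := (pos a c N).
Notation gapN N k := (gap a c N (posN N k)).
Notation W N k := (word_matrix a (posN N k) (gapN N k)).
Let entry1 (w : nat * nat * nat * nat) := w.1.1.1.
Let entry2 (w : nat * nat * nat * nat) := w.1.1.2.
Let entry3 (w : nat * nat * nat * nat) := w.1.2.
Let entry4 (w : nat * nat * nat * nat) := w.2.
(** At level [N], letter [k] is the return word that starts at the [k]-th return position. *)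
Let L (e : nat * nat * nat * nat -> nat) (k : 'I_B) : HR := hyp (fun N => (e (W N k))%:R).

Let gap_ge2 N k : (N.+2 <= gapN N k)%N.
Proof. apply: (gap_ge lr c0 aperiodic); exact: (prefix_at_pos lr c0). Qed.

Let gap_leN N k : (gapN N k <= c * (c * N.+3))%N.
Proof. by have [] := gap_le lr c0 (prefix_at_pos lr c0 N k). Qed.

Let Wb N k : [/\ (entry1 (W N k) <= entry3 (W N k))%N, (entry2 (W N k) <= entry4 (W N k))%N,
  (0 < entry3 (W N k))%N, (entry3 (W N k) <= entry4 (W N k))%N & (2 ^ N <= entry3 (W N k) ^ 2)%N].
Proof.
move: (gap_ge2 N k); move: (gapN N k) => g g2.
have := @word_matrix_bounds a apos (posN N k) g; have := @word_matrix_lower a apos (posN N k) g.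
case: (word_matrix a _ g) => [[[s t] u] v]; rewrite /entry1 /entry2 /entry3 /entry4 /= => h1 h2.
have [|h3 h4 h5 h6 _] := h2; first by lia.
split=> //; apply: leq_trans (h1 _); last by lia.
by rewrite leq_exp2l //; lia.
Qed.

Lemma hyper_letter_system : exists cc : nat, letter_system hyperint cc (hyp (fun N => 2 ^+ N))
  (L entry1) (L entry2) (L entry3) (L entry4) (fun k => L entry1 k * L entry4 k - L entry2 k * L entry3 k).
Proof.
(* The entries are at most [A.+1 ^ g <= 2 ^ (A * g)] with [g <= c ^ 2 * N.+3], and [N.+3 <= 4 * N]
   for positive [N]. *)
have [A hA] := bounded_letters lr; exists (4 * A * c ^ 2)%N.
have Lint e k : hyperint (L e k) by exists (fun N => (e (W N k))%:Z).
have Lge0 e k : 0 <= L e k by rewrite [0]hyp0; apply/hyp_le/uaeT => N.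
split=> //.
- by exists (fun=> 1).
- by move=> _ _ [z ->] [z' ->]; exists (fun n => z n - z' n); rewrite hypN hypD; congr hyp;
    apply/funext => n; rewrite intrB.
- by move=> _ _ [z ->] [z' ->]; exists (fun n => z n * z' n); rewrite hypM; congr hyp;
    apply/funext => n; rewrite intrM.
- move=> _ [z ->] h; have {}h : hy (fun n => `|(z n)%:~R|) < hy (fun=> 1).
    by rewrite -hyp_norm; exact: h.
  apply: (proj2 (hypP _ (fun=> 0))); move/hyp_lt: h; apply: uaeS => n; rewrite -intr_norm -[1]/(1%:~R) ltr_int => h.
  suff -> : z n = 0 by [].
  by move: h; clear; lia.
- move=> k; rewrite /L !hypM hypN hypD.
  have : uae (fun N => (entry1 (W N k))%:R * (entry4 (W N k))%:R - (entry2 (W N k))%:R * (entry3 (W N k))%:R = 1 :> R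
      \/ (entry1 (W N k))%:R * (entry4 (W N k))%:R - (entry2 (W N k))%:R * (entry3 (W N k))%:R = -1 :> R).
    apply: uaeT => N; have := @word_matrix_det a R (posN N k) (gapN N k).
    by case: (W N k) => [[[s t] u] v].
  case/uae_or => h; [left|right]; first exact: (proj2 (hypP _ (fun=> 1)) h).
  exact: etrans (proj2 (hypP _ (fun=> -1)) h) (esym (hypN (fun=> 1))).
- by move=> k; apply/hyp_le/uaeT => N; rewrite ler_nat; case: (Wb N k).
- by move=> k; apply/hyp_le/uaeT => N; rewrite ler_nat; case: (Wb N k).
- by move=> k; rewrite [0]hyp0; apply/hyp_lt/uaeT => N; rewrite ltr0n; case: (Wb N k).
- by move=> k; apply/hyp_le/uaeT => N; rewrite ler_nat; case: (Wb N k).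
- move=> n; rewrite hyp_nat; apply/hyp_lt; apply: uaeS (uae_ge n) => N nN.
  by rewrite -natrX ltr_nat (leq_ltn_trans nN) // ltn_expl.
- by move=> k; rewrite hypX; apply/hyp_le/uaeT => N; rewrite -!natrX ler_nat; case: (Wb N k).
- move=> k; rewrite hypX; apply/hyp_le; apply: uaeS (uae_ge 1) => N N1.
  rewrite -!natrX ler_nat.
  have := @word_matrix_upper a A (posN N k) (gapN N k) hA.
  have key g : (g <= c * (c * N.+3))%N -> (A.+1 ^ g <= (2 ^ N) ^ (4 * A * c ^ 2))%N.
    move=> gN; apply: leq_trans (_ : (2 ^ A) ^ g <= _)%N.
      by case: (g) => // g'; rewrite leq_exp2r // ltn_expl.
    rewrite -!expnM leq_exp2l //.
    apply: leq_trans (_ : A * (c * (c * N.+3)) <= _)%N; first by rewrite leq_mul2l gN orbT.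
    rewrite (_ : A * (c * (c * N.+3)) = A * c ^ 2 * N.+3)%N; last by ring.
    rewrite (_ : N * (4 * A * c ^ 2) = A * c ^ 2 * (4 * N))%N; last by ring.
    by rewrite leq_mul2l; apply/orP; right; lia.
  move: (key _ (gap_leN N k)); move: (gapN N k) => g.
  by case: (word_matrix _ _ g) => [[[s t] u] v] /= h1 [_ h2]; rewrite /entry4 /= (leq_trans h2).
Qed.

Lemma irreducible_root_size_le3 : (size m <= 3)%N.
Proof.
rewrite leqNgt; apply/negP => m_size.
have [cc hS] := hyper_letter_system.
(* The letter at position [j] of the ultrapower is the code found there at almost all levels. *)
have [om hom] := choice (fun j => uae_ord (fun N => code a c N j)).
have al01 : 0 <= (hyp (fun=> x 0%N) : HR) <= 1.
  by rewrite [0]hyp0 [1]hyp1; apply/andP; split; apply/hyp_le/uaeT => N; case/andP: (x01 0%N).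
pose X i : HR := hyp (fun N => x (posN N i)).
have X01 i : 0 <= X i <= 1.
  by rewrite [0]hyp0 [1]hyp1; apply/andP; split; apply/hyp_le/uaeT => N; case/andP: (x01 (posN N i)).
have XE i : X i = mob (L entry1) (L entry2) (L entry3) (L entry4) (om i) (X i.+1).
  pose l e N : R := (e (W N (om i)))%:R; pose y N := x (posN N i.+1).
  have mobE : (hy (l entry1) * hy y + hy (l entry2)) / (hy (l entry3) * hy y + hy (l entry4)) =
      hyp (fun N => (l entry1 N * y N + l entry2 N) / (l entry3 N * y N + l entry4 N)).
    have e1 : hy (l entry1) * hy y + hy (l entry2) = hyp (fun N => l entry1 N * y N + l entry2 N).
      by rewrite hypM hypD.
    have e2 : hy (l entry3) * hy y + hy (l entry4) = hyp (fun N => l entry3 N * y N + l entry4 N).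
      by rewrite hypM hypD.
    by rewrite e1 e2 hypV hypM.
  apply: etrans (esym mobE); apply/hypP; apply: uaeS (hom i) => N; rewrite /l /y => <-.
  have e := code_gap lr c0 aperiodic N i.
  have ew : word_matrix a (posN N i) (gapN N i) = W N (code a c N i).
    by rewrite -e; apply: eq_word_matrix; apply: (code_word lr c0 aperiodic).
  have := @word_matrix_tail a R x (posN N i) (gapN N i) xE; rewrite ew -posS.
  have [_ _ u0 uv _] := Wb N (code a c N i); move: u0 uv.
  case: (W N (code a c N i)) => [[[s t] u] v]; rewrite /entry1 /entry2 /entry3 /entry4 /= => u0 uv h.
  have /andP[y0 _] := x01 (posN N i.+1).
  have v0 : (0 : R) < v%:R by rewrite ltr0n; lia.
  have d0 : u%:R * x (posN N i.+1) + v%:R != 0 by rewrite gt_eqF // ltr_wpDl // mulr_ge0.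
  by rewrite -h mulfK.
have al_r J : `|(hyp (fun=> x 0%N) : HR) - rr (L entry1) (L entry2) (L entry3) (L entry4) om J 0| <= (hyp (fun N => 2 ^+ N) : HR)^-1 ^+ J.
  exact: (rr_tail hS X01 XE J 0).
apply: (no_hyper_expansion hS al01 al_r m_monic m_size _ (hyper_liouville (x01 0%N) m_irr m_root) _ hyperint_rational_root).
  by have e := hyp_horner_rat m (fun=> x 0%N); rewrite m_root in e; exact: e.
(* As [Jb] is the same at all levels, one return index occurs at almost all of them. *)
move=> L'; pose Jb := (2 * c * (c * (c * L' + c.+1)))%N.
have /choice [jN hjN] : forall N, exists j : 'I_Jb.+1, (0 < j)%N /\
    forall l, (l < L')%N -> code a c N (j + l) = code a c N l.
  move=> N; have [j /andP[j0 jb] hj] := code_recurs lr c0 aperiodic N L'.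
  by have jb' : (j < Jb.+1)%N by []; exists (Ordinal jb').
have [j hj] := uae_ord jN; exists j.
  by have [N <-] := uae_ex hj; case: (hjN N).
move=> l lL; have [N [<- [<- jE]]] := uae_ex (uaeI (hom (j + l)%N) (uaeI (hom l) hj)).
by rewrite -jE; case: (hjN N) => _ ->.
Qed.

End Contradiction.
End HyperTransfer.

Local Open Scope classical_set_scope.

(** * Continued fractions of real numbers and the conclusion *)

Section ContinuedFractions.
Variable R : realType.
Implicit Types (a : int_seq) (x : R).

Lemma iter_shiftE a i n : iter i Defs.shift a n = a (i + n)%N.
Proof. by elim: i n => // i IH n; rewrite iterS /Defs.shift IH addnS. Qed.

Lemma cf_convergent_bounds a n : (forall i, (0 < a i)%N) -> 0 <= cf_convergent R a n <= 1.
Proof.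
elim: n a => [|n IH] a a0 /=; first by rewrite lexx ler01.
have /andP[h0 h1] := IH (Defs.shift a) (fun i => a0 i.+1).
have h : 1 <= (a 0%N)%:R + cf_convergent R (Defs.shift a) n.
  by rewrite -[X in X <= _]addr0 lerD // ler1n.
by rewrite invr_ge0 (le_trans ler01 h) /= invf_le1 // (lt_le_trans ltr01 h).
Qed.

Lemma cf_tail_cvg a x : (forall i, (0 < a i)%N) -> cf_convergent R a @ \oo --> x ->
  [/\ 0 < x, x <= 1 & cf_convergent R (Defs.shift a) @ \oo --> x^-1 - (a 0%N)%:R].
Proof.
move=> a0 cvx.
have cvS : (fun n => cf_convergent R a n.+1) @ \oo --> x by rewrite cvg_shiftS.
have xlim : lim ((fun n => cf_convergent R a n.+1) @ \oo) = x by apply: cvg_lim.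
have x0 : 0 < x.
  apply: (@lt_le_trans _ _ ((a 0%N)%:R + 1)^-1); first by rewrite invr_gt0 ltr_wpDl.
  rewrite -xlim; apply: limr_ge; first by apply/cvg_ex; exists x.
  apply: nearW => n /=; have /andP[h0 h1] := @cf_convergent_bounds (Defs.shift a) n (fun i => a0 i.+1).
  have h : 0 < (a 0%N)%:R + cf_convergent R (Defs.shift a) n by rewrite ltr_pwDl // ltr0n.
  by rewrite lef_pV2 ?posrE ?lerD2l // ltr_wpDl.
split=> //.
  rewrite -xlim; apply: limr_le; first by apply/cvg_ex; exists x.
  by apply: nearW => n; case/andP: (@cf_convergent_bounds a n.+1 a0).
have -> : cf_convergent R (Defs.shift a) = (fun n => (cf_convergent R a n.+1)^-1 - (a 0%N)%:R).
  by apply/funext => n /=; rewrite invrK addrC addKr.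
by apply: cvgB; [apply: cvgV => //; rewrite gt_eqF|apply: cvg_cst].
Qed.

Section Tails.
Variables (a : int_seq) (alpha : R).
Hypotheses (a0 : forall i, (0 < a i)%N) (cva : cf_convergent R a @ \oo --> alpha).

Fixpoint cf_tail i : R := if i is j.+1 then (cf_tail j)^-1 - (a j)%:R else alpha.

Lemma cf_tail_lim i : cf_convergent R (iter i Defs.shift a) @ \oo --> cf_tail i.
Proof.
elim: i => // i IH; have [|_ _] := cf_tail_cvg _ IH; first by move=> j; rewrite iter_shiftE.
by rewrite iter_shiftE addn0.
Qed.

Lemma cf_tail_bounds i : 0 < cf_tail i <= 1.
Proof.
have [|h1 h2 _] := cf_tail_cvg _ (@cf_tail_lim i); first by move=> j; rewrite iter_shiftE.
by rewrite h1.
Qed.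

Lemma cf_tailE i : cf_tail i * ((a i)%:R + cf_tail i.+1) = 1.
Proof. by have /andP[h _] := cf_tail_bounds i; rewrite /= addrC subrK mulfV // gt_eqF. Qed.

(** Descent along Euclid's algorithm: a tail equal to [p / q] has [p < q], and the next tail is a
    fraction of denominator [p]. *)
Lemma cf_tail_not_fraction q i p : (0 < q)%N -> cf_tail i * q%:R <> p%:R.
Proof.
elim/ltn_ind: q i p => q IH i p q0 tq.
have /andP[t0 _] := cf_tail_bounds i; have /andP[s0 _] := cf_tail_bounds i.+1.
have tE := cf_tailE i; set t := cf_tail i in t0 tE tq; set s := cf_tail i.+1 in s0 tE.
have ai : 1 <= (a i)%:R :> R by rewrite ler1n.
have q0' : 0 < q%:R :> R by rewrite ltr0n.
have t1 : t < 1 by nra.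
have p0 : (0 < p)%N by rewrite -(ltr0n R) -tq mulr_gt0.
have pq : (p < q)%N by rewrite -(ltr_nat R) -tq gtr_pMl.
have e : s * p%:R = q%:R - (a i)%:R * p%:R.
  have h : t * ((a i)%:R + s) * q%:R = q%:R by rewrite tE mul1r.
  by rewrite -tq -[X in _ = X - _]h; ring.
have apq : (a i * p <= q)%N.
  rewrite -(ler_nat R) natrM -subr_ge0 -e mulr_ge0 //; exact: ltW.
by apply: (IH p pq i.+1 (q - a i * p)%N p0); rewrite natrB // natrM -e.
Qed.

Lemma cf_irrational : irrational alpha.
Proof.
move=> /rationalP [z [b alE]]; have /andP[al0 _] := cf_tail_bounds 0; rewrite /= in al0.
have [b0|b0] := posnP b; first by move: al0; rewrite alE b0 invr0 mulr0 ltxx.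
have e : alpha * b%:R = z%:~R by rewrite alE mulfVK // pnatr_eq0 -lt0n.
case: z e alE => p e _; first exact: (@cf_tail_not_fraction b 0 p b0).
have : 0 < alpha * b%:R by rewrite mulr_gt0 // ltr0n.
by rewrite e NegzE mulrNz oppr_gt0 ltNge ler0n.
Qed.

(** The Moebius map of one period fixes [alpha]; its fixed points are the roots of
    [u X^2 + (v - s) X - t]. *)
Lemma periodic_quadratic k : (0 < k)%N -> (forall i, a i = a (i + k)%N) ->
  quadratic_irrational alpha.
Proof.
move=> k0 hk; split; first exact: cf_irrational.
have it : iter k Defs.shift a = a by apply/funext => n; rewrite iter_shiftE addnC -hk.
have tk : cf_tail k = alpha.
  by have := @cf_tail_lim k; rewrite it => h; apply: cvg_unique h cva.
have := word_matrix_tail 0 k cf_tailE; have := @word_matrix_bounds a a0 0 k k0.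
rewrite add0n tk /=; case: (word_matrix a 0 k) => [[[s t] u] v] [_ _ u0 _ _] e.
pose l : seq rat := [:: - t%:R; v%:R - s%:R; u%:R].
exists (\poly_(i < 3) l`_i); split.
  by rewrite size_poly_eq //= pnatr_eq0 -lt0n.
rewrite /root (@horner_coef_wide _ 3) ?size_map_poly ?size_poly //.
rewrite !big_ord_recl big_ord0 !coef_map !coef_poly /= rmorphN rmorphB !ratr_nat.
apply/eqP; transitivity (alpha * (u%:R * alpha + v%:R) - (s%:R * alpha + t%:R)).
  by rewrite /bump /=; ring.
by rewrite e subrr.
Qed.

End Tails.

Lemma minimal_polynomial_exists (x : R) : algebraicOver (ratr : rat -> R) x ->
  exists m : {poly rat}, [/\ irreducible_poly m, m \is monic & (map_poly ratr m).[x] = 0].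
Proof.
move=> [p0 p0n p0r].
pose P n := `[< exists m : {poly rat}, [/\ m \is monic, root (map_poly ratr m) x & size m = n] >].
have monicize (q : {poly rat}) : q != 0 -> root (map_poly ratr q) x -> P (size q).
  move=> q0 qr; apply/asboolP; exists ((lead_coef q)^-1 *: q).
  have lq : (lead_coef q)^-1 != 0 by rewrite invr_eq0 lead_coef_eq0.
  split; last by rewrite size_scale.
    by rewrite monicE lead_coefZ mulVf // lead_coef_eq0.
  by rewrite map_polyZ rootZ // fmorph_eq0.
have exP : exists n, P n by exists (size p0); apply: monicize.
have := ex_minnP exP; case=> n /asboolP [m [mm mr <-]] mmin.
have m0 := monic_neq0 mm.
have {}mmin (q : {poly rat}) : q != 0 -> root (map_poly ratr q) x -> (size m <= size q)%N.
  by move=> q0 qr; apply/mmin/monicize.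
exists m; split=> //; last by apply/eqP.
split.
  rewrite ltnNge; apply/negP => sm.
  have mE := size1_polyC sm; move: mr; rewrite mE map_polyC rootC fmorph_eq0 => /eqP c0.
  by move: m0; rewrite mE c0 polyC0 eqxx.
have ar (u v : nat) : u != 1%N -> (0 < u)%N -> (0 < v)%N -> ~~ ((v + u).-1 <= v)%N by lia.
move=> q sq qm; have /dvdpP [r mE] := qm.
have q0 : q != 0 by apply: contraNneq m0 => q0; rewrite mE q0 mulr0.
have r0 : r != 0 by apply: contraNneq m0 => r0; rewrite mE r0 mul0r.
have szm : size m = (size r + size q).-1 by rewrite mE size_mul.
have := mr; rewrite {1}mE rmorphM rootM => /orP[rr|qr].
  have := mmin r r0 rr; rewrite szm; move: sq (size_poly_gt0 q) (size_poly_gt0 r); rewrite q0 r0.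
  by move=> h1 h2 h3 h4; case: (negP (ar _ _ h1 h2 h3)); exact: h4.
by rewrite -(dvdp_size_eqp qm) eqn_leq (dvdp_leq m0 qm) mmin.
Qed.

End ContinuedFractions.

Theorem theorem5 (R : realType) (X : set int_seq)
    (hX : subshift X) (hlr : linearly_recurrent R X) :
  forall alpha : R, cf_set X alpha ->
    quadratic_irrational alpha \/ transcendental alpha.
Proof.
move=> alpha [_ [a Xa cva]]; have [Xpos Xshift] := hX; have [_ [C [C0 hC]]] := hlr.
have a0 i : (0 < a i)%N by apply: Xpos Xa i.
have Xi i : X (iter i Defs.shift a) by elim: i => // i IH; apply: Xshift; exists (iter i Defs.shift a).
have [alg|] := pselect (algebraicOver (ratr : rat -> R) alpha); last by right.
left; have [m [m_irr m_monic m_root]] := minimal_polynomial_exists alg.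
(* Return times grow with the prefix only for an aperiodic sequence, so the periodic case is settled
   directly. *)
have [[k k0 hk]|aper] := pselect (exists2 k, (0 < k)%N & forall i, a i = a (i + k)%N).
  exact: periodic_quadratic k0 hk.
have aperiodic k : (0 < k)%N -> exists i, a i <> a (i + k)%N.
  by move=> k0; apply/existsNP => hk; apply: aper; exists k.
pose c := (Num.truncn C).+1.
have lr i len : (0 < len)%N -> exists k, (0 < k <= c * len)%N /\
    forall l, (l < len)%N -> a (i + k + l)%N = a (i + l)%N.
  move=> len0; pose W := mkseq (iter i Defs.shift a) len.
  have sW : size W = len by rewrite size_mkseq.
  have [||k [k1 kC [_ hk]]] := hC W _ (iter i Defs.shift a).
  - by rewrite -size_eq0 sW -lt0n.
  - by split; rewrite ?sW.
  exists k; rewrite sW in kC hk; split.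
    rewrite k1 /= -(ler_nat R) natrM (le_trans kC) // ler_wpM2r //.
    by apply: ltW; apply: truncnS_gt.
  move=> l ll; have := congr1 (fun s => nth 0%N s l) hk; rewrite /W !nth_mkseq //.
  by rewrite -iterD !iter_shiftE [(k + i)%N]addnC.
have x01 i : 0 <= cf_tail a alpha i <= 1.
  by have /andP[h ->] := cf_tail_bounds a0 cva i; rewrite ltW.
have sz3 : (size m <= 3)%N.
  exact: (irreducible_root_size_le3 (isT : 0 < c)%N lr a0 aperiodic x01 (cf_tailE a0 cva) m_irr m_monic).
have irr := cf_irrational a0 cva.
split=> //; exists m; split; last by apply/eqP.
(* Only degree 1 remains to be excluded; it would make [alpha] rational. *)
apply/eqP; rewrite eqn_leq sz3 ltnNge; apply/negP => sz2.
have sm : size m = 2%N by apply/eqP; rewrite eqn_leq sz2; case: m_irr.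
apply: irr; exists (- m`_0) => //.
have l1 : m`_1 = 1 by move/monicP: m_monic; rewrite lead_coefE sm.
move: m_root; rewrite (@horner_coef_wide _ 2) ?size_map_poly ?sm //.
rewrite !big_ord_recl big_ord0 !coef_map /= l1 rmorph1 rmorphN /bump /= => e.
by apply/eqP; rewrite -subr_eq0 -oppr_eq0 -e; apply/eqP; ring.
Qed.
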